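(* Let $\mathcal A$ be a hermitian unital complex Banach algebra with continuous involution, let $n\ge1$ and let $\delta=(p_1,\dots,p_n)\in\mathcal P_n(\mathcal A)$ with $p_j=p_j^*$ for $j=1,\dots,n$. The unitary Stiefel bundle $\sigma^U\colon\mathcal V^U(\delta,\mathcal A)\to\mathcal V^U(\delta,\mathcal A)/\mathcal G^U(\delta)\simeq\mathrm{Fl}(\delta)$ is a $\mathcal G^U(\delta)$-principal bundle under the right action $$\mathcal V^U(\delta,\mathcal A)\times\mathcal G^U(\delta)\to\mathcal V^U(\delta,\mathcal A),\qquad(up_n,ap_n)\mapsto uap_n,$$ admitting a principal connection $\Phi^U_\delta$ given by $$\Phi^U_\delta\colon\mathfrak u(\mathcal A)p_n\to D^{\mathfrak u}(\delta)p_n,\qquad ap_n\mapsto\Phi_\delta(a)p_n .$$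
   Context: $\mathcal A$ has unit $\mathbf 1$; hermitian means $\sigma(a)\subset\mathbb R$ (spectrum) whenever $a=a^*$. $\mathcal P_n(\mathcal A)$ is the set of $n$-tuples $\delta=(p_1,\dots,p_n)$ of idempotents of $\mathcal A$ with $0=p_0<p_1<\dots<p_n<p_{n+1}=\mathbf 1$, meaning $p_jp_k=p_kp_j=p_j$ for $j\le k$ and $p_j\ne p_{j+1}$. $U(\mathcal A)=\{u\in\mathcal A\mid uu^*=u^*u=\mathbf 1\}$ is a Banach-Lie group with Lie algebra $\mathfrak u(\mathcal A)=\{a\in\mathcal A\mid a^*=-a\}$. $D(\delta)=\{x\in\mathcal A: xp_j=p_jx\ (j=1,\dots,n)\}$, $D^U(\delta)=U(\mathcal A)\cap D(\delta)$, $D^{\mathfrak u}(\delta)=\mathfrak u(\mathcal A)\cap D(\delta)$. The diagonal truncation is $\Phi_\delta\colon\mathcal A\to\mathcal A$, $\Phi_\delta(x)=\sum_{j=1}^{n+1}(p_j-p_{j-1})x(p_j-p_{j-1})$. $\mathrm{Fl}(\delta)=\{(up_1u^{-1},\dots,up_nu^{-1})\mid u\in U(\mathcal A)\}$ with the manifold structure of $U(\mathcal A)/D^U(\delta)$. $\mathcal V^U(\delta,\mathcal A)=\{(up_1,\dots,up_n)\mid u\in U(\mathcal A)\}$, identified with $\{up_n\mid u\in U(\mathcal A)\}$ and, as a manifold, with $U(\mathcal A)/\{u\in U(\mathcal A)\mid up_n=p_n\}$. $\mathcal G^U(\delta)=D^U(\delta)/\{u\in D^U(\delta)\mid up_n=p_n\}\simeq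 D^U(\delta)p_n$. The unitary Stiefel bundle $\sigma^U$ is the quotient projection $up_n\mapsto(up_1u^{-1},\dots,up_nu^{-1})$. The tangent space of $\mathcal V^U(\delta,\mathcal A)$ at the base point $p_n$ is $\mathfrak u(\mathcal A)/\{a\in\mathfrak u(\mathcal A)\mid ap_n=0\}\simeq\mathfrak u(\mathcal A)p_n$. The formula for $\Phi^U_\delta$ describes the connection at the base point; at an arbitrary point $up_n$ it is obtained by left translation, $uap_n\mapsto u\Phi_\delta(a)p_n$ ($u\in U(\mathcal A)$, $a\in\mathfrak u(\mathcal A)$). A principal $G$-bundle $\pi\colon P\to Z$ is a smooth map of Banach manifolds with a smooth free right action $(x,g)\mapsto\mu_g(x)$ of the Banach-Lie group $G$ on $P$ whose orbits are the fibers of $\pi$, and such that every $z\in Z$ has an open neighborhood $V$ with a $G$-equivariant diffeomorphism $\pi^{-1}(V)\to V\times G$ over $V$. A principal connection on it is a smooth map $\Phi\colon TP\to TP$ with $\Phi\circ\Phi=\Phi$, which is an endomorphism of the vector bundle $TP\to P$ over $\mathrm{id}_P$, with $\mathrm{Ran}(\Phi|_{T_xP})=\mathrm{Ker}(T_x\pi)$ for all $x\in P$, and $T(\mu_g)\circ\Phi=\Phi\circ T(\mu_g)$ for all $g\in G$. *)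

(* Defs.v *)
From HB Require Import structures.
From mathcomp Require Import all_boot all_order all_algebra.
From mathcomp Require Import complex.
From mathcomp Require Import all_classical all_reals all_analysis.

Set Implicit Arguments.
Unset Strict Implicit.
Unset Printing Implicit Defensive.

Import Order.TTheory GRing.Theory Num.Theory.
Import numFieldNormedType.Exports.

Local Open Scope classical_set_scope.
Local Open Scope ring_scope.
Local Open Scope complex_scope.

(* A unital complex Banach algebra.  The library's normed modules cannot be
   joined with its rings, so the (real-valued) norm is part of the mixin; the
   underlying real Banach space is [realified A] below, with the same carrier.
   The inverse of a unitAlgType is a total function, and is the inverse only on
   GRing.unit, the set of all invertible elements. *)
HB.mixin Record UnitAlgebra_isBanach (R : realType) A
    & GRing.UnitAlgebra R[i] A := {
  bnorm : A -> R;
  ler_bnormD : forall x y : A, bnorm (x + y) <= bnorm x + bnorm y;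
  bnormZ : forall (z : R[i]) (x : A), bnorm (z *: x) = complex.Re `|z| * bnorm x;
  bnorm0_eq0 : forall x : A, bnorm x = 0 -> x = 0;
  ler_bnormM : forall x y : A, bnorm (x * y) <= bnorm x * bnorm y;
  bnorm_complete : forall u : nat -> A,
    (forall e : R, 0 < e -> exists N : nat, forall m n : nat,
      (N <= m)%N -> (N <= n)%N -> bnorm (u m - u n) < e) ->
    exists l : A, forall e : R, 0 < e -> exists N : nat, forall n : nat,
      (N <= n)%N -> bnorm (l - u n) < e
}.

#[short(type="banachAlgType")]
HB.structure Definition BanachAlgebra (R : realType) :=
  {A of UnitAlgebra_isBanach R A & GRing.UnitAlgebra R[i] A}.

Definition realified (R : realType) (A : banachAlgType R) : Type := A.

Section Realified.
Variables (R : realType) (A : banachAlgType R).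

HB.instance Definition _ := GRing.Zmodule.copy (realified A) A.

Definition rscale (r : R) (x : realified A) : realified A :=
  (r%:C *: (x : A)).

Lemma rscaleA a b v : rscale a (rscale b v) = rscale (a * b) v.
Proof. by rewrite /rscale scalerA rmorphM. Qed.
Lemma rscale1 : left_id 1 rscale.
Proof. by move=> x; rewrite /rscale rmorph1 scale1r. Qed.
Lemma rscaleDr : right_distributive rscale +%R.
Proof. by move=> r x y; rewrite /rscale scalerDr. Qed.
Lemma rscaleDl v : {morph rscale^~ v : a b / a + b}.
Proof. by move=> a b; rewrite /rscale rmorphD scalerDl. Qed.

HB.instance Definition _ := GRing.Zmodule_isLmodule.Build R (realified A)
  rscaleA rscale1 rscaleDr rscaleDl.

Let rnorm (x : realified A) : R := bnorm (x : A).

Let rnormD x y : rnorm (x + y) <= rnorm x + rnorm y.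
Proof. exact: ler_bnormD. Qed.
Let rnormZ (r : R) x : rnorm (r *: x) = `|r| * rnorm x.
Proof.
by rewrite /rnorm bnormZ normc_def /= expr0n addr0 sqrtr_sqr.
Qed.
Let rnorm0_eq0 x : rnorm x = 0 -> x = 0.
Proof. exact: bnorm0_eq0. Qed.

HB.instance Definition _ := Lmodule_isNormed.Build R (realified A)
  rnormD rnormZ rnorm0_eq0.

Lemma realified_normE (x : realified A) : `|x| = bnorm (x : A).
Proof. by []. Qed.

Lemma realified_complete (F : set_system (realified A)) :
  ProperFilter F -> cauchy F -> cvg F.
Proof.
move=> FF /cauchy_ballP Fc.
have e0 n : 0 < (n.+1%:R^-1 : R) by rewrite invr_gt0.
have P n : {x : realified A | F (ball x n.+1%:R^-1)}.
  apply: cid; have FB := Fc _ (e0 n).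
  case: FB => -[P Q] [FP FQ] PQ.
  have [x Px] := filter_ex FP.
  by exists x; apply: filterS FQ => y Qy; exact: (PQ (x, y)).
pose u n := sval (P n).
have uF n : F (ball (u n) n.+1%:R^-1) by exact: (svalP (P n)).
have inv_small (e : R) : 0 < e -> exists N : nat, forall n, (N <= n)%N ->
    n.+1%:R^-1 < e.
  move=> e_gt0; exists (Num.truncn e^-1) => n Nn.
  rewrite -[ltRHS]invrK ltf_pV2 ?posrE ?invr_gt0//.
  apply: (lt_le_trans (truncnS_gt _)); by rewrite ler_nat ltnS.
have [|l ul] := @bnorm_complete R A u.
  move=> e e_gt0; have [|N NE] := inv_small (e / 2); first by rewrite divr_gt0.
  exists N => m n Nm Nn.
  have [x [xm xn]] := filter_ex (filterI (uF m) (uF n)).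
  move: xm xn; rewrite -!ball_normE /= => xm xn.
  rewrite -realified_normE.
  rewrite -(subrKA (x : realified A)) (le_lt_trans (ler_normD _ _))//.
  rewrite [e]splitr ltrD//; first exact: lt_trans (NE _ Nm).
  by rewrite distrC; exact: lt_trans (NE _ Nn).
apply/cvg_ex; exists (l : realified A).
apply/cvgrPdist_lt => e e_gt0.
have [|N1 NE1] := inv_small (e / 2); first by rewrite divr_gt0.
have [|N2 NE2] := ul (e / 2); first by rewrite divr_gt0.
pose n := maxn N1 N2.
apply: filterS (uF n) => y; rewrite -ball_normE /= => un.
rewrite -(subrKA (u n)) (le_lt_trans (ler_normD _ _))//.
rewrite [e]splitr ltrD//; first by apply: NE2; rewrite leq_maxr.
by apply: lt_trans un _; apply: NE1; rewrite leq_maxl.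
Qed.

HB.instance Definition _ :=
  Uniform_isComplete.Build (realified A) realified_complete.

End Realified.

Section Smooth.
Variable R : realType.

(* C^k maps on an open set of a Banach space, by induction along the tangent
   construction: f is C^(k+1) on O when it is Fréchet differentiable on O and
   (x, h) |-> 'd f x h is C^k on O * E.  The resulting notion of C^k is
   slightly weaker than requiring continuity of the iterated derivatives in
   operator norm, but the two notions of smooth map coincide. *)
Fixpoint C_k (k : nat) (E F : normedModType R) (O : set E) (f : E -> F) : Prop :=
  match k with
  | 0 => forall x, O x -> {for x, continuous f}
  | k'.+1 => (forall x, O x -> differentiable f x) /\
             @C_k k' (E * E)%type F [set p | O p.1] (fun p => 'd f (p.1) (p.2))
  end.

Definition smooth (E F : normedModType R) (O : set E) (f : E -> F) : Prop :=
  forall k, C_k k O f.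

Definition closed_subspace (E : normedModType R) (S : set E) : Prop :=
  [/\ S 0, forall (a : R) x y, S x -> S y -> S (a *: x + y) & closed S].

Definition complemented (E : normedModType R) (S : set E) : Prop :=
  closed_subspace S /\
  exists S' : set E, [/\ closed_subspace S', S `&` S' = [set 0] &
    forall x, exists y z, [/\ S y, S' z & x = y + z]].

End Smooth.

Section Manifolds.
Variable R : realType.

(* A manifold is a subset [carrier] of an ambient type T with an atlas; its
   topology is the one for which the charts are homeomorphisms.  The values of
   [cmap] outside [cdom], and of [cinv] outside the image, are irrelevant. *)
Record chart (T : Type) (E : normedModType R) := Chart {
  cdom : set T;
  cmap :> T -> E;
  cinv : E -> T
}.

Record premanifold (T : Type) (E : normedModType R) := PreManifold {
  carrier : set T;
  atlas : set (chart T E)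
}.

Definition chart_at T (E : normedModType R) (M : premanifold T E) (x : T)
  (c : chart T E) : Prop := atlas M c /\ cdom c x.

Definition mopen T (E : normedModType R) (M : premanifold T E) (W : set T) :
    Prop :=
  W `<=` carrier M /\ forall c, atlas M c -> open (c @` (W `&` cdom c)).

Record is_manifold T (E : normedModType R) (M : premanifold T E) : Prop :=
  IsManifold {
  manifold_dom : forall c, atlas M c -> cdom c `<=` carrier M;
  manifold_cover : forall x, carrier M x -> exists c, chart_at M x c;
  manifold_cmapK : forall c x, chart_at M x c -> cinv c (c x) = x;
  manifold_open : forall c d, atlas M c -> atlas M d ->
    open (c @` (cdom c `&` cdom d));
  manifold_smooth : forall c d, atlas M c -> atlas M d ->
    smooth (c @` (cdom c `&` cdom d)) (d \o cinv c);
  manifold_hausdorff : forall x y, carrier M x -> carrier M y -> x <> y ->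
    exists W W', [/\ mopen M W, mopen M W', W x, W' y & W `&` W' = set0]
}.

Definition banach_manifold (E : normedModType R) : premanifold E E :=
  PreManifold setT [set Chart setT id id].

Definition prod_chart T1 T2 (E1 E2 : normedModType R)
    (c : chart T1 E1) (d : chart T2 E2) : chart (T1 * T2) (E1 * E2)%type :=
  Chart (cdom c `*` cdom d) (fun x => (c x.1, d x.2))
        (fun y => (cinv c y.1, cinv d y.2)).

Definition prod_manifold T1 T2 (E1 E2 : normedModType R)
    (M : premanifold T1 E1) (N : premanifold T2 E2) :
    premanifold (T1 * T2) (E1 * E2)%type :=
  PreManifold (carrier M `*` carrier N)
    [set e | exists c d, [/\ atlas M c, atlas N d & e = prod_chart c d]].

Section SmoothMaps.
Variables (T T' : Type) (E E' : normedModType R).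
Variables (M : premanifold T E) (N : premanifold T' E').

Definition smooth_on (W : set T) (f : T -> T') : Prop :=
  forall x, W x -> exists c d (O : set E),
    [/\ chart_at M x c, chart_at N (f x) d, open O /\ O (c x) &
        [/\ O `<=` c @` (W `&` cdom c),
            forall y, O y -> cdom d (f (cinv c y)) &
            smooth O (d \o f \o cinv c)]].

Definition smooth_map (f : T -> T') : Prop := smooth_on (carrier M) f.

End SmoothMaps.

(* A tangent vector of M at tpt is encoded by its components in all the charts
   of M at tpt, which are related by the derivatives of the chart changes; the
   component at a c that is not a chart at tpt is 0, so that equality of
   tangent vectors is equality of their base points and components. *)
Record tvec (T : Type) (E : normedModType R) := TVec {
  tpt : T;
  tcomp : chart T E -> E
}.

Section Tangent.
Variables (T : Type) (E : normedModType R) (M : premanifold T E).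

Definition is_tangent (v : tvec T E) : Prop :=
  [/\ carrier M (tpt v),
      forall c d, chart_at M (tpt v) c -> chart_at M (tpt v) d ->
        tcomp v d = 'd (d \o cinv c) (c (tpt v)) (tcomp v c) &
      forall c, ~ chart_at M (tpt v) c -> tcomp v c = 0].

Definition tangent_space (x : T) : set (tvec T E) :=
  [set v | is_tangent v /\ tpt v = x].

Definition tvec_of (c : chart T E) (x : T) (h : E) : tvec T E :=
  TVec x (fun d => if `[< chart_at M x d >]
                   then 'd (d \o cinv c) (c x) h else 0).

Definition tangent_chart (c : chart T E) : chart (tvec T E) (E * E)%type :=
  Chart [set v | is_tangent v /\ cdom c (tpt v)]
        (fun v => (c (tpt v), tcomp v c))
        (fun p => tvec_of c (cinv c p.1) p.2).

Definition tangent_bundle : premanifold (tvec T E) (E * E)%type :=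
  PreManifold [set v | is_tangent v] [set tangent_chart c | c in atlas M].

Definition tzero (x : T) : tvec T E := TVec x (fun=> 0).
Definition tlin (a : R) (v w : tvec T E) : tvec T E :=
  TVec (tpt v) (fun c => a *: tcomp v c + tcomp w c).

(* complementedness of S as a subspace of the tangent space at x *)
Definition tcomplemented (x : T) (S : set (tvec T E)) : Prop :=
  forall c, chart_at M x c -> complemented [set tcomp v c | v in S].

End Tangent.

Section TangentMap.
Variables (T T' : Type) (E E' : normedModType R).
Variables (M : premanifold T E) (N : premanifold T' E').

(* The component in the chart d of N does not depend on the chart c of M used
   to compute it, when f is smooth and v is tangent to M. *)
Definition tmap (f : T -> T') (v : tvec T E) : tvec T' E' :=
  TVec (f (tpt v)) (fun d =>
    if `[< chart_at N (f (tpt v)) d >] then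
      xget 0 [set h | exists2 c, chart_at M (tpt v) c &
                      h = 'd (d \o f \o cinv c) (c (tpt v)) (tcomp v c)]
    else 0).

Definition tker (f : T -> T') (x : T) : set (tvec T E) :=
  [set v | tangent_space M x v /\ tmap f v = tzero E' (f x)].

Definition submersion (f : T -> T') : Prop :=
  smooth_map M N f /\ forall x, carrier M x ->
    tmap f @` tangent_space M x = tangent_space N (f x) /\
    tcomplemented M x (tker f x).

Definition embedding (f : T -> T') : Prop :=
  [/\ smooth_map M N f,
      forall x y, carrier M x -> carrier M y -> f x = f y -> x = y,
      forall x, carrier M x -> tker f x = [set tzero E x] /\
        tcomplemented N (f x) (tmap f @` tangent_space M x) &
      forall W, mopen M W <->
        exists O, mopen N O /\ W = carrier M `&` f @^-1` O].

End TangentMap.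

Section LieGroups.
Variables (T : Type) (E : normedModType R) (G : premanifold T E).
Variables (mul : T -> T -> T) (one : T).

Record is_lie_group : Prop := IsLieGroup {
  lie_manifold : is_manifold G;
  lie_one : carrier G one;
  lie_mul : forall g h, carrier G g -> carrier G h -> carrier G (mul g h);
  lie_mulA : forall g h k, carrier G g -> carrier G h -> carrier G k ->
    mul g (mul h k) = mul (mul g h) k;
  lie_mul1 : forall g, carrier G g -> mul one g = g /\ mul g one = g;
  lie_mul_smooth :
    smooth_map (prod_manifold G G) G (fun p => mul p.1 p.2);
  lie_inv_smooth : exists inv : T -> T, smooth_map G G inv /\
    forall g, carrier G g ->
      [/\ carrier G (inv g), mul (inv g) g = one & mul g (inv g) = one]
}.

End LieGroups.

Section PrincipalBundles.
Variables (TP TZ TG : Type) (EP EZ EG : normedModType R).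
Variables (P : premanifold TP EP) (Z : premanifold TZ EZ).
Variables (G : premanifold TG EG) (mul : TG -> TG -> TG) (one : TG).
Variables (mu : TP -> TG -> TP) (pi : TP -> TZ).

Definition trivializable_over (V : set TZ) : Prop :=
  exists (tau : TP -> TZ * TG) (taui : TZ * TG -> TP),
  [/\ smooth_on P (prod_manifold Z G) (carrier P `&` pi @^-1` V) tau,
      smooth_on (prod_manifold Z G) P (V `*` carrier G) taui,
      forall x, carrier P x -> V (pi x) ->
        [/\ carrier G (tau x).2, (tau x).1 = pi x, taui (tau x) = x &
            forall g, carrier G g -> tau (mu x g) = (pi x, mul (tau x).2 g)] &
      forall q, V q.1 -> carrier G q.2 ->
        [/\ carrier P (taui q), pi (taui q) = q.1 & tau (taui q) = q]].

Record principal_bundle : Prop := PrincipalBundle {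
  pb_total : is_manifold P;
  pb_base : is_manifold Z;
  pb_group : is_lie_group G mul one;
  pb_proj : smooth_map P Z pi;
  pb_act : smooth_map (prod_manifold P G) P (fun q => mu q.1 q.2);
  pb_act1 : forall x, carrier P x -> mu x one = x;
  pb_actM : forall x g h, carrier P x -> carrier G g -> carrier G h ->
    mu x (mul g h) = mu (mu x g) h;
  pb_free : forall x g, carrier P x -> carrier G g -> mu x g = x -> g = one;
  pb_fibers : forall x y, carrier P x -> carrier P y ->
    (pi y = pi x <-> exists2 g, carrier G g & y = mu x g);
  pb_trivial : forall z, carrier Z z ->
    exists V, [/\ mopen Z V, V z & trivializable_over V]
}.

Record principal_connection (Phi : tvec TP EP -> tvec TP EP) : Prop :=
  PrincipalConnection {
  pc_smooth : smooth_map (tangent_bundle P) (tangent_bundle P) Phi;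
  pc_fiber : forall x v, tangent_space P x v -> tangent_space P x (Phi v);
  pc_linear : forall x a v w, tangent_space P x v -> tangent_space P x w ->
    Phi (tlin a v w) = tlin a (Phi v) (Phi w);
  pc_idem : forall v, is_tangent P v -> Phi (Phi v) = Phi v;
  pc_range : forall x, carrier P x ->
    Phi @` tangent_space P x = tker P Z pi x;
  pc_equivariant : forall g v, carrier G g -> is_tangent P v ->
    tmap P P (mu^~ g) (Phi v) = Phi (tmap P P (mu^~ g) v)
}.

End PrincipalBundles.

(* N is the quotient manifold of M by the fibers of q *)
Definition quotient_manifold T T' (E E' : normedModType R)
    (M : premanifold T E) (N : premanifold T' E') (q : T -> T') : Prop :=
  [/\ is_manifold N, carrier N = q @` carrier M & submersion M N q].

End Manifolds.

Section BanachStarAlgebras.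
Variables (R : realType) (A : banachAlgType R).

Record involution (star : A -> A) : Prop := Involution {
  starD : forall x y, star (x + y) = star x + star y;
  starZ : forall (z : R[i]) x, star (z *: x) = z^* *: star x;
  starM : forall x y, star (x * y) = star y * star x;
  starK : forall x, star (star x) = x
}.

Definition spectrum (a : A) : set R[i] :=
  [set z | a - z%:A \isn't a GRing.unit].

Definition hermitian_algebra (star : A -> A) : Prop :=
  forall a, a = star a -> forall z, spectrum a z -> z \is Num.real.

Variables (n : nat) (delta : 'I_n -> A).

(* p_j for 0 <= j <= n+1, where delta = (p_1, ..., p_n), p_0 = 0 and
   p_(n+1) = 1 *)
Definition flag_idem (j : nat) : A :=
  if j is i.+1 then (if insub i is Some o then delta o else 1) else 0.

Definition is_flag : Prop :=
  (forall j k, (j <= k <= n.+1)%N ->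
     flag_idem j * flag_idem k = flag_idem j /\
     flag_idem k * flag_idem j = flag_idem j) /\
  (forall j, (j <= n)%N -> flag_idem j <> flag_idem j.+1).

Definition block_diagonal : set A :=
  [set x | forall j, x * delta j = delta j * x].

Definition truncation (x : A) : A :=
  \sum_(1 <= j < n.+2) (flag_idem j - flag_idem j.-1) * x *
                       (flag_idem j - flag_idem j.-1).

Definition flag_conj (u : A) : 'I_n -> A := fun j => u * delta j * u^-1.

Variable star : A -> A.

Definition unitary_group : set A := [set u | u * star u = 1 /\ star u * u = 1].
Definition skew_adjoint : set A := [set a | star a = - a].

(* M, with carrier contained in A, is viewed in the real Banach space
   underlying A: the image in A of a tangent vector under the tangent map of
   the inclusion *)
Definition velocity (E : normedModType R) (M : premanifold A E)
    (v : tvec A E) : realified A :=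
  tcomp (tmap M (banach_manifold (realified A)) (id : A -> realified A) v)
        (Chart setT id id).

(* U is a Banach-Lie group under the product of A, and a (split) submanifold
   of A, with Lie algebra L *)
Definition unitary_lie_group (E : normedModType R) (U : premanifold A E)
    (L : set A) : Prop :=
  [/\ is_lie_group U *%R 1,
      embedding U (banach_manifold (realified A)) (id : A -> realified A) &
      velocity U @` tangent_space U 1 = L].

End BanachStarAlgebras.

(* Main.v *)
Require Import Defs.
From HB Require Import structures.
From Stdlib Require Import -(notations) Ncring Ncring_tac.
From mathcomp Require Import all_boot all_order all_algebra.
From mathcomp Require Import complex ring lra.
From mathcomp Require Import all_classical all_reals all_analysis.

Set Implicit Arguments.
Unset Strict Implicit.
Unset Printing Implicit Defensive.

Import Order.TTheory GRing.Theory Num.Theory.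
Import numFieldNormedType.Exports.

Local Open Scope classical_set_scope.
Local Open Scope ring_scope.

(** All the manifolds of the statement are coset spaces H/K of one kind.  Let EH
    and EK be commuting projections of A onto star-subalgebras, linear over their
    ranges and compatible with the involution, with EH 1 = 1.  Let H be the group
    of the unitaries in Ran EH, and K its subgroup of the u with u - 1 in Ran EK.
    Writing Phi for the truncation and q x q, q = 1 - p_n, for the corner of x,
    the pairs (EH, EK) are (id, 0) for U(A), (Phi, 0) for D^U, (id, corner) for
    the Stiefel manifold V, (Phi, corner) for the structure group G and (id, Phi)
    for the flag manifold.

    A slice for H/K near the unit.  Put kap u = 1 + EK (u - 1); then
    kap (u d) = (kap u) d for d in K.  If kap u is invertible and
    kap u (kap u)^* is close to 1, the polar decomposition of kap u provides an
    element d = (kap u)^* (kap u (kap u)^* )^(-1/2) of K, and v = u d depends only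
    on the coset of u and has kap v selfadjoint.  The skew part a of v then
    satisfies EK a = 0, and as v is unitary, its selfadjoint part t satisfies
    t t = 1 + a a.  So the coset is determined by a, through
    v = a + sqrt (1 + a a), and a ranges over an open set of the complement
    {a skew in Ran EH, EK a = 0} of the Lie algebra of K (slice_chartP,
    slice_secP).  Translating this chart by the elements of H gives an atlas
    (hom_is_manifold), and also local sections of H -> H/K.

    The only analytic input is a square root near the unit, smooth for the notion
    in use.  It is the fixed point of a contraction; differentiating the equation
    (1 + h)^2 = 1 + k leads to 2 l + h l + l g = k', whose solution is smooth in
    (h, g, k') because its derivative solves an equation of the same form
    (smooth_sylvester, smooth_sqrt1).

    Smoothness and tangent maps are computed in A: the unitaries present every
    H/K, charts extend to smooth maps on open sets of A, and a tangent vector at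
    the class of u is represented by u a with a in the Lie algebra of H, modulo
    that of K (smooth_on_lift, tmap_tpush, hom_tpush_eq).  In these terms the
    projection, the action and the group operations are covered by continuous
    linear and bilinear maps of A, the local sections of the flag manifold trivialize the
    bundle (hom_principal_bundle), and the connection is u a |-> u (Phi a).  It is
    well defined and equivariant because Phi commutes with conjugation by D^U and
    with the corner; its range is vertical because Phi is the projection onto the
    Lie algebra of D^U (hom_principal_connection). *)

(** * Differential calculus of smooth maps *)

Section Differentiation.
Variable R : realType.
Implicit Types E F G H : normedModType R.

Definition cont_linear E F (L : E -> F) : Prop := linear L /\ continuous L.

Lemma cont_linear_is_diff E F (L : E -> F) x :
  cont_linear L -> is_diff x L L.
Proof.
move=> [lL cL].
pose LM := GRing.isLinear.Build _ _ _ _ L lL.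
pose LL : {linear E -> F} := HB.pack L LM.
apply: DiffDef; first exact: (@linear_differentiable _ _ _ LL).
exact: (@diff_lin _ _ _ LL).
Qed.

Lemma diff_cont_linear E F (f : E -> F) x :
  differentiable f x -> cont_linear ('d f x).
Proof. by move=> df; split; [exact: linearP|exact: diff_continuous]. Qed.

(** The epsilon form of differentiability, in which the derivatives of the
    maps defined by an equation are found below. *)
Lemma is_diffP E F (f L : E -> F) x :
  is_diff x f L <-> cont_linear L /\
    (forall e : R, 0 < e ->
       \forall h \near (0 : E), `|f (h + x) - f x - L h| <= e * `|h|).
Proof.
split=> [[df <-]|[[lL cL] fL]].
  split; first exact: diff_cont_linear.
  move=> e e0; have /diff_locallyxP[_ fE] := df.
  have canc (a b c : F) : a + b + c - a - b = c.
    by rewrite -(addrA _ (- a)) -opprD addrAC subrr add0r.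
  near=> h; rewrite fE canc; near: h; exact: littleoP.
pose LM := GRing.isLinear.Build _ _ _ _ L lL.
pose LL : {linear E -> F} := HB.pack L LM.
have fE : f \o shift x = cst (f x) + LL +o_ 0 id.
  apply/eqaddoP => _/posnumP[e]; near=> h.
  rewrite /= !fctE opprD addrA; near: h; exact: fL.
have dfE : 'd f x = L :> (E -> F) by exact: (@diff_unique _ _ _ f LL).
by apply: DiffDef => //; apply/diff_locallyP; rewrite dfE.
Unshelve. all: by end_near. Qed.

Lemma is_diff_near E F (f g L : E -> F) x :
  {near x, f =1 g} -> is_diff x f L -> is_diff x g L.
Proof.
move=> fg /is_diffP[cL fL]; apply/is_diffP; split=> // e e0.
have gx : f x = g x by exact: nbhs_singleton fg.
have fg0 : \forall h \near (0 : E), f (h + x) = g (h + x).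
  by move: fg; rewrite (near_shift 0) subr0.
near=> h.
rewrite -gx; have <- : f (h + x) = g (h + x) by near: h.
by near: h; exact: fL.
Unshelve. all: by end_near. Qed.

Lemma near_diffE E F (f g : E -> F) x :
  {near x, f =1 g} -> differentiable f x ->
  differentiable g x /\ 'd g x = 'd f x :> (E -> F).
Proof.
move=> fg df; have dfx : is_diff x f ('d f x) by apply: DiffDef.
by have [] := is_diff_near fg dfx.
Qed.

Lemma cont_linear_comp E F G (L : E -> F) (M : F -> G) :
  cont_linear L -> cont_linear M -> cont_linear (M \o L).
Proof.
move=> [lL cL] [lM cM]; split=> [a u v /=|x]; first by rewrite lL lM.
exact: (@continuous_comp _ _ _ L M x (cL x) (cM _)).
Qed.

Lemma cont_linear_pair E F G (L : E -> F) (M : E -> G) :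
  cont_linear L -> cont_linear M -> cont_linear (fun x => (L x, M x)).
Proof.
move=> [lL cL] [lM cM]; split=> [a u v /=|x]; first by rewrite lL lM.
by apply: cvg_pair; [exact: cL|exact: cM].
Qed.

Lemma cont_linear_id E : cont_linear (@id E).
Proof. by split=> // x. Qed.

Lemma cont_linear_fst E F : cont_linear (@fst E F).
Proof. by split=> // x; exact: cvg_fst. Qed.

Lemma cont_linear_snd E F : cont_linear (@snd E F).
Proof. by split=> // x; exact: cvg_snd. Qed.

Lemma cont_linear0 E F : cont_linear (fun _ : E => 0 : F).
Proof. by split=> [a u v|x]; [rewrite scaler0 addr0|exact: cst_continuous]. Qed.

Lemma cont_linearD E F (L M : E -> F) :
  cont_linear L -> cont_linear M -> cont_linear (fun x => L x + M x).
Proof.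
move=> [lL cL] [lM cM]; split=> [a u v|x].
  by rewrite lL lM scalerDr addrACA.
by apply: cvgD; [exact: cL|exact: cM].
Qed.

Lemma cont_linearZ E F (a : R) (L : E -> F) :
  cont_linear L -> cont_linear (fun x => a *: L x).
Proof.
move=> [lL cL]; split=> [b u v|x]; last by apply: cvgZr; exact: cL.
by rewrite lL scalerDr !scalerA mulrC.
Qed.

Lemma cont_linearN E F (L : E -> F) :
  cont_linear L -> cont_linear (fun x => - L x).
Proof.
move=> lL; have -> : (fun x => - L x) = (fun x => (-1) *: L x).
  by apply/funext => x; rewrite scaleN1r.
exact: cont_linearZ.
Qed.

Lemma cont_linearB E F (L M : E -> F) :
  cont_linear L -> cont_linear M -> cont_linear (fun x => L x - M x).
Proof. by move=> lL lM; apply: cont_linearD => //; exact: cont_linearN. Qed.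

Section ContLinearTheory.
Variables (E F : normedModType R) (L : E -> F).
Hypothesis lL : cont_linear L.

Lemma clinD x y : L (x + y) = L x + L y.
Proof. by have := lL.1 1 x y; rewrite !scale1r. Qed.

Lemma clin0 : L 0 = 0.
Proof. by apply: (@addrI _ (L 0)); rewrite -clinD !addr0. Qed.

Lemma clinZ a x : L (a *: x) = a *: L x.
Proof. by have := lL.1 a x 0; rewrite !addr0 clin0 addr0. Qed.

Lemma clinN x : L (- x) = - L x.
Proof. by rewrite -scaleN1r clinZ scaleN1r. Qed.

Lemma clinB x y : L (x - y) = L x - L y.
Proof. by rewrite clinD clinN. Qed.

End ContLinearTheory.

Lemma near0_le E (e : R) : 0 < e -> \forall h \near (0 : E), `|h| <= e.
Proof.
move=> e0; near=> h; rewrite -normrN -sub0r; near: h.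
by apply: (@cvgrPdist_le _ _ _ _ _ id (0 : E)).1 e0; exact: cvg_id.
Unshelve. all: by end_near. Qed.

Lemma bounded_cont_linear E F (L : E -> F) (c : R) : linear L ->
  (forall x, `|L x| <= c * `|x|) -> cont_linear L.
Proof.
move=> lL Lc; split=> // x; apply/cvgrPdist_le => e e0.
have Lb y : L x - L y = L (x - y).
  by have := lL (-1) y x; rewrite !scaleN1r ![- _ + _]addrC.
have d0 : 0 < e / (`|c| + 1) by rewrite divr_gt0// ltr_pwDr.
near=> y; rewrite Lb (le_trans (Lc _))//.
have xy : `|x - y| <= e / (`|c| + 1).
  by near: y; apply: (@cvgrPdist_le _ _ _ _ _ id x).1 d0; exact: cvg_id.
apply: (@le_trans _ _ ((`|c| + 1) * (e / (`|c| + 1)))).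
  apply: (@le_trans _ _ ((`|c| + 1) * `|x - y|)); last first.
    by rewrite ler_wpM2l// addr_ge0.
  by rewrite ler_wpM2r// (le_trans (ler_norm c))// lerDl.
by rewrite mulrC divfK// gt_eqF// ltr_pwDr.
Unshelve. all: by end_near. Qed.

Definition cont_bilinear E F G (b : E -> F -> G) : Prop :=
  [/\ forall y, linear (b ^~ y), forall x, linear (b x) &
      continuous (fun p : E * F => b p.1 p.2)].

Lemma cont_bilinear_is_diff E F G (b : E -> F -> G) p : cont_bilinear b ->
  is_diff p (fun q => b q.1 q.2) (fun q => b p.1 q.2 + b q.1 p.2).
Proof.
move=> [bl br bc].
have bb : bilinear_for
    (GRing.Scale.Law.clone _ _ *:%R _) (GRing.Scale.Law.clone _ _ *:%R _) b.
  by split=> [y|x] a u v /=; rewrite ?bl ?br.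
pose bM := bilinear_isBilinear.Build R E F G _ _ b bb.
pose bL : {bilinear E -> F -> G} := HB.pack b bM.
apply: DiffDef; first exact: (@differentiable_bilin _ _ _ _ bL).
exact: (@diff_bilin _ _ _ _ bL).
Qed.

End Differentiation.

Section SmoothCalculus.
Variable R : realType.
Implicit Types E F G H : normedModType R.

Lemma open_fst E F (O : set E) : open O -> open [set p : E * F | O p.1].
Proof. by move=> oO; apply: (@open_comp _ _ fst) => // p _; exact: cvg_fst. Qed.

Lemma open_nearE E F (f g : E -> F) (O : set E) x :
  open O -> O x -> (forall y, O y -> f y = g y) -> {near x, f =1 g}.
Proof. by move=> oO Ox fg; apply: filterS (open_nbhs_nbhs (conj oO Ox)). Qed.

Lemma C_k_ext k E F (O : set E) (f g : E -> F) :
  open O -> (forall x, O x -> f x = g x) -> C_k k O f -> C_k k O g.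
Proof.
elim: k E F O f g => [|k IH] E F O f g oO fg /=.
  move=> fc x Ox; have fgx := open_nearE oO Ox fg.
  have fx : f @ x --> g x by rewrite -(fg x Ox); exact: fc.
  by apply: cvg_trans fx; exact: near_eq_cvg.
move=> [df cf]; split=> [x Ox|].
  by have [] := near_diffE (open_nearE oO Ox fg) (df x Ox).
apply: IH cf; first exact: open_fst.
move=> p Op; have [_ e] := near_diffE (open_nearE oO Op fg) (df _ Op).
exact: (esym (congr1 (fun h : E -> F => h p.2) e)).
Qed.

(** Needed because the tangent map of f involves f itself, so that the
    inductions on k meet f with one derivative more than they use. *)
Lemma C_kS k E F (O : set E) (f : E -> F) : C_k k.+1 O f -> C_k k O f.
Proof.
elim: k E F O f => [|k IH] E F O f [df cf].
  by move=> x /df; exact: differentiable_continuous.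
by split=> //; exact: IH.
Qed.

Lemma C_k_sub k E F (O O' : set E) (f : E -> F) :
  O' `<=` O -> C_k k O f -> C_k k O' f.
Proof.
elim: k E F O O' f => [|k IH] E F O O' f OO' /=.
  by move=> fc x /OO'; exact: fc.
move=> [df cf]; split; first by move=> x /OO'; exact: df.
by apply: IH cf => p /=; exact: OO'.
Qed.

Lemma C_k_lin k E F (O : set E) (L : E -> F) : cont_linear L -> C_k k O L.
Proof.
elim: k E F O L => [|k IH] E F O L lL; first by move=> x _; exact: lL.2.
split=> [x _|]; first by case: (cont_linear_is_diff x lL).
have -> : (fun p : E * E => 'd L (p.1) (p.2)) = L \o snd.
  by apply/funext => p; have dL := cont_linear_is_diff p.1 lL; rewrite diff_val.
by apply: IH; apply: cont_linear_comp lL; exact: cont_linear_snd.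
Qed.

Lemma C_k_cst k E F (O : set E) (c : F) : C_k k O (fun=> c).
Proof.
case: k => [|k] /=; first by move=> x _; exact: cst_continuous.
split=> [x _|]; first exact: differentiable_cst.
have -> : (fun p : E * E => 'd (fun=> c) (p.1) (p.2)) = fun=> 0.
  by apply/funext => p; have -> := diff_cst c p.1.
by apply: C_k_lin; exact: cont_linear0.
Qed.

Lemma C_k_pair k E F G (O : set E) (f : E -> F) (g : E -> G) :
  open O -> C_k k O f -> C_k k O g -> C_k k O (fun x => (f x, g x)).
Proof.
elim: k E F G O f g => [|k IH] E F G O f g oO /=.
  by move=> fc gc x Ox; apply: cvg_pair; [exact: fc|exact: gc].
move=> [df cf] [dg cg]; split=> [x Ox|].
  by apply: differentiable_pair; [exact: df|exact: dg].
apply: (@C_k_ext k _ _ _ (fun p => ('d f (p.1) (p.2), 'd g (p.1) (p.2)))).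
- exact: open_fst.
- by move=> p /= Op; rewrite diff_pair//; [exact: df|exact: dg].
- by apply: IH => //; exact: open_fst.
Qed.

(** The chain rule says that the tangent map of a composite is the composite
    of the tangent maps, so the induction on k applies to it verbatim. *)
Lemma C_k_comp k E F G (O : set E) (O' : set F) (f : E -> F) (g : F -> G) :
  open O -> open O' -> (forall x, O x -> O' (f x)) ->
  C_k k O f -> C_k k O' g -> C_k k O (g \o f).
Proof.
elim: k E F G O O' f g => [|k IH] E F G O O' f g oO oO' OO' /=.
  by move=> fc gc x Ox; apply: continuous_comp; [exact: fc|exact/gc/OO'].
move=> [df cf] [dg cg]; split=> [x Ox|].
  by apply: differentiable_comp; [exact: df|exact/dg/OO'].
apply: (@C_k_ext k _ _ _
  ((fun p => 'd g (p.1) (p.2)) \o (fun p => (f p.1, 'd f (p.1) (p.2))))).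
- exact: open_fst.
- move=> p /= Op; have -> : 'd (g \o f) (p.1) = 'd g (f p.1) \o 'd f (p.1) :> (E -> G).
    by apply: diff_comp; [exact: df|exact/dg/OO'].
  by [].
- apply: (IH _ _ _ _ [set p : F * F | O' p.1]) => //.
  + exact: open_fst.
  + exact: open_fst.
  + by move=> p /= Op; exact: OO'.
  + apply: C_k_pair => //; first exact: open_fst.
    apply: (IH _ _ _ _ O _ f) => //; first exact: open_fst.
      by apply: C_k_lin; exact: cont_linear_fst.
    exact: C_kS.
Qed.

Lemma cont_linear_add E : cont_linear (fun p : E * E => p.1 + p.2).
Proof. by apply: cont_linearD; [exact: cont_linear_fst|exact: cont_linear_snd]. Qed.

(** The derivative of b at p is q |-> b p.1 q.2 + b q.1 p.2, again built from
    b and linear maps: no order of differentiability is ever lost. *)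
Lemma C_k_bilin k E F G (b : E -> F -> G) : cont_bilinear b ->
  C_k k setT (fun p => b p.1 p.2).
Proof.
move=> bb; elim: k => [|k IH]; first by case: bb => _ _ bc p _; exact: bc.
split=> [p _|]; first by case: (cont_bilinear_is_diff p bb).
have -> : (fun p : (E * F) * (E * F) => 'd (fun q => b q.1 q.2) (p.1) (p.2)) =
   (fun q : G * G => q.1 + q.2) \o
   (fun p => (((fun q => b q.1 q.2) \o (fun p => (p.1.1, p.2.2))) p,
              ((fun q => b q.1 q.2) \o (fun p => (p.2.1, p.1.2))) p)).
  by apply/funext => p; have dp := cont_bilinear_is_diff p.1 bb; rewrite diff_val.
have oT (X : normedModType R) : open [set: X] by exact: openT.
have -> : [set p : (E * F) * (E * F) | [set: E * F] p.1] = setT by [].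
apply: (@C_k_comp k _ _ _ _ setT) => //; last first.
  by apply: C_k_lin; exact: cont_linear_add.
have lin11 : cont_linear (fun p : (E * F) * (E * F) => p.1.1).
  exact: cont_linear_comp (@cont_linear_fst _ _ _) (@cont_linear_fst _ _ _).
have lin12 : cont_linear (fun p : (E * F) * (E * F) => p.1.2).
  exact: cont_linear_comp (@cont_linear_fst _ _ _) (@cont_linear_snd _ _ _).
have lin21 : cont_linear (fun p : (E * F) * (E * F) => p.2.1).
  exact: cont_linear_comp (@cont_linear_snd _ _ _) (@cont_linear_fst _ _ _).
have lin22 : cont_linear (fun p : (E * F) * (E * F) => p.2.2).
  exact: cont_linear_comp (@cont_linear_snd _ _ _) (@cont_linear_snd _ _ _).
apply: C_k_pair => //; apply: (@C_k_comp k _ _ _ _ setT) => //;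
  by apply: C_k_lin; exact: cont_linear_pair.
Qed.

Lemma smooth_ext E F (O : set E) (f g : E -> F) :
  open O -> (forall x, O x -> f x = g x) -> smooth O f -> smooth O g.
Proof. by move=> oO fg sf k; exact: C_k_ext (sf k). Qed.

Lemma smooth_sub E F (O O' : set E) (f : E -> F) :
  O' `<=` O -> smooth O f -> smooth O' f.
Proof. by move=> OO' sf k; exact: C_k_sub (sf k). Qed.

Lemma smooth_lin E F (O : set E) (L : E -> F) : cont_linear L -> smooth O L.
Proof. by move=> lL k; exact: C_k_lin. Qed.

Lemma smooth_cst E F (O : set E) (c : F) : smooth O (fun=> c).
Proof. by move=> k; exact: C_k_cst. Qed.

Lemma smooth_id E (O : set E) : smooth O (@id E).
Proof. by apply: smooth_lin; exact: cont_linear_id. Qed.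

Lemma smooth_pair E F G (O : set E) (f : E -> F) (g : E -> G) :
  open O -> smooth O f -> smooth O g -> smooth O (fun x => (f x, g x)).
Proof. by move=> oO sf sg k; exact: C_k_pair. Qed.

Lemma smooth_comp E F G (O : set E) (O' : set F) (f : E -> F) (g : F -> G) :
  open O -> open O' -> (forall x, O x -> O' (f x)) ->
  smooth O f -> smooth O' g -> smooth O (fun x => g (f x)).
Proof. by move=> oO oO' OO' sf sg k; exact: (C_k_comp oO oO' OO' (sf k) (sg k)). Qed.

Lemma smooth_linc E F G (O : set E) (f : E -> F) (L : F -> G) :
  open O -> cont_linear L -> smooth O f -> smooth O (fun x => L (f x)).
Proof.
move=> oO lL sf; apply: (@smooth_comp _ _ _ _ setT) => //; first exact: openT.
exact: smooth_lin.
Qed.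

Lemma smooth_bilin E F G H (b : F -> G -> H) (O : set E) (f : E -> F)
    (g : E -> G) : open O -> cont_bilinear b ->
  smooth O f -> smooth O g -> smooth O (fun x => b (f x) (g x)).
Proof.
move=> oO bb sf sg.
apply: (@smooth_comp _ _ _ _ setT (fun x => (f x, g x))
  (fun p => b p.1 p.2)) => //; first exact: openT.
  exact: smooth_pair.
by move=> k; exact: C_k_bilin.
Qed.

Lemma smoothD E F (O : set E) (f g : E -> F) : open O ->
  smooth O f -> smooth O g -> smooth O (fun x => f x + g x).
Proof.
move=> oO sf sg.
apply: (@smooth_linc _ _ _ _ (fun x => (f x, g x)) (fun p => p.1 + p.2)) => //.
  exact: cont_linear_add.
exact: smooth_pair.
Qed.

Lemma smoothB E F (O : set E) (f g : E -> F) : open O ->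
  smooth O f -> smooth O g -> smooth O (fun x => f x - g x).
Proof.
move=> oO sf sg; apply: smoothD => //; apply: smooth_linc => //.
by apply: cont_linearN; exact: cont_linear_id.
Qed.

Lemma smooth_differentiable E F (O : set E) (f : E -> F) x :
  smooth O f -> O x -> differentiable f x.
Proof. by move=> /(_ 1%N)[df _]; exact: df. Qed.

Lemma smooth_continuous E F (O : set E) (f : E -> F) x :
  smooth O f -> O x -> {for x, continuous f}.
Proof. by move=> /(_ 0%N); apply. Qed.

Lemma smooth_diff E F (O : set E) (f : E -> F) :
  smooth O f -> smooth [set p | O p.1] (fun p : E * E => 'd f (p.1) (p.2)).
Proof. by move=> sf k; have [] := sf k.+1. Qed.

Lemma open_preimage_on E F (O : set E) (O' : set F) (f : E -> F) :
  open O -> open O' -> (forall x, O x -> {for x, continuous f}) ->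
  open (O `&` f @^-1` O').
Proof.
move=> oO oO' cf; rewrite openE => x [Ox O'fx].
apply: filterI; first by apply: open_nbhs_nbhs; split.
by apply: (cf x Ox); apply: open_nbhs_nbhs; split.
Qed.

Lemma smooth_preimage E F (O : set E) (O' : set F) (f : E -> F) :
  open O -> open O' -> smooth O f -> open (O `&` f @^-1` O').
Proof.
by move=> oO oO' sf; apply: open_preimage_on => // x; exact: smooth_continuous.
Qed.

End SmoothCalculus.

(** * Identities in noncommutative rings *)

(** The reflexive tactic for noncommutative rings works on a type class; these
    instances make it prove identities in any ring of the hierarchy. *)
Section NoncommutativeRing.
Variable V : pzRingType.

#[local] Instance ncring_ops :
  @Ring_ops V 0 1 +%R *%R (fun x y => x - y) -%R (@eq V).
Defined.

#[local] Instance ncring : Ring (Ro := ncring_ops).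
Proof.
constructor; try exact _;
  rewrite /equality /eq_notation /addition /multiplication /mul_notation
    /zero /zero_notation /one /one_notation /opposite /opp_notation
    /add_notation /ncring_ops /=.
all: try (by repeat intro; subst).
- exact: add0r.
- exact: addrC.
- exact: addrA.
- exact: mul1r.
- exact: mulr1.
- exact: mulrA.
- by move=> *; rewrite mulrDl.
- by move=> *; rewrite mulrDr.
- exact: addrN.
Qed.

End NoncommutativeRing.

#[global] Existing Instances ncring_ops ncring.

Ltac ncring := rewrite ?mulr2n; non_commutative_ring.

(** * The Sylvester equation and the square root near the unit *)

(** The real Banach space underlying A is used as a ring as well, so that
    smooth maps can be written with products. *)
HB.instance Definition _ (R : realType) (A : banachAlgType R) :=
  GRing.UnitRing.copy (realified A) A.

Lemma contraction_fixpoint (R : realType)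
    (E : completeNormedModType R) (U : set E) (f : E -> E) :
  closed U -> U !=set0 -> (forall x : E, U x -> U (f x)) ->
  (forall x y : E, U x -> U y -> `|f x - f y| <= 2^-1 * `|x - y|) ->
  exists2 x : E, U x & x = f x.
Proof.
move=> cU U0 Uf fl.
have homo_f : {homo f : x / U x >-> U x} by [].
pose F : {fun U >-> U} := mkfun homo_f.
have ctr : is_contraction F.
  have h0 : 0 <= 2^-1 :> R by rewrite invr_ge0.
  exists (NngNum h0); split => /=; first by rewrite invf_lt1// ltr1n.
  by move=> [x y] /= [Ux Uy]; exact: fl.
exact: banach_fixed_point ctr cU U0.
Qed.

Section BanachAlgebra.
Variables (R : realType) (A : banachAlgType R).
Local Notation W := (realified A).
Implicit Types x y h k l : W.

Lemma norm_mul_le x y : `|x * y| <= `|x| * `|y|.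
Proof. exact: ler_bnormM. Qed.

Lemma scale_mull (a : R) x y : a *: (x * y) = (a *: x) * y.
Proof. exact: (@scalerAl _ A). Qed.

Lemma scale_mulr (a : R) x y : a *: (x * y) = x * (a *: y).
Proof. exact: (@scalerAr _ A). Qed.

Lemma mul_cont_bilinear : cont_bilinear (fun x y : W => x * y).
Proof.
split=> [y a u v|x a u v|].
- by rewrite mulrDl -scale_mull.
- by rewrite mulrDr -scale_mulr.
move=> [x y]; apply/cvgrPdist_le => /= e e0.
have c0 : 0 < `|x| + `|y| + 1 by rewrite ltr_wpDl// addr_ge0.
near=> p.
have pE : x * y - p.1 * p.2 = (x - p.1) * p.2 + x * (y - p.2).
  ncring.
rewrite pE; apply: (le_trans (ler_normD _ _)).
have p1 : `|x - p.1| <= e / (2 * (`|x| + `|y| + 1)).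
  near: p; apply: (@cvgrPdist_le R _ _ _ _ fst x).1; first exact: cvg_fst.
  by rewrite divr_gt0// mulr_gt0.
have p2 : `|y - p.2| <= e / (2 * (`|x| + `|y| + 1)).
  near: p; apply: (@cvgrPdist_le R _ _ _ _ snd y).1; first exact: cvg_snd.
  by rewrite divr_gt0// mulr_gt0.
have p3 : `|y - p.2| <= 1.
  by near: p; apply: (@cvgrPdist_le R _ _ _ _ snd y).1; first exact: cvg_snd.
have p4 : `|p.2| <= `|y| + 1.
  rewrite -[p.2](subKr y) (le_trans (ler_normB _ _))// lerD2l//.
set d := e / _ in p1 p2.
have dE : d * (`|x| + `|y| + 1) = e / 2.
  by rewrite /d invfM mulrA mulfVK// gt_eqF.
have -> : e = e / 2 + e / 2 by lra.
apply: lerD; apply: (le_trans (norm_mul_le _ _)).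
  by rewrite -dE ler_pM// (le_trans p4)// lerD2r lerDr.
by rewrite -dE mulrC ler_pM// -addrA lerDl addr_ge0.
Unshelve. all: by end_near. Qed.

Lemma smoothM (E : normedModType R) (O : set E) (f g : E -> W) : open O ->
  smooth O f -> smooth O g -> smooth O (fun x : E => f x * g x).
Proof. by move=> oO; apply: (smooth_bilin oO mul_cont_bilinear). Qed.

Lemma cont_linear_mull x : cont_linear (fun y : W => x * y).
Proof.
have [_ lin c] := mul_cont_bilinear; split; first exact: lin.
move=> y; have xy : (x, z) @[z --> y] --> (x, y).
  exact: (@cvg_pair _ _ _ (nbhs y) (nbhs x) (nbhs y) _ _ _ (cst x) id (cvg_cst _) (@cvg_id _ _)).
exact: (cvg_comp _ _ xy (c (x, y))).
Qed.

Lemma cont_linear_mulr y : cont_linear (fun x : W => x * y).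
Proof.
have [lin _ c] := mul_cont_bilinear; split; first exact: lin.
move=> x; have xy : (z, y) @[z --> x] --> (x, y).
  exact: (@cvg_pair _ _ _ (nbhs x) (nbhs x) (nbhs y) _ _ _ id (cst y) (@cvg_id _ _) (cvg_cst _)).
exact: (cvg_comp _ _ xy (c (x, y))).
Qed.


(** The operator l |-> 2 l + h l + l g is expanding when h and g have norm
    below 1/2; this estimate is behind every uniqueness and differentiability
    statement about the square root. *)
Lemma sylvester_bound h (g : W) l m : `|h| < 2^-1 -> `|g| < 2^-1 ->
  l *+ 2 + h * l + l * g = m -> `|l| <= `|m|.
Proof.
move=> h2 g2 lE.
have : `|l *+ 2| <= `|m| + (`|h| * `|l| + `|l| * `|g|).
  have -> : l *+ 2 = m - (h * l + l * g) by rewrite -lE; ncring.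
  rewrite (le_trans (ler_normB _ _))// lerD2l (le_trans (ler_normD _ _))//.
  by rewrite lerD// norm_mul_le.
have l0 : 0 <= `|l| by [].
rewrite normrMn mulr2n; nra.
Qed.

Lemma sylvester_inj h (g : W) l l' : `|h| < 2^-1 -> `|g| < 2^-1 ->
  l *+ 2 + h * l + l * g = l' *+ 2 + h * l' + l' * g -> l = l'.
Proof.
move=> h2 g2 ll'; apply/eqP; rewrite -subr_eq0 -normr_le0 -[leRHS](@normr0 _ W).
apply: (sylvester_bound h2 g2).
transitivity ((l *+ 2 + h * l + l * g) - (l' *+ 2 + h * l' + l' * g)).
  ncring.
by rewrite ll' subrr.
Qed.

Definition sylvester (p : W * W * W) : W :=
  xget 0 [set l | l *+ 2 + p.1.1 * l + l * p.1.2 = p.2].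

Definition sylvester_dom : set (W * W * W) :=
  [set p | `|p.1.1| < 2^-1 /\ `|p.1.2| < 2^-1].

(** The equation says that l is fixed by l |-> (k - h l - l g) / 2, which is a
    contraction since h and g have norm below 1/2. *)
Lemma sylvesterE h (g : W) k : `|h| < 2^-1 -> `|g| < 2^-1 ->
  let l := sylvester (h, g, k) in l *+ 2 + h * l + l * g = k.
Proof.
move=> h2 g2; rewrite /sylvester /=; case: xgetP => //= /(_ _)/= no.
pose f (l : W) : W := 2^-1 *: (k - h * l - l * g).
have half_twice (z : W) : (2^-1 *: z) *+ 2 = z.
  by rewrite -scaler_nat scalerA mulfV// ?scale1r// pnatr_eq0.
have [||||l _ lE] := @contraction_fixpoint R W setT f.
- exact: closedT.
- by exists 0.
- by [].
- move=> x y _ _; rewrite /f -scalerBr normrZ ger0_norm ?invr_ge0//.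
  rewrite ler_pM2l ?invr_gt0//.
  have -> : k - h * x - x * g - (k - h * y - y * g)
     = - (h * (x - y) + (x - y) * g) by ncring.
  rewrite normrN (le_trans (ler_normD _ _))//.
  have a := norm_mul_le h (x - y); have b := norm_mul_le (x - y) g.
  have c : 0 <= `|x - y| by []; move: a b; nra.
exfalso; apply: (no l).
have l2 : l *+ 2 = k - h * l - l * g by rewrite {1}lE half_twice.
by rewrite l2; ncring.
Qed.

Lemma sylvester_uniq h (g : W) k l : `|h| < 2^-1 -> `|g| < 2^-1 ->
  l *+ 2 + h * l + l * g = k -> sylvester (h, g, k) = l.
Proof.
by move=> h2 g2 lE; apply: (sylvester_inj h2 g2); rewrite sylvesterE// lE.
Qed.

Lemma sylvester_cont_linear h (g : W) : `|h| < 2^-1 -> `|g| < 2^-1 ->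
  cont_linear (fun k : W => sylvester (h, g, k)).
Proof.
move=> h2 g2.
have lin : linear (fun k : W => sylvester (h, g, k)).
  move=> a k k'; apply: sylvester_uniq => //.
  rewrite -[in RHS](sylvesterE k h2 g2) -[in RHS](sylvesterE k' h2 g2).
  set l := sylvester _; set l' := sylvester _.
  rewrite mulrDr mulrDl -scale_mulr -scale_mull mulrnDl !mulr2n !scalerDr.
  ncring.
apply: (bounded_cont_linear (c := 1)) => // k; rewrite mul1r.
exact: sylvester_bound h2 g2 (sylvesterE _ h2 g2).
Qed.

Lemma open_norm_lt (c : R) : open [set x : W | `|x| < c].
Proof.
have -> : [set x : W | `|x| < c] = (fun x : W => `|x|) @^-1` [set y | y < c].
  by [].
by apply: open_comp => [x _|]; [exact: norm_continuous|exact: open_lt].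
Qed.

Lemma open_sylvester_dom : open sylvester_dom.
Proof.
have -> : sylvester_dom = [set p : W * W * W | [set x : W | `|x| < 2^-1] p.1.1]
   `&` [set p : W * W * W | [set x : W | `|x| < 2^-1] p.1.2] by [].
apply: openI.
  apply: (@open_comp _ _ (fst \o fst)); last exact: open_norm_lt.
  by move=> p _; exact: (cont_linear_comp (@cont_linear_fst _ _ _)
    (@cont_linear_fst _ _ _)).2.
apply: (@open_comp _ _ (snd \o fst)); last exact: open_norm_lt.
by move=> p _; exact: (cont_linear_comp (@cont_linear_fst _ _ _)
  (@cont_linear_snd _ _ _)).2.
Qed.

(** What differentiating 2 l + h l + l g = k gives for the variation of l:
    it solves the same equation with a corrected right-hand side. *)
Definition sylvester_diff (p p' : W * W * W) : W :=
  sylvester (p.1.1, p.1.2,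
    p'.2 - p'.1.1 * sylvester p - sylvester p * p'.1.2).

Lemma sylvester_is_diff p : sylvester_dom p ->
  is_diff p sylvester (sylvester_diff p).
Proof.
case: p => [[h g] k] [/= h2 g2]; apply/is_diffP.
set l := sylvester (h, g, k).
have lE : l *+ 2 + h * l + l * g = k by exact: sylvesterE.
split.
  apply: (@cont_linear_comp _ _ _ _ (fun p' : W * W * W => p'.2 - p'.1.1 * l - l * p'.1.2)
    (fun k : W => sylvester (h, g, k))); last exact: sylvester_cont_linear.
  have l1 := @cont_linear_fst R (W * W)%type W.
  apply: cont_linearB; first (apply: cont_linearB; first exact: cont_linear_snd).
    exact: cont_linear_comp (cont_linear_comp l1 (@cont_linear_fst _ _ _))
      (cont_linear_mulr l).
  exact: cont_linear_comp (cont_linear_comp l1 (@cont_linear_snd _ _ _))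
    (cont_linear_mull l).
move=> e e0.
have nP : \forall d \near (0 : W * W * W), sylvester_dom (d + (h, g, k)).
  have : \forall z \near ((h, g, k) : W * W * W), sylvester_dom z.
    apply: (open_nbhs_nbhs (conj open_sylvester_dom _)).
    by split.
  by rewrite (near_shift 0) subr0.
have c0 : 0 < 2 * (1 + 2 * `|l|) by rewrite mulr_gt0// ltr_pwDl// mulr_ge0.
suff key d : sylvester_dom (d + (h, g, k)) -> 2 * (1 + 2 * `|l|) * `|d| <= e ->
    `|sylvester (d + (h, g, k)) - l - sylvester_diff (h, g, k) d| <= e * `|d|.
  near=> d; apply: key; first by near: d; exact: nP.
  rewrite mulrC -ler_pdivlMr//; near: d.
  apply: (@near0_le R (W * W * W)%type (e / (2 * (1 + 2 * `|l|)))).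
  by rewrite divr_gt0.
move=> Pd de.
case: d Pd de => [[dh dg] dk] [/= h2' g2'] de.
set d := (dh, dg, dk) in de *.
have dhd : `|dh| <= `|d| by rewrite !prod_normE /= !le_max lexx.
have dgd : `|dg| <= `|d| by rewrite !prod_normE /= !le_max lexx orbT.
have dkd : `|dk| <= `|d| by rewrite !prod_normE /= !le_max lexx orbT.
rewrite /sylvester_diff /= -/l.
set l' := sylvester (dh + h, _, _).
have l'E : l' *+ 2 + (dh + h) * l' + l' * (dg + g) = dk + k by exact: sylvesterE.
set m := dk - dh * l - l * dg.
have DE : (l' - l) *+ 2 + (dh + h) * (l' - l) + (l' - l) * (dg + g) = m.
  transitivity ((l' *+ 2 + (dh + h) * l' + l' * (dg + g))
     - (l *+ 2 + h * l + l * g) - dh * l - l * dg); first by ncring.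
  by rewrite l'E lE addrK.
have D1 := sylvester_bound h2' g2' DE.
have l2E := sylvesterE m h2 g2; cbv zeta in l2E; set L := sylvester _ in l2E *.
have D2 : `|l' - l - L| <= `|- (dh * (l' - l)) - (l' - l) * dg|.
  apply: (sylvester_bound h2 g2).
  transitivity (((l' - l) *+ 2 + (dh + h) * (l' - l) + (l' - l) * (dg + g))
    - (L *+ 2 + h * L + L * g) - dh * (l' - l) - (l' - l) * dg); first by ncring.
  by rewrite DE l2E subrr sub0r.
apply: (le_trans D2); apply: (le_trans (ler_normB _ _)); rewrite normrN.
have a := norm_mul_le dh (l' - l); have b := norm_mul_le (l' - l) dg.
have mb : `|m| <= (1 + 2 * `|l|) * `|d|.
  have a' := norm_mul_le dh l; have b' := norm_mul_le l dg.
  rewrite /m; apply: (le_trans (ler_normB _ _)).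
  have := ler_normB dk (dh * l); have : 0 <= `|l| by [].
  nra.
have l0 : 0 <= `|l' - l| by [].
have d0 : 0 <= `|d| by [].
have : `|l' - l| <= (1 + 2 * `|l|) * `|d| by exact: le_trans mb.
have : 0 <= `|l| by [].
move: de dhd dgd; set N := `|d| in d0 *.
set X := `|l' - l| in l0 a b *; set Y := `|l|.
move=> de dhd dgd Y0 XN.
have -> : e * N = (e - 2 * (1 + 2 * Y) * N) * N + 2 * N * ((1 + 2 * Y) * N) by ring.
have : 0 <= (e - 2 * (1 + 2 * Y) * N) * N by rewrite mulr_ge0// subr_ge0.
have : 2 * N * X <= 2 * N * ((1 + 2 * Y) * N) by rewrite ler_wpM2l// mulr_ge0.
have : `|dh| * X <= N * X by rewrite ler_wpM2r.
have : X * `|dg| <= X * N by rewrite ler_wpM2l.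
lra.
Unshelve. all: by end_near. Qed.

(** The derivative is expressed through the solution itself, which
    bootstraps from continuity to every C^k. *)
Lemma smooth_sylvester : smooth sylvester_dom sylvester.
Proof.
have o := open_sylvester_dom.
elim=> [p Dp|k IH].
  by have [dp _] := sylvester_is_diff Dp; exact: differentiable_continuous.
split=> [p /sylvester_is_diff[]//|].
have oD : open [set p : (W * W * W) * (W * W * W) | sylvester_dom p.1].
  exact: open_fst.
apply: (@C_k_ext R k _ _ _ (fun p => sylvester_diff p.1 p.2)) => //.
  by move=> p /sylvester_is_diff dp; rewrite diff_val.
pose l1 := @cont_linear_fst R (W * W * W)%type (W * W * W)%type.
pose l2 := @cont_linear_snd R (W * W * W)%type (W * W * W)%type.
pose f1 := @cont_linear_fst R (W * W)%type W.
pose f2 := @cont_linear_snd R (W * W)%type W.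
pose g1 := @cont_linear_fst R W W.
pose g2 := @cont_linear_snd R W W.
have cS : C_k k [set p : (W * W * W) * (W * W * W) | sylvester_dom p.1]
    (fun p => sylvester p.1).
  apply: (C_k_comp oD o _ _ IH) => //.
  exact: C_k_lin.
have cM (u v : (W * W * W) * (W * W * W) -> W) :
   C_k k [set p : (W * W * W) * (W * W * W) | sylvester_dom p.1] u ->
   C_k k [set p : (W * W * W) * (W * W * W) | sylvester_dom p.1] v ->
   C_k k [set p : (W * W * W) * (W * W * W) | sylvester_dom p.1] (fun p => u p * v p).
  move=> cu cv; apply: (C_k_comp oD _ _ (C_k_pair oD cu cv)
    (C_k_bilin k mul_cont_bilinear)) => //; exact: openT.
have cB (u v : (W * W * W) * (W * W * W) -> W) :
   C_k k [set p : (W * W * W) * (W * W * W) | sylvester_dom p.1] u ->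
   C_k k [set p : (W * W * W) * (W * W * W) | sylvester_dom p.1] v ->
   C_k k [set p : (W * W * W) * (W * W * W) | sylvester_dom p.1] (fun p => u p - v p).
  move=> cu cv; apply: (C_k_comp oD _ _ (C_k_pair oD cu cv)
    (C_k_lin k setT (cont_linearB g1 g2))) => //; exact: openT.
apply: (C_k_comp oD o _ _ IH) => //.
apply: C_k_pair => //.
  have l11 := cont_linear_comp l1 f1.
  apply: C_k_lin; apply: cont_linear_pair.
    exact: cont_linear_comp l11 g1.
  exact: cont_linear_comp l11 g2.
apply: (cB (fun p => p.2.2 - p.2.1.1 * sylvester p.1)); first apply: cB.
- by apply: C_k_lin; exact: cont_linear_comp l2 f2.
- apply: (cM (fun p => p.2.1.1)) => //; apply: C_k_lin.
  exact: cont_linear_comp (cont_linear_comp l2 f1) g1.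
- apply: cM => //; apply: C_k_lin.
  exact: cont_linear_comp (cont_linear_comp l2 f1) g2.
Qed.

Lemma half_twice (x : W) : (2^-1 *: x) *+ 2 = x.
Proof. by rewrite -scaler_nat scalerA mulfV// ?scale1r// pnatr_eq0. Qed.

Lemma twice_inj (x y : W) : x *+ 2 = y *+ 2 -> x = y.
Proof.
have e (z : W) : 2^-1 *: (z *+ 2) = z by rewrite -scalerMnr half_twice.
by move=> xy; rewrite -[x]e xy e.
Qed.

(** sqrt1 k is the h of norm below 1/2 with (1 + h)^2 = 1 + k. *)
Definition sqrt1 k : W :=
  xget 0 [set h : W | `|h| < 2^-1 /\ h *+ 2 + h * h = k].

Lemma sqrt1_uniq h k :
  `|h| < 2^-1 -> h *+ 2 + h * h = k -> sqrt1 k = h.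
Proof.
move=> h2 hE; rewrite /sqrt1; case: xgetP => [l _ [l2 lE]|/(_ h)/= []//].
apply/eqP; rewrite -subr_eq0 -normr_le0 -[leRHS](@normr0 _ W).
apply: (sylvester_bound l2 h2).
transitivity (l *+ 2 + l * l - (h *+ 2 + h * h)); first by ncring.
by rewrite lE hE subrr.
Qed.

(** The root is the fixed point of h |-> (k - h h) / 2 on a ball; since
    iteration does not leave a closed set U that is stable under this map, the
    root inherits the closed conditions satisfied by k. *)
Lemma sqrt1_mem k (U : set W) : `|k| < 2^-1 -> closed U -> U 0 ->
  (forall h, U h -> U (2^-1 *: (k - h * h))) ->
  [/\ U (sqrt1 k), `|sqrt1 k| < 2^-1 & sqrt1 k *+ 2 + sqrt1 k * sqrt1 k = k].
Proof.
move=> k2 cU U0 Uf.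
(* The ball is stable because 1/4 + (3/8)^2 / 2 < 3/8. *)
pose B : set W := [set h : W | `|h| <= 3 / 8].
have Bhalf h : B h -> `|h| < 2^-1 by rewrite /B /= => h3; lra.
have cB : closed B.
  have -> : B = (fun h : W => `|h|) @^-1` [set c | c <= 3 / 8] by [].
  by apply: closed_comp => [h _|]; [exact: norm_continuous|exact: closed_le].
have [||h|h l|h [Uh Bh] hE] := @contraction_fixpoint R W (U `&` B)
  (fun h => 2^-1 *: (k - h * h)).
- exact: closedI.
- by exists 0; split => //; rewrite /B /= normr0; lra.
- move=> [Uh Bh]; split; first exact: Uf.
  rewrite /B /= normrZ ger0_norm ?invr_ge0//.
  have := ler_normB k (h * h); have := norm_mul_le h h.
  by have : 0 <= `|h| by []; move: Bh; rewrite /B /=; nra.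
- move=> [_ Bh] [_ Bl]; rewrite -scalerBr normrZ ger0_norm ?invr_ge0//.
  rewrite ler_pM2l ?invr_gt0//.
  have -> : k - h * h - (k - l * l) = - (h * (h - l) + (h - l) * l) by ncring.
  rewrite normrN (le_trans (ler_normD _ _))//.
  have a := norm_mul_le h (h - l); have b := norm_mul_le (h - l) l.
  have c : 0 <= `|h - l| by []; move: a b; move: Bh Bl; rewrite /B /=; nra.
have hk : h *+ 2 + h * h = k by rewrite {1}hE half_twice subrK.
by rewrite (sqrt1_uniq (Bhalf _ Bh) hk); split => //; exact: Bhalf.
Qed.

Lemma sqrt1E k : `|k| < 2^-1 ->
  `|sqrt1 k| < 2^-1 /\ sqrt1 k *+ 2 + sqrt1 k * sqrt1 k = k.
Proof. by move=> k2; have [] := @sqrt1_mem k setT k2 closedT. Qed.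

Lemma sqrt1_sqr h k : `|k| < 2^-1 -> h = sqrt1 k -> (1 + h) * (1 + h) = 1 + k.
Proof.
move=> k2 ->; have [_] := sqrt1E k2.
set l := sqrt1 k => lE; rewrite -lE; ncring.
Qed.

Lemma sqrt10 : sqrt1 0 = 0.
Proof. by apply: sqrt1_uniq; rewrite ?normr0 ?invr_gt0// mul0r mul0rn addr0. Qed.

(** Differentiating 2 h + h h = k gives the Sylvester equation
    2 d + h d + d h = k'. *)
Lemma sqrt1_is_diff k : `|k| < 2^-1 ->
  is_diff k sqrt1 (fun d => sylvester (sqrt1 k, sqrt1 k, d)).
Proof.
move=> k2; have [h2 hE] := sqrt1E k2; set h := sqrt1 k in h2 hE *.
apply/is_diffP; split; first exact: sylvester_cont_linear.
move=> e e0.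
have nP : \forall d \near (0 : W), `|d + k| < 2^-1.
  have : \forall z \near (k : W), `|z| < 2^-1.
    by apply: open_nbhs_nbhs; split; [exact: open_norm_lt|exact: k2].
  by rewrite (near_shift 0) subr0.
near=> d.
have dk2 : `|d + k| < 2^-1 by near: d; exact: nP.
have de : `|d| <= e by near: d; exact: near0_le.
have [h'2 h'E] := sqrt1E dk2; set h' := sqrt1 (d + k) in h'2 h'E *.
have DE : (h' - h) *+ 2 + h' * (h' - h) + (h' - h) * h = d.
  transitivity ((h' *+ 2 + h' * h') - (h *+ 2 + h * h)); first by ncring.
  by rewrite h'E hE addrK.
have D1 := sylvester_bound h'2 h2 DE.
have LE := sylvesterE d h2 h2; cbv zeta in LE; set L := sylvester _ in LE *.
have D2 : `|h' - h - L| <= `|- ((h' - h) * (h' - h))|.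
  apply: (sylvester_bound h2 h2).
  transitivity (((h' - h) *+ 2 + h' * (h' - h) + (h' - h) * h)
    - (L *+ 2 + h * L + L * h) - (h' - h) * (h' - h)); first by ncring.
  by rewrite DE LE subrr sub0r.
rewrite (le_trans D2)// normrN (le_trans (norm_mul_le _ _))// ler_pM//.
exact: le_trans de.
Unshelve. all: by end_near. Qed.

Lemma smooth_sqrt1 : smooth [set k : W | `|k| < 2^-1] sqrt1.
Proof.
have o : open [set k : W | `|k| < 2^-1] by exact: open_norm_lt.
elim=> [k k2|m IH].
  by have [dk _] := sqrt1_is_diff k2; exact: differentiable_continuous.
split=> [k /sqrt1_is_diff[]//|].
have oD : open [set p : W * W | `|p.1| < 2^-1] by exact: (open_fst o).
apply: (@C_k_ext R m _ _ _ (fun p => sylvester (sqrt1 p.1, sqrt1 p.1, p.2))) => //.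
  by move=> p /sqrt1_is_diff dp; rewrite diff_val.
have cS : C_k m [set p : W * W | `|p.1| < 2^-1] (fun p => sqrt1 p.1).
  apply: (C_k_comp oD o _ _ IH) => //.
  by apply: C_k_lin; exact: cont_linear_fst.
apply: (C_k_comp oD open_sylvester_dom _ _ (smooth_sylvester m)).
  by move=> p /= /sqrt1E[].
apply: C_k_pair => //; first exact: C_k_pair.
by apply: C_k_lin; exact: cont_linear_snd.
Qed.

(** The inverse of 1 + h also comes from the Sylvester equation, with g = h
    and k = 2: its solution commutes with h by uniqueness, so that
    (1 + h) l = 1.  This makes the inverse smooth near the unit. *)
Lemma unit1D h : `|h| < 2^-1 ->
  1 + h \is a GRing.unit /\ (1 + h)^-1 = sylvester (h, h, 1 *+ 2).
Proof.
move=> h2; have lE := sylvesterE (1 *+ 2) h2 h2; cbv zeta in lE.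
set l := sylvester _ in lE *.
have lh : h * l = l * h.
  apply/eqP; rewrite -subr_eq0 -normr_le0 -[leRHS](@normr0 _ W).
  apply: (sylvester_bound h2 h2).
  transitivity (h * (l *+ 2 + h * l + l * h) - (l *+ 2 + h * l + l * h) * h).
    by ncring.
  by rewrite lE; ncring.
have l1 : l + h * l = 1.
  apply: twice_inj; rewrite -lE -lh; ncring.
have u1 : (1 + h) * l = 1 by rewrite mulrDl mul1r.
have u2 : l * (1 + h) = 1 by rewrite mulrDr mulr1 -lh.
have u : (1 + h : A) \is a GRing.unit by apply/unitrP; exists l.
split=> //; rewrite -[RHS]mul1r -[in RHS](mulVr (u : 1 + h \is a GRing.unit)).
by rewrite -mulrA u1 mulr1.
Qed.

End BanachAlgebra.

(** * Ranges of continuous projections as Banach spaces *)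

Record projector (R : realType) (V : normedModType R) := Projector {
  proj :> V -> V;
  proj_cont_linear : cont_linear proj;
  proj_idem : forall x, proj (proj x) = proj x
}.

(** All model spaces are ranges of continuous projections of A. *)
Record range_of (R : realType) (V : normedModType R) (P : projector V) :=
  RangeOf { rval : V; rvalP : P rval == rval }.

Section RangeAlgebra.
Variables (R : realType) (V : normedModType R) (P : projector V).
Let lP := proj_cont_linear P.

HB.instance Definition _ := [isSub for (@rval R V P)].
HB.instance Definition _ := [Choice of range_of P by <:].

Lemma rval_inj : injective (@rval R V P).
Proof. exact: val_inj. Qed.

Lemma range_fix (a : range_of P) : P (rval a) = rval a.
Proof. exact/eqP/rvalP. Qed.

Fact range_zero_subproof : P 0 == 0.
Proof. by rewrite clin0. Qed.
Fact range_opp_subproof (a : range_of P) : P (- rval a) == - rval a.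
Proof. by rewrite clinN// range_fix. Qed.
Fact range_add_subproof (a b : range_of P) :
  P (rval a + rval b) == rval a + rval b.
Proof. by rewrite clinD// !range_fix. Qed.
Fact range_scale_subproof (c : R) (a : range_of P) :
  P (c *: rval a) == c *: rval a.
Proof. by rewrite clinZ// range_fix. Qed.

Let zero : range_of P := RangeOf range_zero_subproof.
Let opp (a : range_of P) : range_of P := RangeOf (range_opp_subproof a).
Let add (a b : range_of P) : range_of P := RangeOf (range_add_subproof a b).
Let scale (c : R) (a : range_of P) : range_of P :=
  RangeOf (range_scale_subproof c a).

Let addA : associative add.
Proof. by move=> a b c; apply: rval_inj; exact: addrA. Qed.
Let addC : commutative add.
Proof. by move=> a b; apply: rval_inj; exact: addrC. Qed.
Let add0 : left_id zero add.
Proof. by move=> a; apply: rval_inj; exact: add0r. Qed.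
Let addN : left_inverse zero opp add.
Proof. by move=> a; apply: rval_inj; exact: addNr. Qed.

HB.instance Definition _ :=
  GRing.isZmodule.Build (range_of P) addA addC add0 addN.

Let scaleA a b v : scale a (scale b v) = scale (a * b) v.
Proof. by apply: rval_inj; exact: scalerA. Qed.
Let scale1 : left_id 1 scale.
Proof. by move=> v; apply: rval_inj; exact: scale1r. Qed.
Let scaleDr : right_distributive scale +%R.
Proof. by move=> a u v; apply: rval_inj; exact: scalerDr. Qed.
Let scaleDl v : {morph scale^~ v : a b / a + b}.
Proof. by move=> a b; apply: rval_inj; exact: scalerDl. Qed.

HB.instance Definition _ := GRing.Zmodule_isLmodule.Build R (range_of P)
  scaleA scale1 scaleDr scaleDl.

Let norm (a : range_of P) : R := `|rval a|.

Let normD a b : norm (a + b) <= norm a + norm b.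
Proof. exact: ler_normD. Qed.
Let normZ (c : R) a : norm (c *: a) = `|c| * norm a.
Proof. exact: normrZ. Qed.
Let norm0 a : norm a = 0 -> a = 0.
Proof. by move=> /normr0_eq0 a0; exact: rval_inj. Qed.

HB.instance Definition _ := Lmodule_isNormed.Build R (range_of P)
  normD normZ norm0.

Lemma rval_cont_linear : cont_linear (@rval R V P).
Proof. by apply: (bounded_cont_linear (c := 1)) => // a; rewrite mul1r. Qed.

Fact to_range_subproof (x : V) : P (P x) == P x.
Proof. by rewrite proj_idem. Qed.
Definition to_range (x : V) : range_of P := RangeOf (to_range_subproof x).

Lemma to_rangeK x : rval (to_range x) = P x.
Proof. by []. Qed.

Lemma rvalK : cancel (@rval R V P) to_range.
Proof. by move=> a; apply: rval_inj; exact: range_fix. Qed.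

Lemma to_range_cont_linear : cont_linear to_range.
Proof.
split=> [c x y|x]; first by apply: rval_inj; exact: lP.1.
apply/cvgrPdist_lt => e e0; near=> y.
have -> : `|to_range x - to_range y| = `|P x - P y| by [].
by near: y; apply: (@cvgrPdist_lt _ _ _ _ _ P (P x)).1 e0; exact: lP.2.
Unshelve. all: by end_near. Qed.

End RangeAlgebra.

Section RangeComplete.
Variables (R : realType) (V : completeNormedModType R) (P : projector V).

Lemma range_complete (F : set_system (range_of P)) :
  ProperFilter F -> cauchy F -> cvg F.
Proof.
move=> FF /cauchy_ballP Fc.
have Gc : cauchy (@rval R V P @ F).
  apply/cauchy_ballP => e e0.
  have := Fc e e0; case=> -[X Y] [/= FX FY] XY.
  exists (@rval R V P @` X, @rval R V P @` Y).
    by split; rewrite /= nbhs_simpl /=; [apply: filterS FX|apply: filterS FY]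
      => a Xa; exists a.
  move=> [_ _] [/= [a Xa <-] [b Yb <-]].
  by have := XY (a, b) (conj Xa Yb); rewrite -!ball_normE.
have /cvg_ex[l Gl] : cvg (@rval R V P @ F) by exact: cauchy_cvg.
apply/cvg_ex; exists (to_range P l).
have : (fun a => to_range P (rval a)) @ F --> to_range P l.
  exact: (cvg_comp _ _ Gl ((to_range_cont_linear P).2 l)).
suff -> : (fun a => to_range P (rval a)) = id by [].
by apply/funext => a; exact: rvalK.
Qed.

HB.instance Definition _ :=
  Uniform_isComplete.Build (range_of P) range_complete.

End RangeComplete.


(** * Manifolds presented as quotients of subsets of a Banach space *)

Section Chain.
Variables (R : realType) (E F G : normedModType R).

Lemma diff_chain (f : E -> F) (g : F -> G) x h :
  differentiable f x -> differentiable g (f x) ->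
  'd (g \o f) x h = 'd g (f x) ('d f x h).
Proof. by move=> df dg; have -> := diff_comp df dg. Qed.

Lemma diff_chain_cst (f : E -> F) (g : F -> G) (c : G) x h :
  differentiable f x -> differentiable g (f x) ->
  {near x, g \o f =1 cst c} -> 'd g (f x) ('d f x h) = 0.
Proof.
move=> df dg gf; rewrite -diff_chain//.
have cg : {near x, cst c =1 g \o f} by apply: filterS gf => y ->.
have [_ ->] := near_diffE cg (differentiable_cst c x).
by have -> := diff_cst c x.
Qed.

End Chain.

Lemma diff_chain_id (R : realType) (E F : normedModType R) (f : E -> F)
    (g : F -> E) x h :
  differentiable f x -> differentiable g (f x) ->
  {near x, id =1 g \o f} -> 'd g (f x) ('d f x h) = h.
Proof.
move=> df dg gf; rewrite -diff_chain//.
have [did dE] := cont_linear_is_diff x (@cont_linear_id R E).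
by have [_ ->] := near_diffE gf did; rewrite dE.
Qed.

(** The parameter space X of the curve is arbitrary, so that lifts of charts and
    multi-parameter families in H give tangent directions directly. *)
Definition tangent_dir (R : realType) (B : normedModType R) (H : set B)
    (u k : B) : Prop :=
  exists (X : normedModType R) (x h : X) (gamma : X -> B),
    [/\ differentiable gamma x, gamma x = u,
        \forall y \near x, H (gamma y) & 'd gamma x h = k].

Section Presentation.
Variables (R : realType) (T : Type) (E B : normedModType R).
Variables (M : premanifold T E) (H : set B) (pr : B -> T).

(** A smooth lift of the inverse of c to H, sending the coordinates of pr u to
    the prescribed point u of the fibre. *)
Definition local_lift (u : B) (c : chart T E) (O : set E) (s : E -> B) : Prop :=
  [/\ open O, O (c (pr u)), smooth O s, s (c (pr u)) = u &
      forall a, O a ->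
        [/\ H (s a), pr (s a) = cinv c a, cdom c (cinv c a) & c (cinv c a) = a]].

(** A smooth extension C to the ambient Banach space of the chart c, read
    on H. *)
Definition local_coord (u : B) (c : chart T E) (D : set B) (C : B -> E) : Prop :=
  [/\ open D, D u, smooth D C &
      forall v, H v -> D v -> cdom c (pr v) /\ C v = c (pr v)].

(** M is covered by the subset H of B in such a way that all charts and their
    inverses are restrictions and lifts of smooth maps of B.  Smoothness and
    tangent maps on M can then be computed in B, and the notion is stable under
    products. *)
Record presented : Prop := Presented {
  pr_carrier : carrier M = pr @` H;
  pr_chart : forall u, H u -> exists c, chart_at M (pr u) c;
  pr_lift : forall u c, H u -> chart_at M (pr u) c ->
    exists O s, local_lift u c O s;
  pr_coord : forall u c, H u -> chart_at M (pr u) c ->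
    exists D C, local_coord u c D C
}.

Definition coord_ext (u : B) (c : chart T E) : B -> E :=
  xget (fun=> 0) [set C | exists D, local_coord u c D C].

(** For k tangent to H the components do not depend on the chosen extensions
    of the charts. *)
Definition tpush (u k : B) : tvec T E :=
  TVec (pr u) (fun c => if `[< chart_at M (pr u) c >]
                        then 'd (coord_ext u c) u k else 0).

Lemma tlin_tpush a u k k' :
  tlin a (tpush u k) (tpush u k') = tpush u (a *: k + k').
Proof.
rewrite /tlin /tpush /=; congr TVec; apply/funext => c.
by case: ifP => _; rewrite ?linearP// scaler0 addr0.
Qed.

Lemma tvec_eq (v w : tvec T E) c : is_tangent M v -> is_tangent M w ->
  tpt v = tpt w -> chart_at M (tpt v) c -> tcomp v c = tcomp w c -> v = w.
Proof.
case: v w => [x f] [y g] [/= _ fE f0] [/= _ gE g0] xy; subst y => xc fg.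
congr TVec; apply/funext => d; have [xd|xd] := pselect (chart_at M x d).
  by rewrite (fE c)// (gE c)// fg.
by rewrite f0// g0.
Qed.

Hypothesis MH : presented.

Lemma pr_cinv u c : H u -> chart_at M (pr u) c -> cinv c (c (pr u)) = pr u.
Proof.
move=> Hu uc; have [ O [s [_ Ou _ su sP]]] := pr_lift MH Hu uc.
by have [_ <- _ _] := sP _ Ou; rewrite su.
Qed.

Lemma coord_extP u c : H u -> chart_at M (pr u) c ->
  exists D, local_coord u c D (coord_ext u c).
Proof.
move=> Hu uc; rewrite /coord_ext; case: xgetP => //= no.
by have [D [C DC]] := pr_coord MH Hu uc; exfalso; apply: (no C); exists D.
Qed.

Lemma near_coord u c D C (X : normedModType R) (x : X) (gamma : X -> B) :
  local_coord u c D C -> {for x, continuous gamma} -> gamma x = u ->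
  (\forall y \near x, H (gamma y)) ->
  \forall y \near x, [/\ H (gamma y), D (gamma y), cdom c (pr (gamma y)) &
                         C (gamma y) = c (pr (gamma y))].
Proof.
move=> [oD Du _ DC] cg gx Hg.
have Dg : \forall y \near x, D (gamma y).
  by apply: cg; apply: open_nbhs_nbhs; split => //; rewrite gx.
near=> y; have Hy : H (gamma y) by near: y.
have Dy : D (gamma y) by near: y.
by have [? ?] := DC _ Hy Dy.
Unshelve. all: by end_near. Qed.

Lemma coord_differentiable u c D C : local_coord u c D C -> differentiable C u.
Proof. by move=> [_ Du sC _]; exact: smooth_differentiable sC Du. Qed.

Lemma lift_differentiable u c O s :
  local_lift u c O s -> differentiable s (c (pr u)).
Proof. by move=> [_ Ou ss _ _]; exact: smooth_differentiable ss Ou. Qed.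

(** Along a curve in H both extensions are the chart read on the curve, so
    they have the same derivative in the directions tangent to H. *)
Lemma diff_coord_uniq u k c D C D' C' : tangent_dir H u k ->
  local_coord u c D C -> local_coord u c D' C' -> 'd C u k = 'd C' u k.
Proof.
move=> [X [x [h [g [dg gx Hg gk]]]]] DC DC'; subst k.
have cg := differentiable_continuous dg.
have dC : differentiable C (g x) by rewrite gx; exact: coord_differentiable DC.
have dC' : differentiable C' (g x) by rewrite gx; exact: coord_differentiable DC'.
rewrite -gx -(diff_chain h dg dC) -(diff_chain h dg dC').
have CC' : {near x, C \o g =1 C' \o g}.
  have n1 := near_coord DC cg gx Hg; have n2 := near_coord DC' cg gx Hg.
  near=> y; rewrite /=.
  have [_ _ _ ->] : [/\ H (g y), D (g y), cdom c (pr (g y)) &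
                       C (g y) = c (pr (g y))] by near: y.
  by have [_ _ _ ->] : [/\ H (g y), D' (g y), cdom c (pr (g y)) &
                       C' (g y) = c (pr (g y))] by near: y.
have [_ ->//] := near_diffE CC' (differentiable_comp dg dC).
Unshelve. all: by end_near. Qed.

Lemma tcomp_tpush u k c D C : H u -> chart_at M (pr u) c -> tangent_dir H u k ->
  local_coord u c D C -> tcomp (tpush u k) c = 'd C u k.
Proof.
move=> Hu uc uk DC; rewrite /tpush /=; case: asboolP => // _.
have [D' DC'] := coord_extP Hu uc; exact: diff_coord_uniq DC' DC.
Qed.

(** C o s is the identity near c (pr u). *)
Lemma diff_coord_lift u c D C O s h : local_coord u c D C ->
  local_lift u c O s -> 'd C u ('d s (c (pr u)) h) = h.
Proof.
move=> DC Os; have ds := lift_differentiable Os.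
have [oO Ou _ su sP] := Os.
have dC : differentiable C (s (c (pr u))) by rewrite su; exact: coord_differentiable DC.
have nC := near_coord DC (differentiable_continuous ds) su.
have Cs : {near c (pr u), id =1 C \o s}.
  have nO : \forall a \near c (pr u), O a by apply: open_nbhs_nbhs; split.
  have /nC {}nC : \forall a \near c (pr u), H (s a).
    by apply: filterS nO => a /sP[].
  near=> a; rewrite /=.
  have [_ _ _ ->] : [/\ H (s a), D (s a), cdom c (pr (s a)) &
                        C (s a) = c (pr (s a))] by near: a.
  by have /sP[_ -> _ ->] : O a by near: a.
have -> : 'd C u = 'd C (s (c (pr u))) by rewrite su.
exact: diff_chain_id.
Unshelve. all: by end_near. Qed.

Lemma lift_tangent_dir u c O s h : local_lift u c O s ->
  tangent_dir H u ('d s (c (pr u)) h).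
Proof.
move=> Os; have ds := lift_differentiable Os; have [oO Ou _ su sP] := Os.
exists E, (c (pr u)), h, s; split=> //.
by apply: filterS (open_nbhs_nbhs (conj oO Ou)) => a /sP[].
Qed.

End Presentation.

Definition lift_at (R : realType) (T T' : Type) (B B' : normedModType R)
    (H : set B) (pr : B -> T) (H' : set B') (pr' : B' -> T')
    (f : T -> T') (F : B -> B') (u : B) : Prop :=
  exists D : set B, [/\ open D, D u, smooth D F &
    forall v, H v -> D v -> H' (F v) /\ pr' (F v) = f (pr v)].

Section PresentedMaps.
Variables (R : realType) (T T' : Type) (E E' B B' : normedModType R).
Variables (M : premanifold T E) (H : set B) (pr : B -> T).
Variables (N : premanifold T' E') (H' : set B') (pr' : B' -> T').
Hypotheses (MH : presented M H pr) (NH : presented N H' pr').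

(** In charts f is C o F o s, with s a lift of the chart of M, F the lift of f
    and C the extended chart of N. *)
Lemma smooth_on_lift (Z : set T) (f : T -> T') : Z `<=` carrier M ->
  (forall u, H u -> Z (pr u) -> exists (D : set B) (F : B -> B'),
     [/\ open D, D u, smooth D F &
         forall v, H v -> D v ->
           [/\ Z (pr v), H' (F v) & pr' (F v) = f (pr v)]]) ->
  smooth_on M N Z f.
Proof.
move=> ZM Zf x Zx; have := ZM _ Zx; rewrite (pr_carrier MH) => -[u Hu ux].
subst x; have [D [F [oD Du sF DF]]] := Zf _ Hu Zx.
have [_ HFu Fu] := DF _ Hu Du.
have [c uc] := pr_chart MH Hu; have [ O [s Os]] := pr_lift MH Hu uc.
have [d ud] := pr_chart NH HFu; have [D' [C DC]] := pr_coord NH HFu ud.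
have [oO Ou ss su sP] := Os; have [oD' D'u sC CP] := DC.
pose K := D `&` F @^-1` D'.
have oK : open K by exact: smooth_preimage.
pose O' := O `&` s @^-1` K.
exists c, d, O'; rewrite -Fu; split=> //.
  split; first exact: smooth_preimage.
  by split; [|rewrite /= su].
have O'P a : O' a -> [/\ Z (cinv c a), cdom c (cinv c a), c (cinv c a) = a,
    cdom d (f (cinv c a)) & C (F (s a)) = d (f (cinv c a))].
  move=> [Oa [Da D'a]]; have [Ha sa ca cca] := sP _ Oa.
  have [Za HFa Fa] := DF _ Ha Da; have [da Ca] := CP _ HFa D'a.
  by rewrite -sa -Fa; split=> //; rewrite sa.
split=> [a /O'P[Za ca cca _ _]|a /O'P[]//|].
  by exists (cinv c a).
have oO' : open O' by exact: smooth_preimage.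
apply: (@smooth_ext R _ _ _ (fun a => C (F (s a)))) => //.
  by move=> a /O'P[].
apply: (@smooth_comp R _ _ _ O' K s (fun b => C (F b))) => //.
- by move=> a [].
- by apply: smooth_sub ss => a [].
apply: (@smooth_comp R _ _ _ K D' F C) => //.
- by move=> a [].
- by apply: smooth_sub sF => a [].
Qed.

Lemma smooth_map_lift (f : T -> T') (F : B -> B') :
  (forall u, H u -> lift_at H pr H' pr' f F u) -> smooth_map M N f.
Proof.
move=> fF; apply: smooth_on_lift => // u Hu _.
have [D [oD Du sF DF]] := fF u Hu; exists D, F; split=> // v Hv Dv.
have [? ?] := DF _ Hv Dv; split=> //.
by rewrite (pr_carrier MH); exists v.
Qed.

Section TangentPush.
Variables (f : T -> T') (F : B -> B') (u : B).
Hypotheses (Hu : H u) (fF : lift_at H pr H' pr' f F u).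

Lemma lift_at_point : H' (F u) /\ pr' (F u) = f (pr u).
Proof. by have [D [_ Du _ DF]] := fF; exact: DF. Qed.

Lemma lift_at_differentiable : differentiable F u.
Proof. by have [D [_ Du sF _]] := fF; exact: smooth_differentiable sF Du. Qed.

Lemma lift_at_curve (X : normedModType R) (x : X) (g : X -> B) :
  {for x, continuous g} -> g x = u -> (\forall y \near x, H (g y)) ->
  \forall y \near x, [/\ H (g y), H' (F (g y)) & pr' (F (g y)) = f (pr (g y))].
Proof.
move=> cg gx Hg; have [D [oD Du _ DF]] := fF.
have Dg : \forall y \near x, D (g y).
  by apply: cg; apply: open_nbhs_nbhs; split => //; rewrite gx.
near=> y; have Hy : H (g y) by near: y.
have Dy : D (g y) by near: y.
by have [? ?] := DF _ Hy Dy.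
Unshelve. all: by end_near. Qed.

Lemma tangent_dir_push k : tangent_dir H u k -> tangent_dir H' (F u) ('d F u k).
Proof.
move=> [X [x [h [g [dg gx Hg gk]]]]]; subst k.
have dF : differentiable F (g x) by rewrite gx; exact: lift_at_differentiable.
exists X, x, h, (F \o g); split=> //=.
- exact: differentiable_comp.
- by rewrite gx.
- have := lift_at_curve (differentiable_continuous dg) gx Hg.
  by apply: filterS => y [].
- by rewrite diff_chain// gx.
Qed.

(** The representative of f in charts is differentiable because it is C' o F
    composed with a lift of c; its derivative is then found along a curve in H,
    where it is C' o F before composing with C. *)
Lemma diff_representative c d D C D' C' :
  chart_at M (pr u) c -> chart_at N (f (pr u)) d ->
  local_coord H pr u c D C -> local_coord H' pr' (F u) d D' C' ->
  differentiable (d \o f \o cinv c) (c (pr u)) /\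
  forall k, tangent_dir H u k ->
    'd (d \o f \o cinv c) (c (pr u)) ('d C u k) = 'd C' (F u) ('d F u k).
Proof.
move=> uc ud DC DC'; have [ O [s Os]] := pr_lift MH Hu uc.
have [oO Ou ss su sP] := Os; have [HFu Fu] := lift_at_point.
have dF := lift_at_differentiable; have dC' := coord_differentiable DC'.
have dC := coord_differentiable DC; have ds := lift_differentiable Os.
set r := d \o f \o cinv c.
have dr : differentiable r (c (pr u)).
  have rC : {near c (pr u), C' \o F \o s =1 r}.
    have nO : \forall a \near c (pr u), O a by apply: open_nbhs_nbhs; split.
    have Hs : \forall a \near c (pr u), H (s a) by apply: filterS nO => a /sP[].
    have cs := differentiable_continuous ds.
    have n1 := lift_at_curve cs su Hs.
    have n2 := @near_coord _ _ _ _ H' pr' (F u) d D' C' _ (c (pr u)) (F \o s) DC' _ _ _.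
    have cFs : {for c (pr u), continuous (F \o s)}.
      apply: differentiable_continuous; apply: differentiable_comp => //.
      by rewrite su.
    have HFs : \forall a \near c (pr u), H' ((F \o s) a) by apply: filterS n1 => a [].
    have := n2 cFs (congr1 F su) HFs => {}n2.
    near=> a; rewrite /r /=.
    have [_ _ _ ->] : [/\ H' ((F \o s) a), D' ((F \o s) a), cdom d (pr' ((F \o s) a)) &
                       C' ((F \o s) a) = d (pr' ((F \o s) a))] by near: a.
    have [_ _ -> ] : [/\ H (s a), H' (F (s a)) & pr' (F (s a)) = f (pr (s a))].
      by near: a.
    by have /sP[_ -> _ _] : O a by near: a.
  have [] // := near_diffE rC _.
  apply: differentiable_comp => //; rewrite su.
  exact: differentiable_comp.
split=> // k [X [x [h [g [dg gx Hg gk]]]]]; subst k.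
have cg := differentiable_continuous dg.
have dCg : differentiable C (g x) by rewrite gx.
have dFg : differentiable F (g x) by rewrite gx.
have Cgx : C (g x) = c (pr u) by rewrite gx; have [_ Du _ /(_ u Hu Du)[_]] := DC.
have drg : differentiable r ((C \o g) x) by rewrite /= Cgx.
have dC'g : differentiable C' ((F \o g) x) by rewrite /= gx.
have dCgx := differentiable_comp dg dCg.
have dFgx := differentiable_comp dg dFg.
have rCg : {near x, r \o (C \o g) =1 C' \o (F \o g)}.
  have n0 := near_coord DC cg gx Hg.
  have n1 := lift_at_curve cg gx Hg.
  have HFg : \forall a \near x, H' ((F \o g) a) by apply: filterS n1 => a [].
  have n2 := near_coord DC' (differentiable_continuous dFgx) (congr1 F gx) HFg.
  near=> y; rewrite /r /=.
  have [Hgy _ cy ->] : [/\ H (g y), D (g y), cdom c (pr (g y)) &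
                       C (g y) = c (pr (g y))] by near: y.
  rewrite (pr_cinv MH Hgy); last by split => //; have [] := uc.
  have [_ _ _ ->] : [/\ H' ((F \o g) y), D' ((F \o g) y), cdom d (pr' ((F \o g) y)) &
                       C' ((F \o g) y) = d (pr' ((F \o g) y))] by near: y.
  by have [_ _ <-] : [/\ H (g y), H' (F (g y)) & pr' (F (g y)) = f (pr (g y))]
     by near: y.
have [_ /(congr1 (@^~ h)) /=] := near_diffE rCg (differentiable_comp dCgx drg).
rewrite (diff_chain h dFgx dC'g) (diff_chain h dg dFg).
rewrite (diff_chain h dCgx drg) (diff_chain h dg dCg) /= Cgx.
have -> : 'd C (g x) = 'd C u by rewrite gx.
have -> : 'd F (g x) = 'd F u by rewrite gx.
by have -> : 'd C' (F (g x)) = 'd C' (F u) by rewrite gx.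
Unshelve. all: by end_near. Qed.

(** Tangent maps are computed on lifts, whatever chart is used to evaluate
    them. *)
Lemma tmap_tpush k : tangent_dir H u k ->
  tmap M N f (tpush M H pr u k) = tpush N H' pr' (F u) ('d F u k).
Proof.
move=> uk; have [HFu Fu] := lift_at_point.
rewrite /tmap [RHS]/tpush -Fu; congr TVec; apply/funext => d /=.
case: asboolP => // ud.
have [D' DC'] := coord_extP NH HFu ud.
have ud' := ud; rewrite Fu in ud'.
have val c : chart_at M (pr u) c ->
   'd (d \o f \o cinv c) (c (pr u)) (tcomp (tpush M H pr u k) c) =
   'd (coord_ext H' pr' (F u) d) (F u) ('d F u k).
  move=> uc; have [D [C DC]] := pr_coord MH Hu uc.
  rewrite (tcomp_tpush MH Hu uc uk DC).
  by have [_ ->] := diff_representative uc ud' DC DC'.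
case: xgetP => [h _ [c uc ->]|no]; first exact: val.
have [c uc] := pr_chart MH Hu; exfalso.
by apply: (no ('d (d \o f \o cinv c) (c (pr u)) (tcomp (tpush M H pr u k) c)));
  exists c.
Qed.

End TangentPush.
End PresentedMaps.

Section TangentVectors.
Variables (R : realType) (T : Type) (E B : normedModType R).
Variables (M : premanifold T E) (H : set B) (pr : B -> T).
Hypothesis MH : presented M H pr.

Lemma lift_at_id u : lift_at H pr H pr id id u.
Proof.
by exists setT; split=> //; [exact: openT|exact: smooth_id].
Qed.

Lemma tpush_tangent u k : H u -> tangent_dir H u k ->
  is_tangent M (tpush M H pr u k).
Proof.
move=> Hu uk; split=> [|c d uc ud|c /= uc].
- by rewrite (pr_carrier MH); exists u.
- have [D [C DC]] := pr_coord MH Hu uc; have [D' [C' DC']] := pr_coord MH Hu ud.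
  have -> := tcomp_tpush MH Hu uc uk DC; have -> := tcomp_tpush MH Hu ud uk DC'.
  have [_ /(_ _ uk)->] := diff_representative MH Hu (lift_at_id u) uc ud DC DC'.
  by have [did ->] := cont_linear_is_diff u (@cont_linear_id R B).
- by case: asboolP.
Qed.

Lemma tangent_spaceP u k : H u -> tangent_dir H u k ->
  tangent_space M (pr u) (tpush M H pr u k).
Proof. by move=> Hu uk; split; first exact: tpush_tangent. Qed.

Lemma tpush_eq u k k' c D C : H u -> chart_at M (pr u) c ->
  local_coord H pr u c D C -> tangent_dir H u k -> tangent_dir H u k' ->
  'd C u k = 'd C u k' -> tpush M H pr u k = tpush M H pr u k'.
Proof.
move=> Hu uc DC uk uk' kk'; apply: (@tvec_eq _ _ _ M _ _ c) => //.
- exact: tpush_tangent.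
- exact: tpush_tangent.
- have -> := tcomp_tpush MH Hu uc uk DC.
  by have -> := tcomp_tpush MH Hu uc uk' DC.
Qed.

Lemma tangent_tpush_lift v u c O s : is_tangent M v -> H u -> tpt v = pr u ->
  chart_at M (pr u) c -> local_lift H pr u c O s ->
  v = tpush M H pr u ('d s (c (pr u)) (tcomp v c)).
Proof.
move=> tv Hu vu uc Os; have ut := lift_tangent_dir (tcomp v c) Os.
have [D [C DC]] := pr_coord MH Hu uc.
apply: (@tvec_eq _ _ _ M _ _ c) => //.
- exact: tpush_tangent.
- by rewrite vu.
- have -> := tcomp_tpush MH Hu uc ut DC.
  by rewrite (diff_coord_lift _ DC Os).
Qed.

(** Every tangent vector comes from a direction of H: take the image of its
    component under the derivative of a lift of the chart. *)
Lemma tangent_tpush v u : is_tangent M v -> H u -> tpt v = pr u ->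
  exists2 k, tangent_dir H u k & v = tpush M H pr u k.
Proof.
move=> tv Hu vu; have [c uc] := pr_chart MH Hu.
have [ O [s Os]] := pr_lift MH Hu uc.
exists ('d s (c (pr u)) (tcomp v c)); first exact: lift_tangent_dir Os.
exact: tangent_tpush_lift Os.
Qed.

Lemma tmap_id v : is_tangent M v -> tmap M M id v = v.
Proof.
move=> tv; have [+ _ _] := tv; rewrite (pr_carrier MH) => -[u Hu /esym vu].
have [k uk ->] := tangent_tpush tv Hu vu.
rewrite (tmap_tpush MH MH Hu (lift_at_id u) uk).
by have [did ->] := cont_linear_is_diff u (@cont_linear_id R B).
Qed.

(** A lift of the identity moves the base point inside a fibre of the
    presentation, without changing the tangent vector of M. *)
Lemma tpush_lift_id F u k : H u -> lift_at H pr H pr id F u ->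
  tangent_dir H u k -> tpush M H pr u k = tpush M H pr (F u) ('d F u k).
Proof.
move=> Hu fF uk; rewrite -(tmap_tpush MH MH Hu fF uk) tmap_id//.
exact: tpush_tangent.
Qed.


(** In the chart of the tangent bundle over c, with C an extension of c and s a
    lift of its inverse, Phi reads (a, h) |-> (a, dC (Psi (s a, ds h))). *)
Lemma smooth_bundle_map (Psi : B -> B -> B) (Phi : tvec T E -> tvec T E) :
  smooth setT (fun p : B * B => Psi p.1 p.2) ->
  (forall u k, H u -> tangent_dir H u k -> tangent_dir H u (Psi u k)) ->
  (forall u k, H u -> tangent_dir H u k ->
     Phi (tpush M H pr u k) = tpush M H pr u (Psi u k)) ->
  smooth_map (tangent_bundle M) (tangent_bundle M) Phi.
Proof.
move=> sPsi dPsi PhiE v /= tv.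
have [+ _ _] := tv; rewrite (pr_carrier MH) => -[u Hu /esym vu].
have [k uk vE] := tangent_tpush tv Hu vu.
have Phiv : Phi v = tpush M H pr u (Psi u k) by rewrite vE PhiE.
have tPhiv : is_tangent M (Phi v) by rewrite Phiv; apply: tpush_tangent => //; exact: dPsi.
have [c uc] := pr_chart MH Hu; have [Mc cu] := uc.
have [ O [s Os]] := pr_lift MH Hu uc; have [D [C DC]] := pr_coord MH Hu uc.
have [oO Ou ss su sP] := Os; have [oD Du sC CP] := DC.
pose O1 := O `&` s @^-1` D.
have oO1 : open O1 by exact: smooth_preimage.
pose O' := [set p : E * E | O1 p.1].
have oO' : open O' by exact: open_fst.
have local a : O1 a -> [/\ H (s a), chart_at M (pr (s a)) c,
    local_coord H pr (s a) c D C, pr (s a) = cinv c a & c (cinv c a) = a].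
  move=> [Oa Da]; have [Ha sa ca cca] := sP _ Oa.
  split=> //; first by split => //; rewrite sa.
have dir a h : O1 a -> tangent_dir H (s a) ('d s a h).
  move=> [Oa _]; exists E, a, h, s; split=> //.
    exact: smooth_differentiable ss Oa.
  by apply: filterS (open_nbhs_nbhs (conj oO Oa)) => b /sP[].
have dCs a h : O1 a -> 'd C (s a) ('d s a h) = h.
  move=> O1a; have [Ha sac DCa sa cca] := local _ O1a.
  have Osa : local_lift H pr (s a) c O s.
    by split=> //; rewrite sa cca//; have [] := O1a.
  by have := diff_coord_lift h DCa Osa; rewrite sa cca.
have tvE a h : O1 a -> tvec_of M c (cinv c a) h =
    tpush M H pr (s a) ('d s a h).
  move=> O1a; have [Ha sac DCa sa cca] := local _ O1a.
  rewrite /tvec_of -sa /tpush; congr TVec; apply/funext => d.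
  case: ifP => // /asboolP sad; rewrite sa cca.
  have [D' DC'] := coord_extP MH Ha sad.
  have [_ /(_ _ (dir a h O1a))] :=
    diff_representative MH Ha (lift_at_id (s a)) sac sad DCa DC'.
  rewrite dCs// sa cca => ->.
  by have [did ->] := cont_linear_is_diff (s a) (@cont_linear_id R B).
exists (tangent_chart M c), (tangent_chart M c), O'; split.
- by split; [exists c|split=> //; rewrite vu].
- by split; [exists c|split=> //; rewrite Phiv].
- split=> //; rewrite /O' /= vu; split=> //.
  by rewrite /= su.
split=> [[a h] /= O1a|[a h] /= O1a|].
- have [Ha sac DCa sa cca] := local _ O1a.
  exists (tpush M H pr (s a) ('d s a h)).
    have ts := tpush_tangent Ha (dir a h O1a).
    by split=> //; split=> //; have [] := sac.
  have -> := tcomp_tpush MH Ha sac (dir a h O1a) DCa.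
  by rewrite /= dCs// sa cca.
- have [Ha sac DCa sa cca] := local _ O1a; rewrite tvE// PhiE//; last exact: dir.
  split; last by have [] := sac.
  by apply: tpush_tangent => //; apply: dPsi => //; exact: dir.
apply: (@smooth_ext R _ _ _
  (fun p => (p.1, 'd C (s p.1) (Psi (s p.1) ('d s (p.1) (p.2)))))) => //.
  move=> [a h] /= O1a; have [Ha sac DCa sa cca] := local _ O1a.
  rewrite tvE// PhiE//; last exact: dir.
  have -> := tcomp_tpush MH Ha sac (dPsi _ _ Ha (dir a h O1a)) DCa.
  by rewrite /= sa cca.
apply: smooth_pair => //; first by apply: smooth_lin; exact: cont_linear_fst.
have ss1 : smooth O' (fun p => s p.1).
  apply: (@smooth_comp R _ _ _ O' O fst s) => //.
    by move=> p [].
  by apply: smooth_lin; exact: cont_linear_fst.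
apply: (@smooth_comp R _ _ _ O' [set p : B * B | D p.1]
  (fun p => (s p.1, Psi (s p.1) ('d s (p.1) (p.2)))) (fun p => 'd C (p.1) (p.2))) => //.
- exact: open_fst.
- by move=> p [].
- apply: smooth_pair => //.
  apply: (@smooth_comp R _ _ _ O' setT (fun p => (s p.1, 'd s (p.1) (p.2)))
    (fun p => Psi p.1 p.2)) => //; first exact: openT.
  apply: smooth_pair => //.
  by apply: smooth_sub (smooth_diff ss) => p [].
- exact: smooth_diff.
Qed.

End TangentVectors.

Section Products.
Variables (R : realType) (T T' : Type) (E E' B B' : normedModType R).
Variables (M : premanifold T E) (H : set B) (pr : B -> T).
Variables (N : premanifold T' E') (H' : set B') (pr' : B' -> T').

Lemma openX (X X' : normedModType R) (O : set X) (O' : set X') :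
  open O -> open O' -> open (O `*` O').
Proof.
move=> oO oO'; have -> : O `*` O' =
  [set p : X * X' | O p.1] `&` [set p : X * X' | O' p.2] by [].
apply: openI; first exact: open_fst.
by apply: (@open_comp _ _ snd) => // p _; exact: cvg_snd.
Qed.

Lemma smooth_prod (X X' Y Y' : normedModType R) (O : set X) (O' : set X')
    (f : X -> Y) (g : X' -> Y') : open O -> open O' ->
  smooth O f -> smooth O' g -> smooth (O `*` O') (fun p => (f p.1, g p.2)).
Proof.
move=> oO oO' sf sg; have oX := openX oO oO'; apply: smooth_pair => //.
  apply: (@smooth_comp R _ _ _ _ O fst f) => //; first by move=> p [].
  by apply: smooth_lin; exact: cont_linear_fst.
apply: (@smooth_comp R _ _ _ _ O' snd g) => //; first by move=> p [].
by apply: smooth_lin; exact: cont_linear_snd.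
Qed.

Lemma presented_prod : presented M H pr -> presented N H' pr' ->
  presented (prod_manifold M N) (H `*` H') (fun p => (pr p.1, pr' p.2)).
Proof.
move=> MH NH; split.
- apply/seteqP; split=> [[x y] /= [Mx Ny]|_ [[u u'] /= [Hu Hu'] <-]]; last first.
    split; rewrite /=; first by rewrite (pr_carrier MH); exists u.
    by rewrite (pr_carrier NH); exists u'.
  move: Mx Ny; rewrite (pr_carrier MH) (pr_carrier NH) => -[u Hu <-] [u' Hu' <-].
  by exists (u, u').
- move=> [u u'] [/= Hu Hu']; have [c [Mc uc]] := pr_chart MH Hu.
  have [c' [Nc uc']] := pr_chart NH Hu'.
  by exists (prod_chart c c'); split; [exists c, c'|split].
- move=> [u u'] _ [/= Hu Hu'] [[c [c' [Mc Nc' ->]]] [/= uc uc']].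
  have [ O [s [oO Ou ss su sP]]] := pr_lift MH Hu (conj Mc uc).
  have [ O' [s' [oO' Ou' ss' su' sP']]] := pr_lift NH Hu' (conj Nc' uc').
  exists (O `*` O'), (fun p => (s p.1, s' p.2)); split.
  - exact: openX.
  - by [].
  - exact: smooth_prod.
  - by rewrite /= su su'.
  - move=> [a a'] [/= Oa Oa'].
    have [? ? ? ?] := sP _ Oa; have [? ? ? ?] := sP' _ Oa'.
    by split=> //=; congr pair.
- move=> [u u'] _ [/= Hu Hu'] [[c [c' [Mc Nc' ->]]] [/= uc uc']].
  have [D [C [oD Du sC CP]]] := pr_coord MH Hu (conj Mc uc).
  have [D' [C' [oD' Du' sC' CP']]] := pr_coord NH Hu' (conj Nc' uc').
  exists (D `*` D'), (fun p => (C p.1, C' p.2)); split.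
  - exact: openX.
  - by [].
  - exact: smooth_prod.
  - move=> [v v'] [/= Hv Hv'] [/= Dv Dv'].
    have [? ?] := CP _ Hv Dv; have [? ?] := CP' _ Hv' Dv'.
    by split=> //=; congr pair.
Qed.

Lemma presented_banach : presented (banach_manifold E) setT id.
Proof.
split.
- by rewrite image_id.
- by move=> u _; exists (Chart setT id id); split.
- move=> u _ _ [-> _]; exists setT, id; split=> //; first exact: openT.
  exact: smooth_id.
- move=> u _ _ [-> _]; exists setT, id; split=> //; first exact: openT.
  exact: smooth_id.
Qed.

End Products.

(** * Unitary groups and expectations *)

Section Star.
Variables (R : realType) (A : banachAlgType R) (star : A -> A).
Hypotheses (hstar : involution star)
  (cstar : continuous (star : realified A -> realified A)).
Local Notation W := (realified A).
Local Notation st := (star : W -> W).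

Lemma star_cont_linear : cont_linear st.
Proof.
split=> // a x y; rewrite (starD hstar); congr (_ + _).
rewrite {1}/GRing.scale /= /rscale (starZ hstar).
by have -> : Num.conj (real_complex_def (Phant R) a) = real_complex_def (Phant R) a
  by exact: conjc_real.
Qed.

Lemma starDW x y : st (x + y) = st x + st y.
Proof. exact: (starD hstar). Qed.
Lemma starNW x : st (- x) = - st x.
Proof. exact: (clinN star_cont_linear). Qed.
Lemma starBW x y : st (x - y) = st x - st y.
Proof. exact: (clinB star_cont_linear). Qed.
Lemma starZW (a : R) x : st (a *: x) = a *: st x.
Proof. exact: (clinZ star_cont_linear). Qed.
Lemma star0W : st 0 = 0.
Proof. exact: (clin0 star_cont_linear). Qed.
Lemma starMW x y : st (x * y) = st y * st x.
Proof. exact: (starM hstar). Qed.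
Lemma starKW x : st (st x) = x.
Proof. exact: (starK hstar). Qed.
Lemma star1W : st 1 = 1.
Proof. by have := starMW (st 1) 1; rewrite mulr1 starKW mulr1 => <-. Qed.

Definition skew_part (x : W) : W := 2^-1 *: (x - st x).
Definition herm_part (x : W) : W := 2^-1 *: (x + st x).

Lemma herm_skew x : x = herm_part x + skew_part x.
Proof.
rewrite /herm_part /skew_part -scalerDr addrACA subrr addr0 -mulr2n.
by rewrite -[LHS]half_twice scalerMnr.
Qed.

Lemma star_skew_part x : st (skew_part x) = - skew_part x.
Proof. by rewrite starZW starBW starKW -scalerN opprB. Qed.

Lemma star_herm_part x : st (herm_part x) = herm_part x.
Proof. by rewrite starZW starDW starKW addrC. Qed.

Lemma skew_part_id x : st x = - x -> skew_part x = x.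
Proof. by move=> sx; rewrite /skew_part sx opprK -mulr2n -scalerMnr half_twice. Qed.

Lemma skew_part_herm x : st x = x -> skew_part x = 0.
Proof. by move=> sx; rewrite /skew_part sx subrr scaler0. Qed.

Lemma herm_part_id x : st x = x -> herm_part x = x.
Proof. by move=> sx; rewrite /herm_part sx -mulr2n -scalerMnr half_twice. Qed.

Lemma herm_part_skew x : st x = - x -> herm_part x = 0.
Proof. by move=> sx; rewrite /herm_part sx subrr scaler0. Qed.

Lemma skew_part_cont_linear : cont_linear skew_part.
Proof.
apply: cont_linearZ; apply: cont_linearB; first exact: cont_linear_id.
exact: star_cont_linear.
Qed.

Lemma herm_part_cont_linear : cont_linear herm_part.
Proof.
apply: cont_linearZ; apply: cont_linearD; first exact: cont_linear_id.
exact: star_cont_linear.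
Qed.

Lemma closed_eqlin (V : normedModType R) (L M : V -> W) :
  cont_linear L -> cont_linear M -> closed [set x | L x = M x].
Proof.
move=> lL lM; have [_ cLM] := cont_linearB lL lM.
have -> : [set x | L x = M x] = (fun x => L x - M x) @^-1` [set 0].
  by apply/seteqP; split=> x /=; [move=> ->; rewrite subrr|move=> /subr0_eq].
apply: closed_comp; first by move=> x _; exact: cLM.
apply: accessible_closed_set1; apply: hausdorff_accessible.
exact: norm_hausdorff.
Qed.

(** Projections onto star-subalgebras that are linear over their range.  Four
    of them are used: 0, the identity, the truncation to the block diagonal, and
    the compression to a corner. *)
Record cond_expectation := CondExpectation {
  expec :> W -> W;
  expec_cont_linear : cont_linear expec;
  expec_idem : forall x, expec (expec x) = expec x;
  expec_star : forall x, expec (st x) = st (expec x);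
  expec_mod : forall x y, expec (expec x * y) = expec x * expec y
}.

Section Expectation.
Variable F : cond_expectation.
Let lF := expec_cont_linear F.

Lemma expec_modr x y : F (x * F y) = F x * F y.
Proof.
by rewrite -[LHS]starKW -expec_star starMW -(expec_star F y) expec_mod starMW
   -!expec_star !starKW.
Qed.

Lemma fix_mul x y : F x = x -> F y = y -> F (x * y) = x * y.
Proof. by move=> Fx Fy; rewrite -{1}Fx expec_mod Fx Fy. Qed.

Lemma fix_star x : F x = x -> F (st x) = st x.
Proof. by rewrite expec_star => ->. Qed.

Lemma fixD x y : F x = x -> F y = y -> F (x + y) = x + y.
Proof. by move=> Fx Fy; rewrite (clinD lF) Fx Fy. Qed.

Lemma fixN x : F x = x -> F (- x) = - x.
Proof. by move=> Fx; rewrite (clinN lF) Fx. Qed.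

Lemma fixZ (a : R) x : F x = x -> F (a *: x) = a *: x.
Proof. by move=> Fx; rewrite (clinZ lF) Fx. Qed.

Lemma fix_skew_part x : F x = x -> F (skew_part x) = skew_part x.
Proof.
by move=> Fx; apply: fixZ; apply: fixD => //; apply: fixN; exact: fix_star.
Qed.

Lemma expec_skew_part x : F (skew_part x) = skew_part (F x).
Proof. by rewrite (clinZ lF) (clinB lF) expec_star. Qed.

(** The affine space 1 + Ran F is closed under products, adjoints and
    inverses, even when 1 is not in Ran F. *)
Definition affine_fix (x : W) : Prop := F (x - 1) = x - 1.

Lemma affine_fix1 : affine_fix 1.
Proof. by rewrite /affine_fix subrr (clin0 lF). Qed.

Lemma affine_fix_mul x y : affine_fix x -> affine_fix y -> affine_fix (x * y).
Proof.
move=> Fx Fy; rewrite /affine_fix.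
have -> : x * y - 1 = (x - 1) * (y - 1) + ((x - 1) + (y - 1)) by ncring.
by apply: fixD; [exact: fix_mul|exact: fixD].
Qed.

Lemma affine_fix_star x : affine_fix x -> affine_fix (st x).
Proof. by move=> Fx; rewrite /affine_fix -{1 2}star1W -starBW fix_star. Qed.

(** If x = 1 + b and x (1 + l) = 1, then l + b l = - b; applying F gives the
    same equation for F l, and x can be cancelled. *)
Lemma affine_fix_inv (x : W) : x \is a GRing.unit -> affine_fix x ->
  affine_fix x^-1.
Proof.
move=> ux; rewrite /affine_fix => Fx.
set b := x - 1 in Fx; set l := x^-1 - 1.
have xE : x = 1 + b by rewrite /b addrC subrK.
have lE : l + b * l = - b.
  have -> : l + b * l = x * x^-1 - x by rewrite /l /b; ncring.
  by rewrite (mulrV ux) /b opprB.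
have Fl : F l + b * F l = - b.
  have := congr1 F lE.
  by rewrite (clinD lF) (clinN lF) -{1}Fx expec_mod Fx.
have e z : x * z = z + b * z by rewrite {1}xE mulrDl mul1r.
by apply: (mulrI ux); rewrite !e lE Fl.
Qed.

End Expectation.

Lemma fix_inv (F : cond_expectation) (x : W) : F 1 = 1 -> x \is a GRing.unit ->
  F x = x -> F x^-1 = x^-1.
Proof.
move=> F1 ux Fx; apply: (mulrI ux); rewrite (mulrV ux).
by rewrite -{1}Fx -expec_mod Fx (mulrV ux).
Qed.

Lemma star_inv (x : W) : x \is a GRing.unit -> st x = x -> st x^-1 = x^-1.
Proof.
move=> ux sx; apply: (mulrI ux); rewrite (mulrV ux).
by rewrite -{1}sx -starMW (mulVr ux) star1W.
Qed.

End Star.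

(** * Slices of the unitary group transverse to a subgroup *)

Section Slice.
Variables (R : realType) (A : banachAlgType R) (star : A -> A).
Hypotheses (hstar : involution star)
  (cstar : continuous (star : realified A -> realified A)).
Local Notation W := (realified A).
Local Notation st := (star : W -> W).
Local Notation skew := (skew_part star).
Local Notation herm := (herm_part star).
Variables (EH EK : cond_expectation star).
Hypotheses (EH1 : EH 1 = 1) (EHK : forall x, EH (EK x) = EK (EH x)).
Let stD := starDW hstar.
Let stB := starBW hstar cstar.
Let stN := starNW hstar cstar.
Let stM := starMW hstar.
Let stK := starKW hstar.
Let st1 := star1W hstar.
Let lst := star_cont_linear hstar cstar.
Let lEH := expec_cont_linear EH.
Let lEK := expec_cont_linear EK.

(** The unitary group of the range of EH, its subgroup of the elements of
    1 + Ran EK, and their Lie algebras.  Such a subgroup is the centralizer of a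
    family of projections or the fixator of one, according to EK. *)
Definition in_grp : set W := [set u | [/\ u * st u = 1, st u * u = 1 & EH u = u]].
Definition in_stab : set W := [set u | in_grp u /\ affine_fix EK u].
Definition in_lie : set W := [set a | st a = - a /\ EH a = a].
Definition in_lie_stab : set W := [set a | in_lie a /\ EK a = a].

Lemma grp1 : in_grp 1.
Proof. by rewrite /in_grp /= st1 mulr1. Qed.

Lemma grp_mul u v : in_grp u -> in_grp v -> in_grp (u * v).
Proof.
move=> [u1 u2 u3] [v1 v2 v3]; split; last exact: fix_mul.
  by rewrite stM mulrA -(mulrA u) v1 mulr1.
by rewrite stM mulrA -(mulrA (st v)) u2 mulr1.
Qed.

Lemma grp_star u : in_grp u -> in_grp (st u).
Proof. by move=> [u1 u2 u3]; rewrite /in_grp /= stK; split=> //; exact: fix_star. Qed.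

Lemma grp_mulVK u (x : W) : in_grp u -> st u * (u * x) = x.
Proof. by move=> [_ u2 _]; rewrite mulrA u2 mul1r. Qed.

Lemma grp_mulKV u (x : W) : in_grp u -> u * (st u * x) = x.
Proof. by move=> [u1 _ _]; rewrite mulrA u1 mul1r. Qed.

Lemma grp_unit u : in_grp u -> u \is a GRing.unit.
Proof. by move=> [u1 u2 _]; apply/(@unitrP A); exists (star u). Qed.

Lemma stab1 : in_stab 1.
Proof. by split; [exact: grp1|exact: affine_fix1]. Qed.

Lemma stab_mul u v : in_stab u -> in_stab v -> in_stab (u * v).
Proof. by move=> [? ?] [? ?]; split; [exact: grp_mul|exact: affine_fix_mul]. Qed.

Lemma stab_star u : in_stab u -> in_stab (st u).
Proof. by move=> [? ?]; split; [exact: grp_star|exact: (affine_fix_star hstar cstar)]. Qed.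

Lemma sqrt1_fix (k : W) (L M : W -> W) : `|k| < 2^-1 -> cont_linear L ->
  cont_linear M -> L k = M k ->
  (forall h, L h = M h -> L (h * h) = M (h * h)) ->
  L (sqrt1 k) = M (sqrt1 k).
Proof.
move=> k2 lL lM Lk LM.
have [||h /= Lh|//] := @sqrt1_mem _ _ k [set h | L h = M h] k2.
- exact: closed_eqlin.
- by rewrite /= (clin0 lL) (clin0 lM).
- by rewrite (clinZ lL) (clinZ lM) (clinB lL) (clinB lM) Lk LM.
Qed.

Lemma sqrt1_star (k : W) : `|k| < 2^-1 -> st k = k -> st (sqrt1 k) = sqrt1 k.
Proof.
move=> k2 sk; apply: (@sqrt1_fix k st id) => //; first exact: cont_linear_id.
by move=> h /= sh; rewrite stM sh.
Qed.

Lemma sqrt1_expec (F : cond_expectation star) (k : W) : `|k| < 2^-1 -> F k = k ->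
  F (sqrt1 k) = sqrt1 k.
Proof.
move=> k2 Fk; apply: (@sqrt1_fix k F id) => //.
- exact: expec_cont_linear.
- exact: cont_linear_id.
- by move=> h /= Fh; exact: fix_mul.
Qed.

Lemma sqrt1_comm (k b : W) : `|k| < 2^-1 -> b * k = k * b ->
  b * sqrt1 k = sqrt1 k * b.
Proof.
move=> k2 bk; apply: (@sqrt1_fix k (fun x => b * x) (fun x => x * b)) => //.
- exact: cont_linear_mull.
- exact: cont_linear_mulr.
- by move=> h bh; rewrite mulrA bh -mulrA bh mulrA.
Qed.

(** For skew b this is the unitary element with skew part b which is close to
    the unit when b is small. *)
Definition ucurve (b : W) : W := 1 + (b + sqrt1 (b * b)).

(** With t = sqrt (1 + b b), which is selfadjoint and commutes with b, one has
    (t + b) (t - b) = t t - b b = 1. *)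
Lemma ucurve_grp b : in_lie b -> `|b * b| < 2^-1 -> in_grp (ucurve b).
Proof.
move=> [sb Eb] b2; rewrite /ucurve.
have sbb : st (b * b) = b * b by rewrite stM sb mulrNN.
have Ebb : EH (b * b) = b * b by exact: fix_mul.
have ss := sqrt1_star b2 sbb; have Es := sqrt1_expec b2 Ebb.
have bs : b * sqrt1 (b * b) = sqrt1 (b * b) * b.
  by apply: sqrt1_comm => //; rewrite mulrA.
have [_ sE] := sqrt1E b2; set s := sqrt1 _ in ss Es bs sE *.
have stE : st (1 + (b + s)) = 1 + (s - b).
  by rewrite stD st1 stD sb ss [- b + s]addrC.
rewrite /in_grp /= stE; split.
- transitivity (1 + (s *+ 2 + s * s - b * b) + (b * s - s * b)); first by ncring.
  by rewrite sE bs !subrr !addr0.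
- transitivity (1 + (s *+ 2 + s * s - b * b) - (b * s - s * b)); first by ncring.
  by rewrite sE bs !subrr subr0 addr0.
- by apply: fixD => //; exact: fixD.
Qed.

Lemma ucurve_stab b : in_lie_stab b -> `|b * b| < 2^-1 -> in_stab (ucurve b).
Proof.
move=> [bl Eb] b2; split; first exact: ucurve_grp.
rewrite /affine_fix /ucurve addrC addKr; apply: fixD => //.
by apply: sqrt1_expec => //; exact: fix_mul.
Qed.

(** The affine projection onto 1 + Ran EK. *)
Definition kap (x : W) : W := 1 + EK (x - 1).

Lemma kap_affine x : affine_fix EK (kap x).
Proof. by rewrite /affine_fix /kap addrC addKr expec_idem. Qed.

(** This is where the linearity of EK over its range enters: kap is equivariant
    under the stabilizer, hence kapsq is invariant. *)
Lemma kap_mul x d : affine_fix EK d -> kap (x * d) = kap x * d.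
Proof.
rewrite /affine_fix /kap => Ed; set b := d - 1 in Ed.
have dE : d = 1 + b by rewrite /b addrC subrK.
have -> : x * d - 1 = (x - 1) + (x - 1) * b + b by rewrite dE; ncring.
have Exb : EK ((x - 1) * b) = EK (x - 1) * b.
  by rewrite -{1}Ed (expec_modr hstar) Ed.
rewrite (clinD lEK) (clinD lEK) Ed Exb dE; ncring.
Qed.

Lemma kap_expec x : EH x = x -> EH (kap x) = kap x.
Proof.
by move=> Ex; rewrite (clinD lEH) EH1 EHK (clinB lEH) Ex EH1.
Qed.

Definition kapsq (x : W) : W := kap x * st (kap x) - 1.

Definition slice_pre : set W := [set x | `|kapsq x| < 2^-1].

(** polar x is the unitary which turns kap x into its positive part. *)
Definition polar (x : W) : W :=
  st (kap x) * sylvester (sqrt1 (kapsq x), sqrt1 (kapsq x), 1 *+ 2).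

Definition normalized (x : W) : W := x * polar x.

Lemma kapsq_star x : st (kapsq x) = kapsq x.
Proof. by rewrite /kapsq stB st1 stM stK. Qed.

Lemma kapsq_fix x : EK (kapsq x) = kapsq x.
Proof.
apply: affine_fix_mul; first exact: kap_affine.
by apply: (affine_fix_star hstar cstar); exact: kap_affine.
Qed.

Lemma kapsq_expec x : EH x = x -> EH (kapsq x) = kapsq x.
Proof.
move=> Ex; apply: fixD; last by apply: fixN.
by apply: fix_mul; rewrite ?fix_star// kap_expec.
Qed.

Lemma stabM_star d : in_stab d -> d * st d = 1.
Proof. by move=> [[]]. Qed.

Lemma kapsq_mul x d : in_stab d -> kapsq (x * d) = kapsq x.
Proof.
move=> Kd; have [_ Ed] := Kd; rewrite /kapsq kap_mul// stM.
by rewrite mulrA -(mulrA (kap x)) stabM_star// mulr1.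
Qed.

Lemma normalized_mul x d : in_stab d -> normalized (x * d) = normalized x.
Proof.
move=> Kd; have [_ Ed] := Kd; rewrite /normalized /polar kapsq_mul// kap_mul// stM.
by rewrite !mulrA -(mulrA x) stabM_star// mulr1.
Qed.

Lemma polarE x : slice_pre x ->
  let y := 1 + sqrt1 (kapsq x) in
  [/\ y \is a GRing.unit, polar x = st (kap x) * y^-1, st y = y,
      y * y = kap x * st (kap x) & affine_fix EK y].
Proof.
move=> x2 y; have [h2 hE] := sqrt1E x2; have [yu yV] := unit1D h2.
split=> //.
- by rewrite /polar -yV.
- by rewrite /y stD st1 sqrt1_star// kapsq_star.
- by rewrite /y (sqrt1_sqr x2)// /kapsq addrC subrK.
- rewrite /affine_fix /y addrC addKr; apply: sqrt1_expec => //; exact: kapsq_fix.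
Qed.

(** The domain of the slice must be a union of cosets of the stabilizer, since
    it is the preimage of a chart domain.  The first two conditions are
    invariant; the last one, that makes kap x invertible, is made so by the
    existential quantifier. *)
Definition slice_dom : set W := [set x |
  [/\ slice_pre x, `|herm (normalized x) - 1| < 5^-1 &
      exists2 d, in_stab d & `|kap (x * d) - 1| < 2^-1]].

(** With y = sqrt (kap u st (kap u)), the element st (kap u) y^-1 is the adjoint of
    the unitary factor in the polar decomposition of kap u, and y lies in
    1 + Ran EK together with kap u. *)
Lemma polar_stab u : in_grp u -> slice_dom u -> in_stab (polar u).
Proof.
move=> Hu [u2 _ [d Kd d2]]; have [yu pE sy yy Ey] := polarE u2.
set y := 1 + _ in yu pE sy yy Ey; have [Hd Ed] := Kd.
have [_ _ Eu] := Hu.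
have sV : st y^-1 = y^-1 by apply: (star_inv hstar).
(* The identity y y = kap u (kap u)^* gives one half of the unitarity of polar
   u; the other half needs that kap u can be cancelled. *)
have ku : kap u \is a GRing.unit.
  have -> : kap u = kap (u * d) * st d.
    by rewrite kap_mul// -mulrA stabM_star// mulr1.
  rewrite unitrMl; last exact: (grp_unit (grp_star Hd)).
  have -> : kap (u * d) = 1 + (kap (u * d) - 1) by rewrite addrC subrK.
  by have [] := unit1D d2.
have EHp : EH (polar u) = polar u.
  rewrite pE; apply: fix_mul; first by apply: fix_star; exact: kap_expec.
  apply: (fix_inv EH1) => //; apply: fixD => //.
  by apply: sqrt1_expec => //; exact: kapsq_expec.
have sp : st (polar u) = y^-1 * kap u by rewrite pE stM sV stK.
split; last first.
  rewrite pE; apply: affine_fix_mul; last exact: affine_fix_inv.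
  by apply: (affine_fix_star hstar cstar); exact: kap_affine.
split=> //; rewrite sp pE.
- apply: (mulrI ku); rewrite mulr1 !mulrA -yy.
  rewrite -(mulrA y) (mulrV yu) mulr1 -[RHS]mul1r.
  by rewrite (mulrV yu) mul1r.
- by rewrite !mulrA -(mulrA _ (kap u)) -yy mulrA (mulVr yu) mul1r (mulrV yu).
Qed.

Lemma slice_dom_mul x d : in_stab d -> slice_dom x -> slice_dom (x * d).
Proof.
move=> Kd [x2 xh [d' Kd' d'2]]; split.
- by rewrite /slice_pre /= kapsq_mul.
- by rewrite normalized_mul.
- exists (st d * d'); first by apply: stab_mul => //; exact: stab_star.
  by rewrite mulrA -(mulrA x) stabM_star// mulr1.
Qed.

Lemma slice_dom_mulP x d : in_stab d -> slice_dom (x * d) <-> slice_dom x.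
Proof.
move=> Kd; split; last exact: slice_dom_mul.
move=> /(slice_dom_mul (stab_star Kd)).
by rewrite -mulrA stabM_star// mulr1.
Qed.

Lemma in_lieD a b : in_lie a -> in_lie b -> in_lie (a + b).
Proof. by move=> [sa Ea] [sb Eb]; split; [rewrite stD sa sb opprD|exact: fixD]. Qed.

Lemma in_lieZ (c : R) a : in_lie a -> in_lie (c *: a).
Proof.
move=> [sa Ea]; split; last exact: fixZ.
by rewrite (clinZ lst) sa scalerN.
Qed.

Lemma in_lieN a : in_lie a -> in_lie (- a).
Proof. by move=> [sa Ea]; split; [rewrite stN sa|exact: fixN]. Qed.

Lemma in_lie0 : in_lie 0.
Proof. by split; rewrite ?(clin0 lst) ?(clin0 lEH) ?oppr0. Qed.

Lemma in_lie_expec a : in_lie a -> in_lie (EK a).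
Proof.
by move=> [sa Ea]; split; [rewrite -expec_star sa (clinN lEK)|rewrite EHK Ea].
Qed.

Lemma in_lie_stab_expec a : in_lie a -> in_lie_stab (EK a).
Proof. by move=> la; split; [exact: in_lie_expec|rewrite expec_idem]. Qed.

Definition lie_proj (x : W) : W := skew (EH x).

Lemma lie_proj_cont_linear : cont_linear lie_proj.
Proof.
by apply: cont_linear_comp lEH _; exact: (skew_part_cont_linear hstar cstar).
Qed.

Lemma lie_projP x : in_lie (lie_proj x).
Proof.
split; first exact: (star_skew_part hstar cstar).
by apply: fix_skew_part => //; rewrite expec_idem.
Qed.

Lemma lie_proj_id a : in_lie a -> lie_proj a = a.
Proof. by move=> [sa Ea]; rewrite /lie_proj Ea skew_part_id. Qed.

(** The projection of A onto the skew elements a of Ran EH with EK a = 0, the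
    complement in the Lie algebra of that of the stabilizer. *)
Definition slice_proj (x : W) : W := lie_proj x - EK (lie_proj x).

Lemma slice_projP x : in_lie (slice_proj x) /\ EK (slice_proj x) = 0.
Proof.
split; last by rewrite /slice_proj (clinB lEK) expec_idem subrr.
by apply: in_lieD; [|apply: in_lieN; apply: in_lie_expec]; exact: lie_projP.
Qed.

Lemma slice_proj_lie a : in_lie a -> slice_proj a = a - EK a.
Proof. by move=> la; rewrite /slice_proj lie_proj_id. Qed.

Lemma slice_proj_id a : in_lie a -> EK a = 0 -> slice_proj a = a.
Proof. by move=> la Ea; rewrite slice_proj_lie// Ea subr0. Qed.

Lemma slice_proj_cont_linear : cont_linear slice_proj.
Proof.
apply: cont_linearB; first exact: lie_proj_cont_linear.
by apply: cont_linear_comp lie_proj_cont_linear _.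
Qed.

Lemma slice_proj_idem x : slice_proj (slice_proj x) = slice_proj x.
Proof. by have [la Ea] := slice_projP x; exact: slice_proj_id. Qed.

Definition slice_projector : projector W :=
  Projector slice_proj_cont_linear slice_proj_idem.

Local Notation S := (range_of slice_projector).

Lemma rval_lie (a : S) : in_lie (rval a) /\ EK (rval a) = 0.
Proof. by rewrite -(range_fix a); exact: slice_projP. Qed.

(** The chart of a coset is the skew part of its normalized representative,
    and the inverse rebuilds the selfadjoint part from it. *)
Definition slice_chart (x : W) : S := to_range slice_projector (normalized x).

Definition slice_sec (a : S) : W := ucurve (rval a).

(** The image of slice_dom under slice_chart: in terms of the selfadjoint part
    1 + s of the representative, whose kap is 1 + EK s, these are the conditions
    that the square roots involved be defined and be the small ones. *)
Definition slice_range : set S := [set a : S |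
  let s := sqrt1 (rval a * rval a) in
  [/\ `|rval a * rval a| < 2^-1, `|s| < 5^-1, `|EK s| < 2^-1 &
      `|EK s *+ 2 + EK s * EK s| < 2^-1]].

(** The element 1 + s + b with s = sqrt1 (b b) is its own normalization, for its
    kap is the selfadjoint 1 + EK s and so has trivial polar part. *)
Lemma slice_secP (a : S) : slice_range a ->
  [/\ in_grp (slice_sec a), slice_dom (slice_sec a) & slice_chart (slice_sec a) = a].
Proof.
move=> [a2 s5 e2 ee2]; have [la Ea] := rval_lie a.
have Hs : in_grp (slice_sec a) by exact: ucurve_grp.
have [sa Ha] := la.
set b := rval a in a2 s5 e2 ee2 la Ea sa Ha *.
have sbb : st (b * b) = b * b by rewrite stM sa mulrNN.
have ss := sqrt1_star a2 sbb.
rewrite /slice_sec -/b in Hs *.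
have kE : kap (ucurve b) = 1 + EK (sqrt1 (b * b)).
  have -> : kap (ucurve b) = 1 + EK (b + sqrt1 (b * b)).
    by rewrite /kap; congr (1 + EK _); rewrite /ucurve; ncring.
  by rewrite (clinD lEK) Ea add0r.
have Hbb : EH (sqrt1 (b * b)) = sqrt1 (b * b).
  by apply: sqrt1_expec => //; exact: fix_mul.
set s := sqrt1 (b * b) in s5 e2 ee2 ss kE Hbb *.
set e := EK s in e2 ee2 kE *.
have se : st e = e by rewrite /e -expec_star ss.
have kqE : kapsq (ucurve b) = e *+ 2 + e * e.
  by rewrite /kapsq kE stD st1 se; ncring.
have pre : slice_pre (ucurve b) by rewrite /slice_pre /= kqE.
have qE : sqrt1 (kapsq (ucurve b)) = e by rewrite kqE; exact: sqrt1_uniq.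
have [yu pE _ _ _] := polarE pre.
have p1 : polar (ucurve b) = 1.
  rewrite pE kE stD st1 se qE; apply: mulrV.
  by rewrite qE in yu.
have nE : normalized (ucurve b) = ucurve b by rewrite /normalized p1 mulr1.
have uE : ucurve b = (1 + s) + b by rewrite /ucurve; ncring.
have s1s : st (1 + s) = 1 + s by rewrite stD st1 ss.
split=> //.
- split=> //.
    rewrite nE uE.
    rewrite (clinD (herm_part_cont_linear hstar cstar)).
    by rewrite (herm_part_id s1s) (herm_part_skew sa) addr0 addrC addKr.
  by exists 1; [exact: stab1|rewrite mulr1 kE addrC addKr].
- apply: rval_inj; rewrite /slice_chart to_rangeK /= nE.
  rewrite uE (clinD slice_proj_cont_linear) -/b.
  have -> : slice_proj (1 + s) = 0.
    rewrite /slice_proj /lie_proj (clinD lEH) EH1 Hbb skew_part_herm//.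
    by rewrite (clin0 lEK) subr0.
  by rewrite add0r slice_proj_id.
Qed.

(** The normalized representative v has kap v selfadjoint, so EK kills its skew
    part a.  Its selfadjoint part t satisfies t t = 1 + a a because v is
    unitary, and being close to 1 it is the root chosen by sqrt1. *)
Lemma slice_chartP u : in_grp u -> slice_dom u ->
  slice_range (slice_chart u) /\ slice_sec (slice_chart u) = u * polar u.
Proof.
move=> Hu Du; have Kp := polar_stab Hu Du; have [Hp Ep] := Kp.
have Hn := grp_mul Hu Hp; rewrite -/(normalized u) in Hn *.
have [pre h5 _] := Du; have [yu pE sy yy Ey] := polarE pre.
have kn : kap (normalized u) = 1 + sqrt1 (kapsq u).
  rewrite /normalized kap_mul// pE mulrA -yy -mulrA (mulrV yu) mulr1//.
set h := sqrt1 (kapsq u) in yu pE sy yy Ey kn.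
have [h2 hE] := sqrt1E pre; rewrite -/h in h2 hE.
have [n1 n2 En] := Hn; set v := normalized u in n1 n2 En h5 kn *.
set a := skew v; set t := herm v.
have vE : v = t + a by exact: herm_skew.
have sa : st a = - a by exact: (star_skew_part hstar cstar).
have stt : st t = t by exact: (star_herm_part hstar cstar).
have Ea : EH a = a by exact: fix_skew_part.
have Et : EH t = t.
  have -> : t = v - a by rewrite vE addrK.
  by apply: fixD => //; exact: fixN.
have EKv : EK (v - 1) = h.
  by have := kn; rewrite /kap => /addrI.
have sh : st h = h by have := sy; rewrite stD st1 => /addrI.
have EKa : EK a = 0.
  have -> : a = skew (v - 1).
    rewrite /a (clinB (skew_part_cont_linear hstar cstar)).
    by rewrite (skew_part_herm st1) subr0.
  by rewrite expec_skew_part EKv skew_part_herm.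
have EKt : EK (t - 1) = h.
  have -> : t - 1 = (v - 1) - a by rewrite {1}vE; ncring.
  by rewrite (clinB lEK) EKa subr0.
have cE : rval (slice_chart u) = a.
  rewrite /slice_chart to_rangeK /= -/v /slice_proj /lie_proj En -/a EKa subr0//.
(* Adding v v^* = 1 and v^* v = 1 eliminates the commutator of t and a. *)
have taE : t * t = 1 + a * a.
  apply: twice_inj.
  transitivity ((t + a) * (t - a) + (t - a) * (t + a) + (a * a) *+ 2); first by ncring.
  have svE : st v = t - a by rewrite vE stD stt sa.
  rewrite -vE -svE n1 n2; ncring.
set s := t - 1; have s5 : `|s| < 5^-1 by [].
have s2 : `|s| < 2^-1 by lra.
have sE : s *+ 2 + s * s = a * a.
  transitivity (t * t - 1); first by rewrite /s; ncring.
  by rewrite taE addrC addKr.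
(* 2/5 + 1/25 < 1/2: the bound 1/5 in slice_dom is made for this. *)
have aa2 : `|a * a| < 2^-1.
  rewrite -sE (le_lt_trans (ler_normD _ _))// normrMn mulr2n.
  have := norm_mul_le s s; have : 0 <= `|s| by []; nra.
have qE : sqrt1 (a * a) = s by exact: sqrt1_uniq.
split; last first.
  rewrite /slice_sec cE /ucurve qE /s vE; ncring.
by rewrite /slice_range /mkset cE /= qE EKt; split=> //; rewrite hE.
Qed.

Lemma slice_chart_mul x d : in_stab d -> slice_chart (x * d) = slice_chart x.
Proof. by move=> Kd; rewrite /slice_chart normalized_mul. Qed.

Lemma slice_range0 : slice_range 0.
Proof.
rewrite /slice_range /= mulr0 sqrt10 (clin0 lEK) mulr0 mul0rn addr0 normr0.
by rewrite !invr_gt0 ltr0n.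
Qed.

Lemma slice_sec0 : slice_sec 0 = 1.
Proof. by rewrite /slice_sec /ucurve /= mulr0 sqrt10 !addr0. Qed.

Lemma slice_dom1 : slice_dom 1.
Proof. by have [] := slice_secP slice_range0; rewrite slice_sec0. Qed.

Lemma slice_chart1 : slice_chart 1 = 0.
Proof. by have [_ _] := slice_secP slice_range0; rewrite slice_sec0. Qed.

Lemma smooth_kapsq (O : set W) : open O -> smooth O kapsq.
Proof.
move=> oO; have sk : smooth O kap.
  apply: smoothD => //; first exact: smooth_cst.
  apply: (smooth_linc oO lEK); apply: smoothB => //; first exact: smooth_id.
  exact: smooth_cst.
apply: smoothB => //; last exact: smooth_cst.
by apply: smoothM => //; exact: smooth_linc sk.
Qed.

Lemma open_slice_pre : open slice_pre.
Proof.
have -> : slice_pre = setT `&` kapsq @^-1` [set x | `|x| < 2^-1].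
  by rewrite setTI.
apply: smooth_preimage; [exact: openT|exact: open_norm_lt|].
by apply: smooth_kapsq; exact: openT.
Qed.

Lemma smooth_normalized : smooth slice_pre normalized.
Proof.
have o := open_slice_pre; apply: smoothM => //; first exact: smooth_id.
apply: smoothM => //.
  apply: smooth_linc => //; apply: smoothD => //; first exact: smooth_cst.
  apply: smooth_linc => //; apply: smoothB => //; first exact: smooth_id.
  exact: smooth_cst.
have ss : smooth slice_pre (fun x => sqrt1 (kapsq x)).
  apply: (@smooth_comp R _ _ _ _ [set k : W | `|k| < 2^-1] kapsq) => //.
  - exact: open_norm_lt.
  - exact: smooth_kapsq.
  - exact: smooth_sqrt1.
apply: (@smooth_comp R _ _ _ _ (@sylvester_dom R A)
  (fun x => (sqrt1 (kapsq x), sqrt1 (kapsq x), 1 *+ 2))) => //.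
- exact: open_sylvester_dom.
- by move=> x /sqrt1E[].
- by apply: smooth_pair => //; [exact: smooth_pair|exact: smooth_cst].
- exact: smooth_sylvester.
Qed.

Lemma smooth_slice_chart : smooth slice_pre slice_chart.
Proof.
apply: smooth_linc smooth_normalized; first exact: open_slice_pre.
exact: to_range_cont_linear.
Qed.

Lemma open_slice_dom : open slice_dom.
Proof.
have o := open_slice_pre.
have -> : slice_dom =
  (slice_pre `&` (fun x => herm (normalized x) - 1) @^-1` [set x | `|x| < 5^-1])
  `&` \bigcup_(d in in_stab) [set x | `|kap (x * d) - 1| < 2^-1].
  by apply/seteqP; split=> x; [move=> [? ? ?]; split|move=> [[? ?] ?]; split].
apply: openI.
  apply: smooth_preimage => //; first exact: open_norm_lt.
  apply: smoothB => //; last exact: smooth_cst.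
  apply: smooth_linc smooth_normalized => //.
  exact: (herm_part_cont_linear hstar cstar).
apply: bigcup_open => d _.
have -> : [set x | `|kap (x * d) - 1| < 2^-1] = setT `&`
    (fun x => kap (x * d) - 1) @^-1` [set x | `|x| < 2^-1] by rewrite setTI.
have oT := @openT W.
apply: smooth_preimage => //; first exact: open_norm_lt.
apply: smoothB => //; last exact: smooth_cst.
apply: smoothD => //; first exact: smooth_cst.
apply: smooth_linc => //; apply: smoothB => //; last exact: smooth_cst.
by apply: smooth_lin; exact: cont_linear_mulr.
Qed.

Lemma sqr_preimage_open : open [set b : W | `|b * b| < 2^-1].
Proof.
have -> : [set b : W | `|b * b| < 2^-1] = setT `&`
   (fun b : W => b * b) @^-1` [set x | `|x| < 2^-1] by rewrite setTI.
apply: smooth_preimage; [exact: openT|exact: open_norm_lt|].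
by apply: smoothM; [exact: openT|exact: smooth_id|exact: smooth_id].
Qed.

Lemma smooth_sqrt1_sqr :
  smooth [set b : W | `|b * b| < 2^-1] (fun b : W => sqrt1 (b * b)).
Proof.
have o := sqr_preimage_open.
apply: (@smooth_comp R _ _ _ _ [set k : W | `|k| < 2^-1] (fun b : W => b * b) (@sqrt1 R A)) => //.
- exact: open_norm_lt.
- by apply: smoothM => //; exact: smooth_id.
- exact: smooth_sqrt1.
Qed.

Lemma smooth_ucurve : smooth [set b : W | `|b * b| < 2^-1] ucurve.
Proof.
have o := sqr_preimage_open; apply: smoothD => //; first exact: smooth_cst.
apply: smoothD => //; first exact: smooth_id.
exact: smooth_sqrt1_sqr.
Qed.

Let range_pre : set S := [set a : S | `|rval a * rval a| < 2^-1].

Let open_range_pre : open range_pre.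
Proof.
have -> : range_pre = setT `&` (@rval _ _ slice_projector) @^-1`
    [set b : W | `|b * b| < 2^-1] by rewrite setTI.
apply: smooth_preimage; [exact: openT|exact: sqr_preimage_open|].
by apply: smooth_lin; exact: rval_cont_linear.
Qed.

Let smooth_on_range_pre (V : normedModType R) (f : W -> V) :
  smooth [set b : W | `|b * b| < 2^-1] f -> smooth range_pre (fun a => f (rval a)).
Proof.
move=> sf; apply: (@smooth_comp R _ _ _ _ [set b : W | `|b * b| < 2^-1]
  (@rval _ _ slice_projector)) => //.
- exact: sqr_preimage_open.
- by apply: smooth_lin; exact: rval_cont_linear.
Qed.

Lemma slice_range_sub : slice_range `<=` range_pre.
Proof. by move=> a []. Qed.

Lemma open_slice_range : open slice_range.
Proof.
pose s (a : S) := sqrt1 ((rval a : W) * rval a).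
have ss : smooth range_pre s by exact: (smooth_on_range_pre smooth_sqrt1_sqr).
have se : smooth range_pre (fun a => EK (s a)) by apply: smooth_linc.
have -> : slice_range =
  (range_pre `&` s @^-1` [set x | `|x| < 5^-1]) `&`
  ((range_pre `&` (fun a => EK (s a)) @^-1` [set x | `|x| < 2^-1]) `&`
   (range_pre `&` (fun a => EK (s a) *+ 2 + EK (s a) * EK (s a))
      @^-1` [set x | `|x| < 2^-1])).
  by apply/seteqP; split=> a; [move=> [? ? ? ?]|move=> [[? ?] [[? ?] [? ?]]]].
apply: openI; last apply: openI.
- by apply: smooth_preimage => //; exact: open_norm_lt.
- by apply: smooth_preimage => //; exact: open_norm_lt.
- apply: smooth_preimage => //; first exact: open_norm_lt.
  apply: smoothD => //; last exact: smoothM.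
  rewrite (_ : (fun a => _) = (fun a => EK (s a) + EK (s a))); first exact: smoothD.
  by apply/funext => a; rewrite mulr2n.
Qed.

Lemma smooth_slice_sec : smooth slice_range slice_sec.
Proof.
apply: smooth_sub slice_range_sub _.
exact: (smooth_on_range_pre smooth_ucurve).
Qed.

Lemma diff_mul (V : normedModType R) (f g : V -> W) x h :
  differentiable f x -> differentiable g x ->
  differentiable (fun y => f y * g y) x /\
  'd (fun y => f y * g y) x h = f x * 'd g x h + 'd f x h * g x.
Proof.
move=> df dg; have bM := mul_cont_bilinear A.
have [dM dME] := cont_bilinear_is_diff (f x, g x) bM.
have dp := differentiable_pair df dg.
split; first exact: (differentiable_comp dp dM).
rewrite (diff_chain (g := fun p : W * W => p.1 * p.2) h dp dM) dME.
by have -> := diff_pair df dg.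
Qed.

Lemma ucurve_is_diff0 : is_diff 0 ucurve id.
Proof.
have h0 : `|0 * 0 : W| < 2^-1 by rewrite mulr0 normr0 invr_gt0.
have di x : differentiable (@id W) x.
  by have [] := cont_linear_is_diff x (@cont_linear_id R W).
have sqd h := diff_mul h (di 0) (di 0).
have dsq : differentiable (fun b : W => b * b) 0 by have [] := sqd 0.
have [ds dsE] := @sqrt1_is_diff R A (0 * 0) h0.
have dc : is_diff 0 (fun b : W => sqrt1 (b * b)) (fun=> 0).
  split; first exact: (differentiable_comp dsq ds).
  apply/funext => h; rewrite (diff_chain (g := @sqrt1 R A) h dsq ds) dsE.
  have [_ ->] := sqd h; rewrite /= !(mul0r, mulr0) addr0 sqrt10.
  by apply: (clin0 (@sylvester_cont_linear R A 0 0 _ _));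
    rewrite normr0 invr_gt0.
have did := cont_linear_is_diff (0 : W) (@cont_linear_id R W).
have dc1 : is_diff 0 (cst 1 + (id + (fun b : W => sqrt1 (b * b)))) (0 + (id + fun=> 0)).
  exact: is_diffD.
have [d1 d2] := dc1; split=> //.
by rewrite d2; apply/funext => b; rewrite !fctE add0r addr0.
Qed.

Lemma ucurve_lin_is_diff0 (V : normedModType R) (L : V -> W) : cont_linear L ->
  is_diff 0 (fun x => ucurve (L x)) L.
Proof.
move=> lL; have [dL dLE] := cont_linear_is_diff 0 lL.
have [du duE] := ucurve_is_diff0; rewrite -(clin0 lL) in du duE.
split; first exact: (differentiable_comp dL du).
by apply/funext => h; rewrite (diff_chain (g := ucurve) h dL du) dLE duE.
Qed.

Lemma near_ucurve (V : normedModType R) (L : V -> W) : cont_linear L ->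
  \forall x \near (0 : V), `|L x * L x| < 2^-1.
Proof.
move=> lL; have : open_nbhs (0 : V) (setT `&` L @^-1` [set b : W | `|b * b| < 2^-1]).
  split; last by split; rewrite //= (clin0 lL) mulr0 normr0 invr_gt0.
  apply: smooth_preimage; [exact: openT|exact: sqr_preimage_open|].
  exact: smooth_lin.
by move=> /open_nbhs_nbhs; apply: filterS => x [].
Qed.

(** Differentiating u^* u = 1 along a curve shows that u^* k is skew; conversely
    w |-> u ucurve (lie_proj w) takes values in the group near 0, and its
    derivative there sends a to u a. *)
Lemma tangent_dir_lie u k : in_grp u ->
  tangent_dir in_grp u k <-> in_lie (st u * k).
Proof.
move=> Hu; have [u1 u2 Eu] := Hu; split.
  move=> [X [x [h [g [dg gx Hg gk]]]]].
  have dst : differentiable (fun y => st (g y)) x.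
    apply: (@differentiable_comp _ _ _ _ g st) => //.
    by have [] := cont_linear_is_diff (g x) lst.
  have dstE : 'd (fun y => st (g y)) x h = st k.
    have [d1 d2] := cont_linear_is_diff (g x) lst.
    by rewrite (diff_chain (g := st) h dg d1) d2 gk.
  have [d1 d2] := diff_mul h dst dg.
  have n1 : {near x, (fun y => st (g y) * g y) =1 cst 1}.
    by apply: filterS Hg => y [].
  have [_ /(congr1 (@^~ h)) /=] := near_diffE n1 d1.
  have -> : 'd (cst (1 : W)) x h = 0 by have -> := diff_cst (1 : W) x.
  rewrite d2 dstE gk gx => /esym /eqP; rewrite addrC addr_eq0 => /eqP uk.
  have EHk : EH k = k.
    have [e1 e2] := cont_linear_is_diff (g x) lEH.
    have n2 : {near x, g =1 EH \o g} by apply: filterS Hg => y [_ _ /= ->].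
    have [_ /(congr1 (@^~ h)) /=] := near_diffE n2 dg.
    by rewrite (diff_chain (g := EH) h dg e1) e2 gk.
  split; first by rewrite stM stK.
  by apply: fix_mul => //; exact: fix_star.
set a := st u * k => la; exists W, 0, a, (fun w => u * ucurve (lie_proj w)).
have [d1 d2] := ucurve_lin_is_diff0 lie_proj_cont_linear.
have [m1 m2] := cont_linear_is_diff (ucurve (lie_proj 0)) (cont_linear_mull u).
split.
- exact: (differentiable_comp d1 m1).
- by rewrite (clin0 lie_proj_cont_linear) /ucurve mulr0 sqrt10 !addr0 mulr1.
- apply: filterS (near_ucurve lie_proj_cont_linear) => w w2.
  by apply: grp_mul => //; apply: ucurve_grp => //; exact: lie_projP.
- rewrite (diff_chain (g := fun x : W => u * x) a d1 m1) m2 d2 lie_proj_id//.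
  by rewrite /a grp_mulKV.
Qed.

Lemma diff_slice_sec0 (a : S) : 'd slice_sec 0 a = rval a.
Proof.
have [_ ->//] := ucurve_lin_is_diff0 (rval_cont_linear slice_projector).
Qed.

Lemma slice_chart_differentiable1 : differentiable slice_chart (1 : W).
Proof.
by apply: smooth_differentiable smooth_slice_chart _; have [] := slice_dom1.
Qed.

(** The derivative kills the Lie algebra of the stabilizer, because the chart is
    constant along curves of the stabilizer, and it inverts the derivative of
    the section, which is the inclusion of the complement. *)
Lemma diff_slice_chart1 b : in_lie b ->
  'd slice_chart (1 : W) b = to_range slice_projector b.
Proof.
move=> lb; have dc := slice_chart_differentiable1.
have lc := diff_cont_linear dc.
have bE : b = slice_proj b + EK b by rewrite slice_proj_lie// subrK.
have -> : 'd slice_chart (1 : W) b = 'd slice_chart (1 : W) (slice_proj b).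
  rewrite {1}bE (clinD lc) -[RHS]addr0; congr (_ + _).
  pose L (w : W) := EK (lie_proj w).
  have lL : cont_linear L by apply: cont_linear_comp lie_proj_cont_linear lEK.
  have [d1 d2] := ucurve_lin_is_diff0 lL.
  have u0 : ucurve (L 0) = 1 by rewrite (clin0 lL) /ucurve mulr0 sqrt10 !addr0.
  have dc' : differentiable slice_chart (ucurve (L 0)) by rewrite u0.
  have n1 : {near (0 : W), slice_chart \o (fun w => ucurve (L w)) =1 cst 0}.
    apply: filterS (near_ucurve lL) => w w2 /=.
    rewrite -slice_chart1 -[ucurve _]mul1r slice_chart_mul//.
    apply: ucurve_stab => //; apply: in_lie_stab_expec; exact: lie_projP.
  have Lb : L b = EK b by rewrite /L lie_proj_id.
  have := diff_chain_cst b d1 dc' n1; rewrite d2 Lb.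
  by have -> : 'd slice_chart (ucurve (L 0)) = 'd slice_chart (1 : W) by rewrite u0.
pose a := to_range slice_projector b.
have ra : rval a = slice_proj b by [].
have dS : differentiable slice_sec 0.
  exact: smooth_differentiable smooth_slice_sec slice_range0.
have dc' : differentiable slice_chart (slice_sec 0) by rewrite slice_sec0.
have n1 : {near (0 : S), id =1 slice_chart \o slice_sec}.
  apply: filterS (open_nbhs_nbhs (conj open_slice_range slice_range0)) => x xr /=.
  by have [_ _ ->] := slice_secP xr.
have := diff_chain_id a dS dc' n1; rewrite diff_slice_sec0 ra.
by have -> : 'd slice_chart (slice_sec 0) = 'd slice_chart (1 : W) by rewrite slice_sec0.
Qed.

End Slice.

(** * Homogeneous spaces of the unitary group *)

Section Homogeneous.
Variables (R : realType) (A : banachAlgType R) (star : A -> A).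
Hypotheses (hstar : involution star)
  (cstar : continuous (star : realified A -> realified A)).
Local Notation W := (realified A).
Local Notation st := (star : W -> W).
Variables (EH EK : cond_expectation star).
Hypotheses (EH1 : EH 1 = 1) (EHK : forall x, EH (EK x) = EK (EH x)).
Variables (T : Type) (pr : W -> T).
Local Notation H := (in_grp EH).
Local Notation K := (in_stab EH EK).
Hypothesis prP : forall u v, H u -> H v -> (pr u = pr v <-> K (st u * v)).
Local Notation S := (range_of (slice_projector hstar cstar EHK)).
Local Notation C := (slice_chart hstar cstar EHK).
Local Notation D := (slice_dom EH EK).
Local Notation O := (@slice_range R A star hstar cstar EH EK EHK).
Let sec : S -> W := @slice_sec R A star hstar cstar EH EK EHK.
Let stM := starMW hstar.
Let grpM := @grp_mul _ _ _ hstar EH.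
Let grpS := @grp_star _ _ _ hstar EH.
Let gKV := @grp_mulKV _ _ star EH.
Let gVK := @grp_mulVK _ _ star EH.
Let oD := open_slice_dom hstar cstar (EH := EH) (EK := EK).
Let oO := @open_slice_range _ _ _ hstar cstar EH EK EHK.

Lemma stab_grp d : K d -> H d.
Proof. by case. Qed.

Lemma pr_stab u d : H u -> K d -> pr (u * d) = pr u.
Proof.
move=> Hu Kd; apply/prP => //; first by apply: grpM => //; exact: stab_grp.
rewrite stM -mulrA; have [_ -> _] := Hu; rewrite mulr1.
exact: (stab_star hstar cstar).
Qed.

Lemma pr_eq u v : H u -> H v -> pr u = pr v -> exists2 d, K d & v = u * d.
Proof.
move=> Hu Hv /prP uv; exists (st u * v); first exact: uv.
by rewrite gKV.
Qed.

(** A choice of representative for each coset; the charts do not depend on it,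
    since slice_chart is constant on cosets. *)
Definition hom_rep (x : T) : W := xget 0 [set u | H u /\ pr u = x].

Lemma hom_repP u : H u -> exists2 d, K d & hom_rep (pr u) = u * d.
Proof.
move=> Hu; rewrite /hom_rep; case: xgetP => [v _ [Hv vu]|/(_ u)/= []//].
exact: pr_eq.
Qed.

(** The slice at the unit, translated by g. *)
Definition hom_chart (g : W) : chart T S :=
  Chart (pr @` [set u | H u /\ D (st g * u)]) (fun x => C (st g * hom_rep x))
        (fun a => pr (g * sec a)).

Definition hom_manifold : premanifold T S :=
  PreManifold (pr @` H) [set hom_chart g | g in H].
Local Notation M := hom_manifold.

Lemma slice_dom_stab u d : K d -> D (u * d) <-> D u.
Proof. exact: (slice_dom_mulP hstar cstar). Qed.

Lemma slice_chart_stab u d : K d -> C (u * d) = C u.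
Proof. exact: slice_chart_mul. Qed.

Lemma hom_chartE g u : H u -> hom_chart g (pr u) = C (st g * u).
Proof.
by move=> Hu; have [d Kd /= ->] := hom_repP Hu; rewrite mulrA slice_chart_stab.
Qed.

Lemma hom_chart_dom g u : H u -> cdom (hom_chart g) (pr u) <-> D (st g * u).
Proof.
move=> Hu; split=> [[v [Hv Dv] vu]|Du]; last by exists u.
have [d Kd uE] := pr_eq Hv Hu vu.
by rewrite uE mulrA; apply/slice_dom_stab.
Qed.

Lemma sec_chart u : H u -> D u ->
  [/\ O (C u), sec (C u) = u * polar EK u & K (polar EK u)].
Proof.
move=> Hu Du; have [? ?] := slice_chartP hstar cstar EH1 EHK Hu Du.
by split=> //; exact: (polar_stab hstar cstar EH1 EHK).
Qed.

Lemma secP a : O a -> [/\ H (sec a), D (sec a) & C (sec a) = a].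
Proof. exact: slice_secP. Qed.

Lemma smooth_sec : smooth O sec.
Proof. exact: smooth_slice_sec. Qed.

Lemma smooth_sec_mul g d : smooth O (fun a => g * sec a * d).
Proof.
apply: (smooth_linc oO (cont_linear_mulr d)).
by apply: (smooth_linc oO (cont_linear_mull g)); exact: smooth_sec.
Qed.

Lemma smooth_chart : smooth D C.
Proof.
apply: smooth_sub (smooth_slice_chart hstar cstar EHK).
by move=> x [].
Qed.

Lemma open_translate (B : set W) g : open B -> open [set x | B (g * x)].
Proof.
move=> oB; have -> : [set x | B (g * x)] = setT `&` (fun x => g * x) @^-1` B.
  by rewrite setTI.
apply: smooth_preimage => //; first exact: openT.
by apply: smooth_lin; exact: cont_linear_mull.
Qed.

Lemma smooth_chart_translate g : smooth [set x | D (g * x)] (fun x => C (g * x)).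
Proof.
apply: (@smooth_comp R _ _ _ _ D (fun x => g * x) C) => //.
- exact: open_translate.
- by apply: smooth_lin; exact: cont_linear_mull.
- exact: smooth_chart.
Qed.

Lemma local_coord_hom g u : H u -> D (st g * u) ->
  local_coord H pr u (hom_chart g) [set x | D (st g * x)] (fun x => C (st g * x)).
Proof.
move=> Hu Du; split=> //; first exact: open_translate.
  exact: smooth_chart_translate.
by move=> v Hv Dv; split; [apply/hom_chart_dom|rewrite hom_chartE].
Qed.

Lemma local_lift_hom g u : H g -> H u -> D (st g * u) ->
  local_lift H pr u (hom_chart g) O
    (fun a => g * sec a * st (polar EK (st g * u))).
Proof.
move=> Hg Hu Du; have Hgu := grpM (grpS Hg) Hu.
have [Oc sc Kp] := sec_chart Hgu Du.
have [Hp _] := Kp; have Kp' := stab_star hstar cstar Kp.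
split=> //.
- by rewrite hom_chartE.
- exact: smooth_sec_mul.
- rewrite hom_chartE// sc; have [pp _ _] := Hp.
  by rewrite mulrA gKV// -mulrA pp mulr1.
- move=> a Oa; have [Hs Ds Cs] := secP Oa.
  have Hgs := grpM Hg Hs; split.
  + by apply: grpM => //; exact: stab_grp.
  + by rewrite pr_stab.
  + by rewrite /=; exists (g * sec a) => //; split=> //; rewrite gVK.
  + have e : hom_chart g (pr (g * sec a)) = a by rewrite hom_chartE// gVK.
    exact: e.
Qed.

Lemma hom_chart_at u c : H u -> chart_at M (pr u) c ->
  exists2 g, H g /\ D (st g * u) & c = hom_chart g.
Proof. by move=> Hu [[g Hg <-] /(hom_chart_dom _ Hu) Du]; exists g. Qed.

Lemma chart_at_hom u g : H u -> H g -> D (st g * u) ->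
  chart_at M (pr u) (hom_chart g).
Proof. by move=> Hu Hg Du; split; [exists g|apply/hom_chart_dom]. Qed.

Lemma chart_at_center u : H u -> chart_at M (pr u) (hom_chart u).
Proof.
move=> Hu; apply: chart_at_hom => //; have [_ -> _] := Hu.
exact: (slice_dom1 hstar cstar EH1 EHK).
Qed.

Lemma hom_presented : presented M H pr.
Proof.
split=> //.
- by move=> u Hu; exists (hom_chart u); exact: chart_at_center.
- move=> u c Hu /(hom_chart_at Hu)[g [Hg Du] ->].
  by eexists; eexists; exact: local_lift_hom.
- move=> u c Hu /(hom_chart_at Hu)[g [Hg Du] ->].
  by eexists; eexists; exact: local_coord_hom.
Qed.

(** In a chart, the image of B is the union over d in the stabilizer of the
    preimages of B under the lifts a |-> g (sec a) d. *)
Lemma hom_mopen (B : set W) : open B -> mopen M (pr @` (H `&` B)).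
Proof.
move=> oB; split=> [_ [u [Hu _] <-]|_ [g Hg <-]]; first by exists u.
have -> : hom_chart g @` ((pr @` (H `&` B)) `&` cdom (hom_chart g)) =
  \bigcup_(d in K) (O `&` (fun a => g * sec a * d) @^-1` B).
  apply/seteqP; split=> [_ [_ [[u [Hu Bu] <-] /(hom_chart_dom _ Hu) Du] <-]|a].
    have [Oc sc Kp] := sec_chart (grpM (grpS Hg) Hu) Du.
    exists (st (polar EK (st g * u))); first exact: (stab_star hstar cstar).
    rewrite hom_chartE//; split=> //=; rewrite sc mulrA gKV//.
    by have [[pp _ _] _] := Kp; rewrite -mulrA pp mulr1.
  move=> [d Kd [Oa Ba]]; have [Hs Ds Cs] := secP Oa.
  have Hgs := grpM Hg Hs; have Hgd := grpM Hgs (stab_grp Kd).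
  exists (pr (g * sec a * d)).
    split; first by exists (g * sec a * d).
    by apply/hom_chart_dom => //; rewrite mulrA gVK//; apply/slice_dom_stab.
  by rewrite hom_chartE// mulrA gVK// slice_chart_stab.
apply: bigcup_open => d _; apply: smooth_preimage => //.
exact: smooth_sec_mul.
Qed.

Lemma hom_transition g g' : H g -> H g' ->
  hom_chart g @` (cdom (hom_chart g) `&` cdom (hom_chart g')) =
  O `&` (fun a => g * sec a) @^-1` [set x | D (st g' * x)].
Proof.
move=> Hg Hg'; apply/seteqP; split=> [_ [y [[u [Hu Du] uy] dy] <-]|a [Oa Da]].
  subst y; move/(hom_chart_dom _ Hu): dy => Du'.
  have Hgu := grpM (grpS Hg) Hu; have [Oc sc Kp] := sec_chart Hgu Du.
  have e : g * sec (C (st g * u)) = u * polar EK (st g * u).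
    by rewrite sc mulrA gKV.
  by rewrite hom_chartE//; split=> //=; rewrite e mulrA; exact/slice_dom_stab.
have [Hs Ds Cs] := secP Oa; have Hgs := grpM Hg Hs.
exists (pr (g * sec a)); last by rewrite hom_chartE// gVK.
by split; apply/hom_chart_dom => //; rewrite gVK.
Qed.

Lemma smooth_translate_sec g : smooth O (fun a => g * sec a).
Proof.
by apply: (smooth_linc oO (cont_linear_mull g)); exact: smooth_sec.
Qed.

(** The manifold is Hausdorff because the stabilizer is closed: the condition
    that u^* v differ from its image under the projection onto 1 + Ran EK is open
    in (u, v), and the presentation is open. *)
Lemma hom_is_manifold : is_manifold M.
Proof.
have MH := hom_presented.
have open_trans g g' : H g -> H g' ->
   open (hom_chart g @` (cdom (hom_chart g) `&` cdom (hom_chart g'))).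
  move=> Hg Hg'; rewrite hom_transition//; apply: smooth_preimage => //.
    exact: open_translate.
  exact: smooth_translate_sec.
split.
- by move=> _ [g Hg <-] _ [u [Hu _] <-]; exists u.
- by move=> _ [u Hu <-]; exists (hom_chart u); exact: chart_at_center.
- move=> c x xc; have [[g Hg cg] cx] := xc.
  move: cx xc; rewrite -cg => -[u [Hu _] <-] uc.
  by refine (pr_cinv MH Hu uc).
- by move=> _ _ [g Hg <-] [g' Hg' <-]; exact: open_trans.
- move=> _ _ [g Hg <-] [g' Hg' <-].
  apply: (@smooth_ext R _ _ _ (fun a => C (st g' * (g * sec a)))).
  + exact: open_trans.
  + move=> a; rewrite hom_transition// => -[Oa Da] /=.
    have [Hs Ds Cs] := secP Oa; have Hgs := grpM Hg Hs.
    by rewrite -(hom_chartE g' Hgs).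
  + apply: (@smooth_comp R _ _ _ _ [set x | D (st g' * x)] (fun a => g * sec a)
      (fun x => C (st g' * x))).
    * exact: open_trans.
    * exact: open_translate.
    * by move=> a; rewrite hom_transition// => -[].
    * apply: smooth_sub (smooth_translate_sec g).
      by move=> a; rewrite hom_transition// => -[].
    * exact: smooth_chart_translate.
- move=> _ _ [u Hu <-] [v Hv <-] uv.
  pose f (p : W * W) : W := (st p.1 * p.2 - 1) - EK (st p.1 * p.2 - 1).
  have fcont : continuous f.
    have oT := @openT (W * W)%type.
    have sf : smooth setT f.
      have sm : smooth setT (fun p : W * W => st p.1 * p.2 - 1).
        apply: smoothB => //; last exact: smooth_cst.
        apply: smoothM => //; apply: smooth_lin; last exact: cont_linear_snd.
        exact: cont_linear_comp (@cont_linear_fst _ _ _)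
          (star_cont_linear hstar cstar).
      by apply: smoothB => //; apply: smooth_linc => //; exact: expec_cont_linear.
    by move=> p; exact: smooth_continuous sf _.
  have fuv : f (u, v) != 0.
    apply/eqP => /subr0_eq/esym fE; apply: uv; apply/prP => //.
    by split=> //; apply: grpM => //; exact: grpS.
  have nf : \forall p \near (u, v), f p != 0.
    have op : open [set x : W | x != 0].
      have -> : [set x : W | x != 0] = ~` [set 0].
        by apply/seteqP; split=> x /=; [move/eqP|move=> ?; apply/eqP].
      rewrite openC; apply: accessible_closed_set1; apply: hausdorff_accessible.
      exact: norm_hausdorff.
    exact: (fcont (u, v) _ (open_nbhs_nbhs (conj op fuv))).
  have [[P Q] /= [nP nQ] PQ] := nf.
  exists (pr @` (H `&` P^°)), (pr @` (H `&` Q^°)); split.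
  + by apply: hom_mopen; exact: open_interior.
  + by apply: hom_mopen; exact: open_interior.
  + by exists u.
  + by exists v.
  + apply/seteqP; split=> // _ [[u' [Hu' /interior_subset Pu'] <-]].
    move=> [v' [Hv' /interior_subset Qv'] uv'].
    have /prP-/(_ Hu' Hv')[_ uv'E] := esym uv'.
    have := PQ (u', v') (conj Pu' Qv'); rewrite /f /= => /eqP; apply.
    by rewrite uv'E subrr.
Qed.

Let MH : presented M H pr := hom_presented.
Local Notation push := (tpush M H pr).

Lemma lie_tangent_dir u a : H u -> in_lie EH a -> tangent_dir H u (u * a).
Proof. by move=> Hu la; apply/(tangent_dir_lie hstar cstar EH1 _ Hu); rewrite gVK. Qed.

Lemma tangent_dir_lieE u k : H u -> tangent_dir H u k ->
  exists2 a, in_lie EH a & k = u * a.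
Proof.
move=> Hu /(tangent_dir_lie hstar cstar EH1 _ Hu) la; exists (st u * k) => //.
by rewrite gKV.
Qed.

Lemma tpush0 u : push u 0 = tzero S (pr u).
Proof.
rewrite /tpush /tzero; congr TVec; apply/funext => c.
by case: ifP => // _; rewrite linear0.
Qed.

Lemma diff_chart_center u a : H u -> in_lie EH a ->
  'd (fun x : W => C (st u * x)) u (u * a) =
  to_range (slice_projector hstar cstar EHK) a.
Proof.
move=> Hu la; have [_ uu _] := Hu.
have [d1 d2] := cont_linear_is_diff u (cont_linear_mull (st u)).
have dC : differentiable C (st u * u).
  by rewrite uu; exact: (slice_chart_differentiable1 hstar cstar EH1 EHK).
rewrite (diff_chain (g := C) (u * a) d1 dC) d2 gVK//.
have -> : 'd C (st u * u) = 'd C (1 : W) by rewrite uu.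
exact: diff_slice_chart1.
Qed.

Lemma local_coord_center u : H u -> local_coord H pr u (hom_chart u)
  [set x | D (st u * x)] (fun x => C (st u * x)).
Proof.
move=> Hu; apply: local_coord_hom => //; have [_ -> _] := Hu.
exact: (slice_dom1 hstar cstar EH1 EHK).
Qed.

(** The kernel of the tangent map of the presentation is the Lie algebra of
    the stabilizer. *)
Lemma hom_tpush_eq u a b : H u -> in_lie EH a -> in_lie EH b ->
  push u (u * a) = push u (u * b) <-> EK (a - b) = a - b.
Proof.
move=> Hu la lb; have DC := local_coord_center Hu.
have uc := chart_at_center Hu.
have ta := lie_tangent_dir Hu la; have tb := lie_tangent_dir Hu lb.
have lEK := expec_cont_linear EK.
have cancel_iff : to_range (slice_projector hstar cstar EHK) a =
    to_range (slice_projector hstar cstar EHK) b <-> EK (a - b) = a - b.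
  rewrite (clinB lEK).
  split=> [/(congr1 (@rval _ _ _))|ab]; last apply: rval_inj.
    rewrite !to_rangeK /= !slice_proj_lie// => ab.
    transitivity ((b - EK b) - (b - EK b) + (EK a - EK b)); first by ncring.
    rewrite -{1}ab; ncring.
  rewrite !to_rangeK /= !slice_proj_lie//.
  transitivity ((a - b) - (EK a - EK b) + (b - EK b)); first by ncring.
  by rewrite ab subrr add0r.
apply: iff_trans cancel_iff.
rewrite -(diff_chart_center Hu la) -(diff_chart_center Hu lb); split=> ab.
  rewrite -(tcomp_tpush MH Hu uc ta DC) -(tcomp_tpush MH Hu uc tb DC).
  by rewrite ab.
exact: (tpush_eq MH Hu uc DC).
Qed.

Lemma hom_tpush_zero u a : H u -> in_lie EH a ->
  push u (u * a) = tzero S (pr u) <-> EK a = a.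
Proof.
move=> Hu la; have := hom_tpush_eq Hu la (in_lie0 hstar cstar EH).
by rewrite subr0 mulr0 tpush0.
Qed.

Lemma hom_tangentE u v : H u -> tangent_space M (pr u) v ->
  exists2 a, in_lie EH a & v = push u (u * a).
Proof.
move=> Hu [tv vu]; have [k tk ->] := tangent_tpush MH tv Hu vu.
by have [a la ->] := tangent_dir_lieE Hu tk; exists a.
Qed.

Lemma hom_tangent_space u a : H u -> in_lie EH a ->
  tangent_space M (pr u) (push u (u * a)).
Proof. by move=> Hu la; apply: (tangent_spaceP MH Hu); exact: lie_tangent_dir. Qed.

Lemma complemented_proj (V : normedModType R) (P : V -> V) : cont_linear P ->
  (forall x, P (P x) = P x) -> complemented [set x | P x = x].
Proof.
move=> lP PP; have closed_lin (L : V -> V) : cont_linear L -> closed [set x | L x = 0].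
  move=> [_ cL]; apply: (@closed_comp _ _ L [set 0]) => [x _|]; first exact: cL.
  apply: accessible_closed_set1; apply: hausdorff_accessible.
  exact: norm_hausdorff.
have lP1 := cont_linearB lP (@cont_linear_id _ V).
split; last exists [set x | P x = 0].
  split=> [|a x y /= Px Py|]; first exact: clin0.
    by rewrite (clinD lP) (clinZ lP) Px Py.
  have -> : [set x | P x = x] = [set x | P x - x = 0].
    by apply/seteqP; split=> x /=; [move=> ->; rewrite subrr|move=> /subr0_eq].
  exact: closed_lin.
split.
- split=> [|a x y /= Px Py|]; [exact: clin0| |exact: closed_lin].
  by rewrite (clinD lP) (clinZ lP) Px Py scaler0 addr0.
- apply/seteqP; split=> [x [/= -> //]|x /= ->].
  by rewrite /= (clin0 lP).
- move=> x; exists (P x), (x - P x); split=> /=; first exact: PP.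
    by rewrite (clinB lP) PP subrr.
  by rewrite addrC subrK.
Qed.

(** When the stabilizer is trivial, a |-> u a identifies the Lie algebra with
    the tangent space, and Q is transported to a projection of the model
    space. *)
Lemma tcomplemented_lie (Q : W -> W) u : (forall x, EK x = 0) ->
  cont_linear Q -> (forall a, in_lie EH a -> in_lie EH (Q a)) ->
  (forall a, Q (Q a) = Q a) -> H u ->
  tcomplemented M (pr u)
    [set v | exists a, [/\ in_lie EH a, Q a = a & v = push u (u * a)]].
Proof.
move=> EK0 lQ Ql QQ Hu c uc.
have [B [X DC]] := pr_coord MH Hu uc; have [ N [s Os]] := pr_lift MH Hu uc.
have dX := coord_differentiable DC; have ds := lift_differentiable Os.
pose L y := st u * 'd s (c (pr u)) y.
pose Y a := 'd X u (u * a).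
have lL : cont_linear L.
  exact: cont_linear_comp (diff_cont_linear ds) (cont_linear_mull _).
have lY : cont_linear Y.
  exact: cont_linear_comp (cont_linear_mull u) (diff_cont_linear dX).
have Llie y : in_lie EH (L y).
  by apply/(tangent_dir_lie hstar cstar EH1 _ Hu); exact: lift_tangent_dir Os.
have YL y : Y (L y) = y by rewrite /Y /L gKV// (diff_coord_lift _ DC Os).
have LY a : in_lie EH a -> L (Y a) = a.
  move=> la; have /(hom_tpush_eq Hu (Llie (Y a)) la) : push u (u * L (Y a)) = push u (u * a).
    apply: (tpush_eq MH Hu uc DC); try exact: lie_tangent_dir.
    exact: YL.
  by rewrite EK0 => /esym/subr0_eq.
have -> : [set tcomp v c | v in
    [set v | exists a, [/\ in_lie EH a, Q a = a & v = push u (u * a)]]] =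
  [set y | Y (Q (L y)) = y].
  apply/seteqP; split=> [_ [_ [a [la Qa ->]] <-]|y /= yE].
    have ta := lie_tangent_dir Hu la.
    by rewrite (tcomp_tpush MH Hu uc ta DC) /= -/(Y a) LY// Qa.
  have la := Ql _ (Llie y); exists (push u (u * Q (L y))).
    by exists (Q (L y)); split=> //; exact: QQ.
  by rewrite (tcomp_tpush MH Hu uc (lie_tangent_dir Hu la) DC).
apply: (@complemented_proj _ (fun y => Y (Q (L y)))).
  exact: cont_linear_comp (cont_linear_comp lL lQ) lY.
by move=> y; rewrite LY ?QQ//; exact: Ql.
Qed.

End Homogeneous.

(** * Velocities and Lie groups *)

Section Velocity.
Variables (R : realType) (A : banachAlgType R).
Local Notation W := (realified A).
Variables (E : normedModType R) (M : premanifold A E) (H : set W) (pr : W -> W).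
Hypotheses (MH : presented M H pr) (lpr : cont_linear pr).
Local Notation banach := (banach_manifold W).

Lemma lift_at_velocity u : lift_at H pr setT id (id : A -> W) pr u.
Proof.
by exists setT; split=> //; [exact: openT|exact: smooth_lin].
Qed.

Lemma tmap_incl_tpush u k : H u -> tangent_dir H u k ->
  tmap M banach (id : A -> W) (tpush M H pr u k) =
  tpush banach setT id (pr u) (pr k).
Proof.
move=> Hu uk; have NB := presented_banach W.
have -> := tmap_tpush MH NB Hu (lift_at_velocity u) uk.
by have [_ ->] := cont_linear_is_diff u lpr.
Qed.

Lemma velocity_tpush u k : H u -> tangent_dir H u k ->
  velocity M (tpush M H pr u k) = pr k.
Proof.
move=> Hu uk; rewrite /velocity tmap_incl_tpush// /tpush /=.
have uc : chart_at banach (pr u) (Chart setT id id) by [].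
case: asboolP => // _; have NB := presented_banach W.
have DC : local_coord setT id (pr u) (Chart setT id id : chart W W) setT id.
  by split=> //; [exact: openT|exact: smooth_id].
have tk : tangent_dir setT (pr u) (pr k).
  have := tangent_dir_push (lift_at_velocity u) uk.
  by have [_ ->] := cont_linear_is_diff u lpr.
have [did dE] := cont_linear_is_diff (pr u) (@cont_linear_id R W).
have := tcomp_tpush NB I uc tk DC; rewrite dE /tpush /=.
by case: asboolP.
Qed.

Lemma smooth_inclusion : smooth_map M banach (id : A -> W).
Proof.
by apply: (smooth_map_lift MH (presented_banach W)) => u _; exact: lift_at_velocity.
Qed.

End Velocity.

Section LieGroup.
Variables (R : realType) (A : banachAlgType R) (star : A -> A).
Hypotheses (hstar : involution star)
  (cstar : continuous (star : realified A -> realified A)).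
Local Notation W := (realified A).
Local Notation st := (star : W -> W).
Variables (EH EK : cond_expectation star).
Hypotheses (EH1 : EH 1 = 1) (EHK : forall x, EH (EK x) = EK (EH x)).
Variable (pr : W -> A).
Local Notation H := (in_grp EH).
Local Notation K := (in_stab EH EK).
Hypothesis prP : forall u v, H u -> H v -> (pr u = pr v <-> K (st u * v)).
Hypothesis prM : forall u v, H u -> H v -> pr (u * v) = pr u * pr v.
Hypothesis prV : forall u, H u -> star (pr u) = pr (st u).
Local Notation M := (hom_manifold hstar cstar EHK pr).

(** The inverse of the class of a unitary is given by the involution, which is
    continuous and linear: no inversion has to be differentiated. *)
Lemma hom_lie_group : is_lie_group M *%R (pr 1).
Proof.
have MH := hom_presented hstar cstar EH1 EHK prP.
have H1 := grp1 hstar EH1; have grpM := @grp_mul _ _ _ hstar EH.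
have grpS := @grp_star _ _ _ hstar EH.
split.
- exact: hom_is_manifold.
- by exists 1.
- by move=> _ _ [u Hu <-] [v Hv <-]; exists (u * v); [exact: grpM|exact: prM].
- by move=> *; rewrite mulrA.
- by move=> _ [u Hu <-]; rewrite -!prM// mul1r mulr1.
- apply: (smooth_map_lift (presented_prod MH MH) MH (F := fun p : W * W => p.1 * p.2)).
  move=> [u v] _; exists setT; split=> //; first exact: openT.
    apply: smoothM; [exact: openT| |]; apply: smooth_lin.
      exact: cont_linear_fst.
    exact: cont_linear_snd.
  by move=> [u' v'] [/= Hu Hv] _; split; [exact: grpM|exact: prM].
- exists star; split=> [|_ [u Hu <-]].
    apply: (smooth_map_lift MH MH (F := st)) => u _; exists setT; split=> //.
    + exact: openT.
    + by apply: smooth_lin; exact: star_cont_linear.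
    + by move=> v Hv _; split; [exact: grpS|rewrite prV].
  rewrite prV//; have Hs := grpS _ Hu; have [u1 u2 _] := Hu; split.
  + by exists (st u).
  + by rewrite -prM// u2.
  + by rewrite -prM// u1.
Qed.

End LieGroup.

(** * The group itself, and its quotients *)

Section ZeroExpectation.
Variables (R : realType) (A : banachAlgType R) (star : A -> A).
Hypotheses (hstar : involution star)
  (cstar : continuous (star : realified A -> realified A)).
Local Notation W := (realified A).
Local Notation st := (star : W -> W).

Fact expec0_star (x : W) : 0 = st 0.
Proof. by rewrite (star0W hstar cstar). Qed.
Fact expec0_mod (x y : W) : 0 = 0 * 0 :> W.
Proof. by rewrite mulr0. Qed.

(** The expectation onto 0, for which the stabilizer is trivial. *)
Definition expec0 : cond_expectation star :=
  @CondExpectation _ _ star (fun=> 0) (@cont_linear0 R W W) (fun=> erefl)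
    expec0_star expec0_mod.

Fact expec_id_mod (x y : W) : x * y = x * y.
Proof. by []. Qed.

Definition expec_id : cond_expectation star :=
  @CondExpectation _ _ star id (@cont_linear_id R W) (fun=> erefl)
    (fun=> erefl) expec_id_mod.

End ZeroExpectation.

Section Quotient.
Variables (R : realType) (A : banachAlgType R) (star : A -> A).
Hypotheses (hstar : involution star)
  (cstar : continuous (star : realified A -> realified A)).
Local Notation W := (realified A).
Local Notation st := (star : W -> W).
Variables (EH : cond_expectation star).
Hypotheses (EH1 : EH 1 = 1).
Local Notation H := (in_grp EH).
Local Notation E0 := (expec0 hstar cstar).

Lemma grp_commute0 x : EH (E0 x) = E0 (EH x).
Proof. by rewrite /= (clin0 (expec_cont_linear EH)). Qed.

Lemma grp_eqP u v : H u -> H v -> ((u : A) = (v : A) <-> in_stab EH E0 (st u * v)).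
Proof.
move=> Hu Hv; have [u1 u2 Eu] := Hu; split=> [<-|[_]].
  by rewrite u2; exact: (stab1 hstar).
rewrite /affine_fix /= => /esym /subr0_eq uv.
by rewrite -[RHS](grp_mulKV v Hu) uv mulr1.
Qed.

Definition grp_manifold := hom_manifold hstar cstar grp_commute0 (id : W -> A).
Local Notation G := grp_manifold.

Lemma grp_presented : presented G H (id : W -> A).
Proof. exact: (hom_presented hstar cstar EH1 grp_commute0 grp_eqP). Qed.

Lemma grp_carrier : carrier G = H.
Proof. by rewrite /= image_id. Qed.

Local Notation gpush := (tpush G H (id : W -> A)).

Lemma grp_tangentE u v : H u -> tangent_space G u v ->
  exists2 a, in_lie EH a & v = gpush u (u * a).
Proof. exact: (hom_tangentE EH1 grp_eqP). Qed.

Lemma grp_tangent u a : H u -> in_lie EH a -> tangent_space G u (gpush u (u * a)).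
Proof.
by move=> Hu la; exact: (hom_tangent_space hstar cstar EH1 grp_commute0 grp_eqP).
Qed.

(** The chart domains are the traces on the group of open sets of A, and the
    charts extend smoothly to these; this gives the embedding, while the tangent
    space at u is the range of the projection y |-> u lie_proj (u^* y). *)
Lemma grp_unitary_lie_group : unitary_lie_group G (in_lie EH).
Proof.
have GH := grp_presented; have lid := @cont_linear_id R W.
have ld u a : H u -> in_lie EH a -> tangent_dir H u (u * a).
  exact: (lie_tangent_dir hstar cstar EH1).
have H1 := grp1 hstar EH1.
split.
- exact: (hom_lie_group hstar cstar EH1 grp_commute0 grp_eqP).
- split.
  + exact: (smooth_inclusion GH).
  + by [].
  + move=> u; rewrite grp_carrier => Hu; split.
      apply/seteqP; split=> [v [/(grp_tangentE Hu)[a la ->]]|_ ->].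
        rewrite (tmap_incl_tpush GH lid Hu (ld _ _ Hu la)).
        have NB := presented_banach W.
        move=> /(congr1 (fun w => tcomp w (Chart setT id id))) /=.
        have := velocity_tpush GH lid Hu (ld _ _ Hu la).
        rewrite /velocity (tmap_incl_tpush GH lid Hu (ld _ _ Hu la)) /= => -> ua.
        rewrite ua; exact: (tpush0 hstar cstar grp_commute0 (id : W -> A)).
      split.
        have := grp_tangent Hu (in_lie0 hstar cstar EH); rewrite mulr0.
        by rewrite (tpush0 hstar cstar grp_commute0 (id : W -> A)).
      have t0 : tangent_dir H u 0.
        by rewrite -(mulr0 u); apply: ld => //; exact: in_lie0.
      rewrite -(tpush0 hstar cstar grp_commute0 (id : W -> A) u).
      rewrite (tmap_incl_tpush GH lid Hu t0).
      rewrite /tpush /tzero; congr TVec; apply/funext => c.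
      by case: ifP => // _; rewrite linear0.
    move=> c [/= -> _].
    have -> : [set tcomp v (Chart setT id id) | v in
        tmap G (banach_manifold W) id @` tangent_space G u] =
        [set y : W | u * lie_proj EH (st u * y) = y].
      apply/seteqP; split=> [_ [_ [v /(grp_tangentE Hu)[a la ->] <-] <-]|y /= yE].
        have := velocity_tpush GH lid Hu (ld _ _ Hu la).
        by rewrite /velocity => -> /=; rewrite (grp_mulVK _ Hu) lie_proj_id.
      have la := lie_projP hstar cstar EH (st u * y).
      exists (tmap G (banach_manifold W) id (gpush u (u * lie_proj EH (st u * y)))).
        by eexists; first exact: grp_tangent la.
      by have := velocity_tpush GH lid Hu (ld _ _ Hu la); rewrite /velocity => ->.
    apply: (@complemented_proj R W (fun y => u * lie_proj EH (st u * y))).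
      exact: cont_linear_comp (cont_linear_comp (cont_linear_mull (st u))
        (lie_proj_cont_linear hstar cstar EH)) (cont_linear_mull u).
    move=> y; rewrite (grp_mulVK _ Hu) (lie_proj_id (EH := EH))//.
    exact: lie_projP.
  + move=> B; split=> [[BG oB]|[U [oU ->]]]; last first.
      have := hom_mopen hstar cstar EH1 grp_commute0 grp_eqP.
      move: oU => [_ /(_ _ erefl)]; rewrite /= setIT image_id => oU /(_ _ oU).
      by rewrite /= !image_id.
    rewrite grp_carrier in BG.
    pose N (g : W) := [set x : W | slice_dom EH E0 (st g * x)].
    pose Cg (g : W) (x : W) := slice_chart hstar cstar grp_commute0 (st g * x).
    pose ch g := hom_chart hstar cstar grp_commute0 (id : W -> A) g.
    pose U := \bigcup_(g in H) (N g `&` Cg g @^-1` (ch g @` (B `&` cdom (ch g)))).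
    have DE g x : H g -> H x -> cdom (ch g) x <-> N g x.
      by move=> Hg Hx; exact: (hom_chart_dom hstar cstar grp_commute0 grp_eqP g Hx).
    have CE g x : H x -> ch g x = Cg g x.
      by move=> Hx; exact: (hom_chartE hstar cstar grp_commute0 grp_eqP).
    exists U; split.
      split=> // _ ->; rewrite setIT image_id.
      apply: bigcup_open => g Hg; apply: smooth_preimage.
      * apply: open_translate; exact: (open_slice_dom hstar cstar).
      * by apply: oB; exists g.
      * exact: smooth_chart_translate.
    apply/seteqP; split=> [x Bx|x].
      have Hx := BG _ Bx; split; first by rewrite grp_carrier.
      have [_ cx] : chart_at G x (ch x).
        exact: (chart_at_center hstar cstar EH1 grp_commute0 grp_eqP Hx).
      exists x => //; split; first by apply/DE.
      by rewrite /= -CE//; exists x.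
    rewrite grp_carrier => -[Hx [g Hg [Nx [y [By cy] yx]]]].
    have Hy := BG _ By; have cx : cdom (ch g) x by apply/DE.
    have uc z : H z -> cdom (ch g) z -> cinv (ch g) (ch g z) = z.
      move=> Hz cz; have zc : chart_at G z (ch g) by split; [exists g|].
      exact: (pr_cinv GH Hz zc).
    suff -> : x = y by [].
    by rewrite -(uc x Hx cx) -(uc y Hy cy) yx (CE g x).
- apply/seteqP; split=> [_ [v /(grp_tangentE H1)[a la ->] <-]|a la].
    by rewrite (velocity_tpush GH lid H1 (ld _ _ H1 la)) /= mul1r.
  exists (gpush 1 (1 * a)); first exact: grp_tangent.
  by rewrite (velocity_tpush GH lid H1 (ld _ _ H1 la)) /= mul1r.
Qed.

Section Projection.
Variables (EK : cond_expectation star).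
Hypothesis EHK : forall x, EH (EK x) = EK (EH x).
Variables (T : Type) (pr : W -> T).
Hypothesis prP : forall u v, H u -> H v -> (pr u = pr v <-> in_stab EH EK (st u * v)).
Local Notation M := (hom_manifold hstar cstar EHK pr).
Local Notation push := (tpush M H pr).

Let MH : presented M H pr := hom_presented hstar cstar EH1 EHK prP.
Let ld := lie_tangent_dir hstar cstar EH1.

Lemma quotient_lift u : lift_at H (id : W -> A) H pr (pr : A -> T) id u.
Proof. by exists setT; split=> //; [exact: openT|exact: smooth_id]. Qed.

Lemma tmap_quotient u a : H u -> in_lie EH a ->
  tmap G M (pr : A -> T) (gpush u (u * a)) = push u (u * a).
Proof.
move=> Hu la; rewrite (tmap_tpush grp_presented MH Hu (quotient_lift u) (ld Hu la)).
by have [_ ->] := cont_linear_is_diff u (@cont_linear_id R W).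
Qed.

(** The identity of A lifts the quotient map, whose tangent map is therefore
    u a |-> u a, with kernel the a in Ran EK. *)
Lemma grp_quotient_manifold : quotient_manifold G M (pr : A -> T).
Proof.
split.
- exact: (hom_is_manifold hstar cstar EH1 EHK prP).
- by rewrite grp_carrier.
- split.
    by apply: (smooth_map_lift grp_presented MH) => u _; exact: quotient_lift.
  move=> u; rewrite grp_carrier => Hu; split.
    apply/seteqP; split=> [_ [v /(grp_tangentE Hu)[a la ->] <-]|v].
      by rewrite tmap_quotient//; exact: (hom_tangent_space hstar cstar EH1 EHK prP).
    move=> /(hom_tangentE EH1 prP Hu)[a la ->].
    by exists (gpush u (u * a)); [exact: grp_tangent|exact: tmap_quotient].
  have -> : tker G M (pr : A -> T) u =
      [set v | exists a, [/\ in_lie EH a, EK a = a & v = gpush u (u * a)]].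
    apply/seteqP; split=> [v [/(grp_tangentE Hu)[a la ->]]|_ [a [la Ea ->]]].
      rewrite tmap_quotient// => /(hom_tpush_zero hstar cstar EH1 EHK prP Hu la) Ea.
      by exists a.
    split; first exact: grp_tangent.
    by rewrite tmap_quotient//; apply/(hom_tpush_zero hstar cstar EH1 EHK prP Hu la).
  apply: (tcomplemented_lie EH1 grp_eqP) => //.
  + exact: expec_cont_linear.
  + by move=> a la; apply: in_lie_expec.
  + by move=> a; rewrite expec_idem.
Qed.

End Projection.
End Quotient.

(** * Principal bundles of homogeneous spaces and their connections *)

(** The bundle H/K -> H/B for subgroups K and B of the unitary group H, given by
    expectations with Ran EK inside Ran EB.  The map pr that presents the total
    space presents the structure group as well, by restriction to B, and mu and
    sig are an action and a projection that pr turns into products and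
    classes. *)
Section Bundle.
Variables (R : realType) (A : banachAlgType R) (star : A -> A).
Hypotheses (hstar : involution star)
  (cstar : continuous (star : realified A -> realified A)).
Local Notation W := (realified A).
Local Notation st := (star : W -> W).
Local Notation E1 := (expec_id star).
Variables (EB EK : cond_expectation star).
Hypotheses (EB1 : EB 1 = 1) (EBK : forall x, EB (EK x) = EK (EB x))
  (EKB : forall x, EB (EK x) = EK x).
Local Notation H := (in_grp E1).
Local Notation B := (in_grp EB).
Local Notation K := (in_stab E1 EK).
Variables (pr : W -> A) (TB : Type) (prB : W -> TB).
Hypothesis prP : forall u v, H u -> H v -> (pr u = pr v <-> K (st u * v)).
Hypothesis prG : forall u v, B u -> B v -> (pr u = pr v <-> in_stab EB EK (st u * v)).
Hypothesis prBP : forall u v, H u -> H v -> (prB u = prB v <-> in_stab E1 EB (st u * v)).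
Variables (mu : A -> A -> A) (sig : A -> TB).
Hypothesis prM : forall u v, B u -> B v -> pr (u * v) = pr u * pr v.
Hypothesis prV : forall u, B u -> star (pr u) = pr (st u).
Hypothesis muE : forall u d, H u -> B d -> mu (pr u) (pr d) = pr (u * d).
Hypothesis sigE : forall u, H u -> sig (pr u) = prB u.

Let E11 : E1 1 = 1 := erefl.
Let E1K (x : W) : E1 (EK x) = EK (E1 x) := erefl.
Let E1B (x : W) : E1 (EB x) = EB (E1 x) := erefl.
Let grpM := @grp_mul _ _ _ hstar E1.
Let grpS := @grp_star _ _ _ hstar E1.
Let BM := @grp_mul _ _ _ hstar EB.
Let BS := @grp_star _ _ _ hstar EB.
Let gKV := @grp_mulKV _ _ star E1.
Let gVK := @grp_mulVK _ _ star E1.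

Definition total_space := hom_manifold hstar cstar E1K pr.
Definition base_space := hom_manifold hstar cstar E1B prB.
Definition structure_group := hom_manifold hstar cstar EBK pr.
Local Notation P := total_space.
Local Notation Z := base_space.
Local Notation G := structure_group.

Let PH : presented P H pr := hom_presented hstar cstar E11 E1K prP.
Let ZH : presented Z H prB := hom_presented hstar cstar E11 E1B prBP.
Let GH : presented G B pr := hom_presented hstar cstar EB1 EBK prG.

Lemma sub_grp u : B u -> H u.
Proof. by move=> [? ? _]; split. Qed.
Let BH := sub_grp.

Lemma base_stabE d : in_stab E1 EB d <-> B d.
Proof.
split=> [[[? ? _]]|[? ? Ed]].
  rewrite /affine_fix (clinB (expec_cont_linear EB)) EB1 => /addIr ?.
  by split.
split; first by split.
by rewrite /affine_fix (clinB (expec_cont_linear EB)) EB1 Ed.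
Qed.

Lemma total_stab_sub d : K d -> B d.
Proof.
move=> [Hd Ed]; apply/base_stabE; split=> //.
by rewrite /affine_fix -Ed EKB.
Qed.

Lemma group_stabE d : in_stab EB EK d <-> K d.
Proof.
split=> [[Bd Ed]|Kd]; first by split=> //; exact: BH.
by split; [exact: total_stab_sub|case: Kd].
Qed.

Lemma pr_mulK u d : H u -> K d -> pr (u * d) = pr u.
Proof. exact: (pr_stab hstar cstar prP). Qed.

Lemma prB_mulB u d : H u -> B d -> prB (u * d) = prB u.
Proof. by move=> Hu /base_stabE; exact: (pr_stab hstar cstar prBP). Qed.

Lemma prB_eq u v : H u -> H v -> prB u = prB v -> exists2 d, B d & v = u * d.
Proof.
move=> Hu Hv /(pr_eq prBP Hu Hv)[d /base_stabE Bd ->]; by exists d.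
Qed.

Section Trivialization.
Variable g : W.
Hypothesis Hg : H g.
Local Notation D := [set u : W | slice_dom E1 EB (st g * u)].

(** A section of the base over the domain of a chart, as a map of the group:
    the representative of the coset of u chosen by the slice at g. *)
Definition local_section (u : W) : W := g * normalized EB (st g * u).
Local Notation S := local_section.

Lemma local_sectionE u : H u -> D u -> exists2 d, B d & S u = u * d.
Proof.
move=> Hu Du; exists (polar EB (st g * u)); last first.
  by rewrite /S /normalized mulrA gKV.
apply/base_stabE.
exact: (polar_stab hstar cstar E11 E1B (grpM (grpS Hg) Hu) Du).
Qed.

Lemma local_section_mul u d : H u -> B d -> S (u * d) = S u.
Proof.
move=> Hu /base_stabE Kd; rewrite /local_section.
by rewrite (mulrA (st g) u d) (normalized_mul hstar _ Kd).
Qed.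

Lemma local_dom_mul u d : H u -> B d -> D (u * d) <-> D u.
Proof.
move=> Hu /base_stabE Kd; rewrite /= mulrA.
exact: (slice_dom_mulP hstar cstar).
Qed.

Lemma smooth_local_section : smooth D S.
Proof.
have oD : open D by apply: open_translate; exact: (open_slice_dom hstar cstar).
apply: (smooth_linc oD (cont_linear_mull g)).
apply: (@smooth_comp R _ _ _ _ (slice_pre EB) (fun u => st g * u) (normalized EB)) => //.
- exact: (open_slice_pre hstar cstar).
- by move=> u [].
- by apply: smooth_lin; exact: cont_linear_mull.
- exact: (smooth_normalized hstar cstar).
Qed.

(** With S the local section, the class of u corresponds to its class in the
    base and to the element S(u)^* u of the structure group. *)
Definition trivialization (x : A) : TB * A :=
  let u := hom_rep E1 pr x in (prB u, pr (st (S u) * u)).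

Definition trivialization_inv (q : TB * A) : A :=
  pr (S (hom_rep E1 prB q.1) * hom_rep EB pr q.2).

Lemma local_section_grp u : H u -> D u -> H (S u).
Proof.
by move=> Hu Du; have [d Bd ->] := local_sectionE Hu Du; apply: grpM => //; exact: BH.
Qed.

Lemma local_section_group u : H u -> D u -> B (st (S u) * u).
Proof.
move=> Hu Du; have [d Bd ->] := local_sectionE Hu Du.
by rewrite starMW// -mulrA; have [_ -> _] := Hu; rewrite mulr1; exact: BS.
Qed.

Lemma trivializationE u : H u -> D u ->
  trivialization (pr u) = (prB u, pr (st (S u) * u)).
Proof.
move=> Hu Du; rewrite /trivialization.
have [d Kd ->] := hom_repP prP Hu; have Bd := total_stab_sub Kd.
rewrite prB_mulB// local_section_mul// mulrA pr_mulK//.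
by apply: grpM => //; apply: grpS; exact: local_section_grp.
Qed.

Lemma trivialization_invE u d : H u -> D u -> B d ->
  trivialization_inv (prB u, pr d) = pr (S u * d).
Proof.
move=> Hu Du Bd; rewrite /trivialization_inv /=.
have [b /base_stabE Bb ->] := hom_repP prBP Hu.
have [k /group_stabE Kk ->] := hom_repP prG Bd.
rewrite local_section_mul// mulrA pr_mulK//.
by apply: grpM; [exact: local_section_grp|exact: BH].
Qed.

Lemma base_domE u : H u ->
  (prB @` (H `&` [set u : W | slice_dom E1 EB (st g * u)])) (prB u) <-> D u.
Proof.
move=> Hu; split=> [[v [Hv Dv] uv]|Du]; last by exists u.
have [d Bd ->] := prB_eq Hv Hu uv.
by apply/local_dom_mul.
Qed.

Lemma bundle_trivializable : trivializable_over P Z G *%R mu sig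
  (prB @` (H `&` [set u : W | slice_dom E1 EB (st g * u)])).
Proof.
have oD : open D by apply: open_translate; exact: (open_slice_dom hstar cstar).
have sS := smooth_local_section.
have ZGH := presented_prod ZH GH.
exists trivialization, trivialization_inv; split.
- apply: (smooth_on_lift PH ZGH) => [x []//|u Hu [_ /=]].
  rewrite sigE// => /(base_domE Hu) Du.
  exists D, (fun u => (u, st (S u) * u)); split=> //.
    apply: smooth_pair => //; first exact: smooth_id.
    apply: smoothM => //; last exact: smooth_id.
    by apply: smooth_linc sS => //; exact: star_cont_linear.
  move=> v Hv Dv; split.
  + split; first by exists v.
    by rewrite /= sigE//; apply/base_domE.
  + by split=> //; exact: local_section_group.
  + by rewrite trivializationE.
- apply: (smooth_on_lift ZGH PH).
    by move=> [z x] [/= [u [Hu _] <-] Gx]; split=> //; exists u.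
  move=> [u d] [/= Hu Bd] [/= /(base_domE Hu) Du _].
  exists (D `*` setT), (fun p => S p.1 * p.2); split=> //.
  + by apply: openX => //; exact: openT.
  + have o : open (D `*` [set: W]) by apply: openX => //; exact: openT.
    apply: smoothM => //; last by apply: smooth_lin; exact: cont_linear_snd.
    apply: (@smooth_comp R _ _ _ _ D fst S) => //; first by move=> p [].
    by apply: smooth_lin; exact: cont_linear_fst.
  + move=> [v b] [/= Hv Bb] [/= Dv _]; split.
    * by split; [apply/base_domE|exists b].
    * by apply: grpM; [exact: local_section_grp|exact: BH].
    * by rewrite trivialization_invE.
- move=> _ [u Hu <-]; rewrite sigE// => /(base_domE Hu) Du.
  have Bs := local_section_group Hu Du; have HS := local_section_grp Hu Du.
  rewrite trivializationE//; split=> //=.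
  + by exists (st (S u) * u).
  + by rewrite trivialization_invE// gKV.
  + move=> _ [d Bd <-]; have Hd := BH Bd; have Hud := grpM Hu Hd.
    rewrite muE// trivializationE//; last exact/local_dom_mul.
    by rewrite prB_mulB// local_section_mul// mulrA prM.
- move=> [z x] [u [Hu Du] /= <-] [d Bd <-].
  have HS := local_section_grp Hu Du; have Hd := BH Bd.
  have HSd := grpM HS Hd.
  have [b Bb SE] := local_sectionE Hu Du.
  have Bbd := BM Bb Bd.
  have SdE : S u * d = u * (b * d) by rewrite SE mulrA.
  rewrite trivialization_invE//; split.
  + by exists (S u * d).
  + by rewrite sigE// SdE prB_mulB.
  + rewrite trivializationE//; last by rewrite SdE; apply/local_dom_mul.
    rewrite {1 2}SdE prB_mulB// local_section_mul//.
    by rewrite (gVK d HS).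
Qed.

End Trivialization.

Theorem hom_principal_bundle : principal_bundle P Z G *%R (pr 1) mu sig.
Proof.
have PGH := presented_prod PH GH; have B1 := grp1 hstar EB1.
split.
- exact: (hom_is_manifold hstar cstar E11 E1K prP).
- exact: (hom_is_manifold hstar cstar E11 E1B prBP).
- exact: (hom_lie_group hstar cstar EB1 EBK prG).
- apply: (smooth_map_lift PH ZH (F := id)) => u _; exists setT; split=> //.
  + exact: openT.
  + exact: smooth_id.
  + by move=> v Hv _; rewrite sigE.
- apply: (smooth_map_lift PGH PH (F := fun p : W * W => p.1 * p.2)).
  move=> [u d] _; exists setT; split=> //; first exact: openT.
    apply: smoothM; [exact: openT| |]; apply: smooth_lin.
      exact: cont_linear_fst.
    exact: cont_linear_snd.
  move=> [v b] [/= Hv Bb] _; split; last by rewrite muE.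
  by apply: grpM => //; exact: BH.
- by move=> _ [u Hu <-]; rewrite muE// mulr1.
- move=> _ _ _ [u Hu <-] [d Bd <-] [b Bb <-].
  by rewrite -prM// !muE ?mulrA//; [apply: grpM => //; exact: BH|exact: BM].
- move=> _ _ [u Hu <-] [d Bd <-]; have Hd := BH Bd.
  rewrite muE// => /(prP (grpM Hu Hd) Hu).
  rewrite starMW// -mulrA; have [_ -> _] := Hu; rewrite mulr1 => Kd.
  by apply/(prG Bd B1); rewrite mulr1; apply/group_stabE.
- move=> _ _ [u Hu <-] [v Hv <-]; rewrite !sigE//; split=> [/esym|].
    move=> /(prB_eq Hu Hv)[d Bd ->]; exists (pr d); first by exists d.
    by rewrite muE.
  move=> [_ [d Bd <-]]; have Hd := BH Bd; rewrite muE// => vE.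
  by rewrite -(sigE Hv) vE sigE ?prB_mulB//; exact: grpM.
- move=> _ [g Hg <-]; exists (prB @` (H `&` [set u : W | slice_dom E1 EB (st g * u)])).
  split.
  + apply: (hom_mopen hstar cstar E11 E1B prBP).
    by apply: open_translate; exact: (open_slice_dom hstar cstar).
  + exists g => //; split=> //=; have [_ -> _] := Hg.
    exact: (slice_dom1 hstar cstar E11 E1B).
  + exact: bundle_trivializable.
Qed.

Local Notation push := (tpush P H pr).
Local Notation bpush := (tpush Z H prB).
Let ld := @lie_tangent_dir _ _ _ hstar cstar E1 E11.

Lemma mul_lift d u : B d -> lift_at H pr H pr (mu^~ (pr d)) (fun v => v * d) u.
Proof.
move=> Bd; exists setT; split=> //; first exact: openT.
  by apply: smooth_lin; exact: cont_linear_mulr.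
by move=> v Hv _; split; [apply: grpM => //; exact: BH|rewrite muE].
Qed.

Lemma lie_conj d a : H d -> in_lie E1 a -> in_lie E1 (st d * a * d).
Proof.
move=> Hd [sa _]; split=> //.
by rewrite starMW// starMW// starKW// sa mulNr mulrN mulrA.
Qed.

Lemma translate_dir u a d : B d -> (u * a) * d = (u * d) * (st d * a * d).
Proof.
by move=> [dd _ _]; rewrite -!mulrA (mulrA d) dd mul1r.
Qed.

Lemma tmap_mul d u a : B d -> H u -> in_lie E1 a ->
  tmap P P (mu^~ (pr d)) (push u (u * a)) = push (u * d) ((u * d) * (st d * a * d)).
Proof.
move=> Bd Hu la; rewrite (tmap_tpush PH PH Hu (mul_lift u Bd) (ld Hu la)).
have [_ ->] := cont_linear_is_diff u (cont_linear_mulr d).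
by rewrite translate_dir.
Qed.

(** Two descriptions of one tangent vector, from two representatives of the
    same point: the connection has to agree on them. *)
Lemma push_mul d u a : K d -> H u -> in_lie E1 a ->
  push u (u * a) = push (u * d) ((u * d) * (st d * a * d)).
Proof.
move=> Kd Hu la; have Bd := total_stab_sub Kd.
have id_lift : lift_at H pr H pr id (fun v => v * d) u.
  exists setT; split=> //; first exact: openT.
    by apply: smooth_lin; exact: cont_linear_mulr.
  by move=> v Hv _; split; [apply: grpM => //; exact: BH|rewrite pr_mulK].
rewrite (tpush_lift_id PH Hu id_lift (ld Hu la)).
have [_ ->] := cont_linear_is_diff u (cont_linear_mulr d).
by rewrite translate_dir.
Qed.

(** Equivariance of the connection, and its independence of the representative,
    both come from this identity. *)
Lemma expec_conj d a : B d -> EB (st d * a * d) = st d * EB a * d.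
Proof.
move=> [_ _ Ed]; have Esd : EB (st d) = st d by exact: fix_star.
have -> : EB (st d * a * d) = EB (st d * a) * d.
  by have := expec_modr hstar EB (st d * a) d; rewrite Ed.
by have := expec_mod EB (st d) a; rewrite Esd => ->.
Qed.

Lemma in_lie_base a : in_lie E1 a -> in_lie E1 (EB a).
Proof. by apply: in_lie_expec. Qed.

Lemma total_tpush_eq u a b : H u -> in_lie E1 a -> in_lie E1 b ->
  push u (u * a) = push u (u * b) <-> EK (a - b) = a - b.
Proof. exact: (hom_tpush_eq hstar cstar E11 E1K prP). Qed.

(** At the point of u the connection is u a |-> u (EB a), transported along
    the presentation. *)
Definition connection (v : tvec A (range_of (slice_projector hstar cstar E1K))) :=
  let p : W * W := xget 0 [set p : W * W | [/\ H p.1, in_lie E1 p.2 &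
    v = push p.1 (p.1 * p.2)]] in
  push p.1 (p.1 * EB p.2).

(** Well-definedness: two presentations of a tangent vector differ by an element
    d of K and by a direction fixed by EK; EB commutes with conjugation by d and
    preserves the directions fixed by EK. *)
Lemma connectionE u a : H u -> in_lie E1 a ->
  connection (push u (u * a)) = push u (u * EB a).
Proof.
move=> Hu la; rewrite /connection; case: xgetP => [[u' a'] _|no]; last first.
  by exfalso; apply: (no (u, a)).
move=> [/= Hu' la' va].
have [d Kd u'E] := pr_eq prP Hu Hu' (congr1 (@tpt _ _ _) va).
have Bd := total_stab_sub Kd; have Hd := BH Bd.
have lda := lie_conj Hd la.
move: va; rewrite (push_mul Kd Hu la) (push_mul Kd Hu (in_lie_base la)).
rewrite -expec_conj// -u'E => /(total_tpush_eq Hu' lda la') dE.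
apply/esym/total_tpush_eq => //; [exact: in_lie_base|exact: in_lie_base|].
by rewrite -(clinB (expec_cont_linear EB)) -{2}dE EBK.
Qed.

Lemma total_tangentE u v : H u -> tangent_space P (pr u) v ->
  exists2 a, in_lie E1 a & v = push u (u * a).
Proof. exact: (hom_tangentE E11 prP). Qed.

Lemma total_tangent u a : H u -> in_lie E1 a ->
  tangent_space P (pr u) (push u (u * a)).
Proof. exact: (hom_tangent_space hstar cstar E11 E1K prP). Qed.

Lemma tmap_proj u a : H u -> in_lie E1 a ->
  tmap P Z sig (push u (u * a)) = bpush u (u * a).
Proof.
move=> Hu la.
have id_lift : lift_at H pr H prB sig id u.
  exists setT; split=> //; [exact: openT|exact: smooth_id|].
  by move=> v Hv _; rewrite sigE.
rewrite (tmap_tpush PH ZH Hu id_lift (ld Hu la)).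
by have [_ ->] := cont_linear_is_diff u (@cont_linear_id R W).
Qed.

Theorem hom_principal_connection : principal_connection P Z G mu sig connection.
Proof.
have tangent_at v : is_tangent P v -> exists u a,
    [/\ H u, in_lie E1 a & v = push u (u * a)].
  move=> tv; have [[u Hu vu] _ _] := tv.
  by have [a la ->] := total_tangentE Hu (conj tv (esym vu)); exists u, a.
have lEB := expec_cont_linear EB.
split.
- apply: (smooth_bundle_map PH (Psi := fun u k => u * EB (st u * k))).
  + have oT := @openT (W * W)%type.
    have s1 : smooth setT (@fst W W) by apply: smooth_lin; exact: cont_linear_fst.
    apply: smoothM => //; apply: smooth_linc => //; apply: smoothM => //.
      by apply: smooth_linc => //; exact: star_cont_linear.
    by apply: smooth_lin; exact: cont_linear_snd.
  + move=> u k Hu /(tangent_dir_lieE hstar cstar E11 Hu)[a la ->].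
    by rewrite gVK//; apply: ld => //; exact: in_lie_base.
  + move=> u k Hu /(tangent_dir_lieE hstar cstar E11 Hu)[a la ->].
    by rewrite gVK// connectionE.
- move=> x v tv; have [tv' vx] := tv; have [[u Hu ux] _ _] := tv'.
  rewrite vx in ux; clear vx; subst x; have [a la ->] := total_tangentE Hu tv.
  by rewrite connectionE//; apply: total_tangent => //; exact: in_lie_base.
- move=> x c v w tv tw; have [tv' vx] := tv; have [[u Hu ux] _ _] := tv'.
  rewrite vx in ux; clear vx; subst x; have [a la ->] := total_tangentE Hu tv.
  have [b lb ->] := total_tangentE Hu tw.
  rewrite !connectionE// !tlin_tpush scale_mulr -mulrDr.
  rewrite connectionE//; last by apply: in_lieD => //; exact: in_lieZ.
  by rewrite (clinD lEB) (clinZ lEB) mulrDr -scale_mulr.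
- move=> v /tangent_at[u [a [Hu la ->]]].
  rewrite !connectionE//; last exact: in_lie_base.
  by rewrite expec_idem.
- move=> _ [u Hu <-]; apply/seteqP; split.
    move=> _ [v /(total_tangentE Hu)[a la ->] <-]; have lEa := in_lie_base la.
    rewrite connectionE//; split; first exact: total_tangent.
    rewrite tmap_proj// sigE//.
    by apply/(hom_tpush_zero hstar cstar E11 E1B prBP Hu lEa); rewrite expec_idem.
  move=> v [tv]; have [a la ->] := total_tangentE Hu tv.
  rewrite tmap_proj// sigE// => /(hom_tpush_zero hstar cstar E11 E1B prBP Hu la) Ea.
  exists (push u (u * a)); first exact: total_tangent.
  by rewrite connectionE// Ea.
- move=> _ v [d Bd <-] /tangent_at[u [a [Hu la ->]]]; have Hd := BH Bd.
  have Hud := grpM Hu Hd; have lda := lie_conj Hd la.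
  rewrite connectionE// !tmap_mul//; last exact: in_lie_base.
  by rewrite connectionE// expec_conj.
Qed.

End Bundle.

(** * Flags of projections and the unitary Stiefel bundle *)

Section Flag.
Variables (R : realType) (A : banachAlgType R) (star : A -> A).
Hypotheses (hstar : involution star)
  (cstar : continuous (star : realified A -> realified A)).
Local Notation W := (realified A).
Local Notation st := (star : W -> W).
Variables (n : nat) (delta : 'I_n -> A).
Hypotheses (hdelta : is_flag delta) (sdelta : forall j, delta j = star (delta j)).
Local Notation p := (flag_idem delta : nat -> W).
Local Notation E1 := (expec_id star).

Definition flag_proj (j : nat) : W := p j - p j.-1.
Local Notation e := flag_proj.

Lemma flag_idemS (j : 'I_n) : p j.+1 = delta j.
Proof. by rewrite /flag_idem valK. Qed.

Lemma flag_idem_last : p n.+1 = 1.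
Proof. by rewrite /flag_idem insubN// ltnn. Qed.

Lemma flag_idem_mul i j : (i <= n.+1)%N -> (j <= n.+1)%N ->
  p i * p j = p (minn i j).
Proof.
move=> ni nj; have [pM _] := hdelta; have [ij|ij] := leqP i j.
  by have [] := pM i j; rewrite ?ij.
by have [|_] := pM j i; rewrite ?(ltnW ij).
Qed.

Lemma star_flag_idem j : st (p j) = p j.
Proof.
case: j => [|j]; first exact: (star0W hstar cstar).
rewrite /flag_idem; case: insub => [i|]; first by rewrite -sdelta.
exact: (star1W hstar).
Qed.

Lemma star_flag_proj j : st (e j) = e j.
Proof. by rewrite /e starBW// !star_flag_idem. Qed.

Lemma flag_proj_idem k j : (k <= n.+1)%N -> (j <= n.+1)%N ->
  p k * e j = (if (j <= k)%N then e j else 0) /\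
  e j * p k = (if (j <= k)%N then e j else 0).
Proof.
move=> nk nj; have nj1 : (j.-1 <= n.+1)%N by exact: leq_trans (leq_pred _) nj.
rewrite /e mulrBr mulrBl !flag_idem_mul//.
have [jk|jk] := leqP j k.
  have j1k : (j.-1 <= k)%N by exact: leq_trans (leq_pred _) jk.
  by rewrite (minn_idPr j1k) (minn_idPl j1k).
have kj1 : (k <= j.-1)%N by rewrite -ltnS prednK//; exact: leq_ltn_trans jk.
by rewrite (minn_idPl kj1) (minn_idPr kj1) subrr.
Qed.

Lemma flag_proj_mul i j : (0 < i <= n.+1)%N -> (0 < j <= n.+1)%N ->
  e i * e j = if i == j then e i else 0.
Proof.
move=> /andP[i0 ni] /andP[j0 nj].
have ni1 : (i.-1 <= n.+1)%N by exact: leq_trans (leq_pred _) ni.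
have [pe _] := flag_proj_idem ni nj; have [pe1 _] := flag_proj_idem ni1 nj.
have ji1 : (j <= i.-1)%N = (j < i)%N by rewrite -ltnS prednK.
rewrite {1}/e mulrBl pe pe1 ji1.
by have [ij|ij|->] := ltngtP i j; rewrite ?subrr ?subr0//.
Qed.

Lemma sum_flag_proj : \sum_(1 <= j < n.+2) e j = 1.
Proof.
rewrite big_add1 /= (eq_big_nat _ _ (F2 := fun j => p j.+1 - p j))//.
by rewrite telescope_sumr// flag_idem_last subr0.
Qed.

Local Notation Phi := (truncation delta : W -> W).

Lemma truncationE (x : W) : Phi x = \sum_(1 <= j < n.+2) e j * x * e j.
Proof. by []. Qed.

Lemma flag_proj_truncation i (x : W) : (0 < i <= n.+1)%N ->
  e i * Phi x = e i * x * e i /\ Phi x * e i = e i * x * e i.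
Proof.
move=> i0n; have iin : i \in index_iota 1 n.+2 by rewrite mem_index_iota.
have inj j : j \in index_iota 1 n.+2 -> (0 < j <= n.+1)%N.
  by rewrite mem_index_iota.
rewrite truncationE big_distrr big_distrl /=; split.
  rewrite (bigD1_seq i iin (iota_uniq _ _)) /= big1_seq ?addr0.
    by rewrite !mulrA flag_proj_mul// eqxx.
  move=> j /andP[ji /inj j0n]; rewrite !mulrA flag_proj_mul//.
  by rewrite eq_sym (negPf ji) !mul0r.
rewrite (bigD1_seq i iin (iota_uniq _ _)) /= big1_seq ?addr0.
  by rewrite -mulrA flag_proj_mul// eqxx.
move=> j /andP[ji /inj j0n]; rewrite -mulrA flag_proj_mul//.
by rewrite (negPf ji) mulr0.
Qed.

Fact truncation_cont_linear : cont_linear Phi.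
Proof.
have -> : Phi = (fun x => \sum_(1 <= j < n.+2) e j * x * e j) by [].
elim: (index_iota 1 n.+2) => [|j s IH].
  rewrite (_ : (fun _ => _) = (fun=> 0)); first exact: cont_linear0.
  by apply/funext => x; rewrite big_nil.
rewrite (_ : (fun _ => _) = (fun x => e j * x * e j + \sum_(i <- s) e i * x * e i)).
  apply: cont_linearD => //.
  exact: cont_linear_comp (cont_linear_mull (e j)) (cont_linear_mulr (e j)).
by apply/funext => x; rewrite big_cons.
Qed.

Fact truncation_idem (x : W) : Phi (Phi x) = Phi x.
Proof.
rewrite [LHS]truncationE [RHS]truncationE; apply: eq_big_nat => j j0n.
have [-> _] := flag_proj_truncation x j0n.
by rewrite -mulrA flag_proj_mul// eqxx.
Qed.

Fact truncation_star (x : W) : Phi (st x) = st (Phi x).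
Proof.
rewrite !truncationE.
have stS (F : nat -> W) s : st (\sum_(j <- s) F j) = \sum_(j <- s) st (F j).
  elim: s => [|j s IH]; first by rewrite !big_nil star0W.
  by rewrite !big_cons starDW// IH.
rewrite stS; apply: eq_bigr => j _.
have -> : st (e j * x * e j) = st (e j) * (st x * st (e j)).
  by rewrite starMW// starMW.
by rewrite star_flag_proj mulrA.
Qed.

Fact truncation_mod (x y : W) : Phi (Phi x * y) = Phi x * Phi y.
Proof.
rewrite [LHS]truncationE [in RHS](truncationE y) big_distrr /=.
apply: eq_big_nat => j j0n; have [e1 e2] := flag_proj_truncation x j0n.
by rewrite !mulrA e1 e2.
Qed.

Definition expec_trunc : cond_expectation star :=
  @CondExpectation _ _ star Phi truncation_cont_linear truncation_idem
    truncation_star truncation_mod.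
Local Notation EB := expec_trunc.

Lemma truncation1 : Phi 1 = 1.
Proof.
rewrite truncationE -[RHS]sum_flag_proj; apply: eq_big_nat => j j0n.
by rewrite mulr1 flag_proj_mul// eqxx.
Qed.

Lemma truncation_comm k (x : W) : (k <= n.+1)%N -> Phi x = x -> x * p k = p k * x.
Proof.
move=> nk <-; rewrite truncationE big_distrl big_distrr /=.
apply: eq_big_nat => j /andP[_ nj]; have [e1 e2] := flag_proj_idem nk nj.
rewrite -[LHS]mulrA e2 !mulrA e1.
by case: ifP => // _; rewrite mulr0 !mul0r.
Qed.

(** The structure group of the bundle and the stabilizer of the flag are thus
    given by the truncation. *)
Lemma truncation_fixE (x : W) : Phi x = x <-> block_diagonal delta x.
Proof.
split=> [Px j|xd].
  rewrite -[delta j]flag_idemS; apply: (truncation_comm _ Px).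
  by rewrite ltnS ltnW.
have xp k : x * p k = p k * x.
  case: k => [|k]; first by rewrite mulr0 mul0r.
  rewrite /flag_idem; case: insub => [j|]; first exact: xd.
  by rewrite mulr1 mul1r.
have xe k : e k * x = x * e k by rewrite /e mulrBl mulrBr !xp.
rewrite truncationE -[RHS]mulr1 -[in RHS]sum_flag_proj big_distrr /=.
apply: eq_big_nat => j j0n.
by rewrite xe -mulrA flag_proj_mul// eqxx.
Qed.

Local Notation pn := (p n).
Local Notation q := (1 - pn).

Lemma pn_idem : pn * pn = pn.
Proof. by rewrite flag_idem_mul// minnn. Qed.

Lemma last_flag_proj : e n.+1 = q.
Proof. by rewrite /e flag_idem_last. Qed.

Lemma pnq : pn * q = 0 /\ q * pn = 0.
Proof. by rewrite mulrBr mulrBl mulr1 mul1r pn_idem subrr. Qed.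

Lemma q_idem : q * q = q.
Proof. by rewrite mulrBl mul1r; have [-> _] := pnq; rewrite subr0. Qed.

Lemma star_q : st q = q.
Proof. by rewrite starBW// star1W// star_flag_idem. Qed.

Definition corner (x : W) : W := q * x * q.

Fact corner_cont_linear : cont_linear corner.
Proof. exact: cont_linear_comp (cont_linear_mull q) (cont_linear_mulr q). Qed.

Fact corner_idem (x : W) : corner (corner x) = corner x.
Proof. by rewrite /corner -!mulrA q_idem !mulrA q_idem. Qed.

Fact corner_star (x : W) : corner (st x) = st (corner x).
Proof.
rewrite /corner; have -> : st (q * x * q) = st q * (st x * st q).
  by rewrite (starMW hstar (q * x)) (starMW hstar q).
by rewrite star_q mulrA.
Qed.

Fact corner_mod (x y : W) : corner (corner x * y) = corner x * corner y.
Proof. by rewrite /corner !mulrA q_idem -(mulrA _ q q) q_idem. Qed.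

(** The expectation onto the corner that is killed by the last projection of
    the flag; its stabilizer is the group of u with u p_n = p_n. *)
Definition expec_corner : cond_expectation star :=
  @CondExpectation _ _ star corner corner_cont_linear corner_idem corner_star
    corner_mod.
Local Notation EK := expec_corner.

(** The corner of 1 - p_n is the last block of the diagonal. *)
Lemma truncation_corner x : EB (EK x) = EK x.
Proof.
rewrite /= truncationE (bigD1_seq n.+1) ?iota_uniq//=; last first.
  by rewrite mem_index_iota /= leqnn.
rewrite last_flag_proj /corner big1_seq ?addr0 => [|j /andP[jn]].
  by rewrite -!mulrA q_idem !mulrA q_idem.
rewrite mem_index_iota => j0n; rewrite -last_flag_proj !mulrA.
by rewrite flag_proj_mul ?leqnn// (negPf jn) !mul0r.
Qed.

Lemma corner_truncation x : EB (EK x) = EK (EB x).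
Proof.
rewrite truncation_corner /= /corner -last_flag_proj.
have n1 : (0 < n.+1 <= n.+1)%N by rewrite leqnn.
by have [-> _] := flag_proj_truncation x n1; rewrite -!mulrA flag_proj_mul// eqxx.
Qed.

Lemma corner_fixE (x : W) : pn * x = 0 -> x * pn = 0 -> corner x = x.
Proof.
move=> px xp; rewrite /corner mulrBl mul1r px subr0 mulrBr mulr1.
by rewrite xp subr0.
Qed.

Definition right_pn (u : W) : A := u * pn.

(** A unitary w with w p_n = p_n also satisfies p_n w = p_n, so w - 1 lies in
    the corner of 1 - p_n. *)
Lemma right_pn_eqP (F : cond_expectation star) u v : in_grp F u -> in_grp F v ->
  (right_pn u = right_pn v <-> in_stab F EK (st u * v)).
Proof.
move=> Fu Fv; have Fw := grp_mul hstar (grp_star hstar Fu) Fv.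
rewrite /right_pn; split=> [uv|[_]].
  split=> //; rewrite /affine_fix /=; set w := st u * v in Fw *.
  have [w1 w2 _] := Fw.
  have wp : w * pn = pn by rewrite /w -mulrA -uv mulrA; have [_ -> _] := Fu; rewrite mul1r.
  have swp : st w * pn = pn by rewrite -{1}wp mulrA w2 mul1r.
  have pw : pn * w = pn.
    by rewrite -[LHS](starKW hstar) starMW// star_flag_idem swp star_flag_idem.
  by apply: corner_fixE; rewrite ?mulrBr ?mulrBl ?pw ?wp ?mulr1 ?mul1r subrr.
rewrite /affine_fix /= => wE.
have : (st u * v - 1) * pn = 0.
  by have [_ qp] := pnq; rewrite -wE /corner -(mulrA _ q pn) qp mulr0.
rewrite mulrBl mul1r => /subr0_eq wp.
by rewrite -[in LHS]wp mulrA mulrA; have [-> _ _] := Fu; rewrite mul1r.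
Qed.

Lemma unitary_inv (u : W) : in_grp E1 u -> (u : A)^-1 = star u.
Proof.
move=> Hu; have uu := grp_unit Hu; have [u1 _ _] := Hu.
by apply: (mulrI uu); rewrite (mulrV uu) u1.
Qed.

Lemma flag_conj_eqP u v : in_grp E1 u -> in_grp E1 v ->
  (flag_conj delta u = flag_conj delta v <-> in_stab E1 EB (st u * v)).
Proof.
move=> Hu Hv; have Hw := grp_mul hstar (grp_star hstar Hu) Hv.
have [u1 u2 _] := Hu; have [v1 v2 _] := Hv.
have stabE : in_stab E1 EB (st u * v) <-> block_diagonal delta (st u * v).
  have lEB := truncation_cont_linear.
  split=> [[_]|/truncation_fixE wE].
    rewrite /affine_fix /= (clinB lEB) truncation1 => /addIr wE.
    exact/truncation_fixE.
  by split=> //; rewrite /affine_fix /= (clinB lEB) truncation1 wE.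
apply: iff_trans (iff_sym stabE); rewrite /flag_conj !unitary_inv//; split=> [uv j|w].
  have := congr1 (fun f => star u * f j * v) uv.
  by rewrite /= !mulrA u2 mul1r -!mulrA v2 mulr1 => <-.
apply/funext => j; have := congr1 (fun x => u * x * star v) (w j).
by rewrite /= !mulrA u1 mul1r -!mulrA v1 mulr1 !mulrA => <-.
Qed.

(** On the Stiefel manifold the inverse of u is not available, but
    u p_j u^-1 = (u p_n) p_j (u p_n)^* because p_j <= p_n. *)
Definition stiefel_proj (x : A) : 'I_n -> A := fun j => x * delta j * star x.

Lemma stiefel_projE u : in_grp E1 u -> stiefel_proj (right_pn u) = flag_conj delta u.
Proof.
move=> Hu; apply/funext => j; rewrite /stiefel_proj /right_pn /flag_conj unitary_inv//.
rewrite (starM hstar).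
have -> : star pn = pn by exact: star_flag_idem.
have dj : pn * delta j * pn = delta j.
  rewrite -[delta j]flag_idemS.
  have nj : (j.+1 <= n.+1)%N by rewrite ltnS ltnW.
  rewrite (flag_idem_mul (leqnSn n) nj) (minn_idPr (ltn_ord j)).
  by rewrite (flag_idem_mul nj (leqnSn n)) (minn_idPl (ltn_ord j)).
by rewrite -[in RHS]dj !mulrA.
Qed.

Lemma block_pn u : in_grp EB u -> u * pn = pn * u.
Proof. by move=> [_ _ Eu]; exact: (truncation_comm (leqnSn n) Eu). Qed.

Lemma right_pnM u v : in_grp EB v -> right_pn u * right_pn v = right_pn (u * v).
Proof.
move=> Bv; rewrite /right_pn.
have -> : u * pn * (v * pn) = u * (pn * v) * pn :> W by rewrite !mulrA.
by rewrite -(block_pn Bv) -!mulrA pn_idem.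
Qed.

Lemma right_pnV u : in_grp EB u -> star (right_pn u) = right_pn (st u).
Proof.
move=> Bu; rewrite /right_pn (starM hstar) block_pn; last exact: grp_star.
by have -> : star pn = pn by exact: star_flag_idem.
Qed.

End Flag.

Theorem proposition3p10 (R : realType) (A : banachAlgType R) (star : A -> A)
    (hstar : involution star)
    (cstar : continuous (star : realified A -> realified A))
    (herm : hermitian_algebra star)
    (n : nat) (hn : (0 < n)%N) (delta : 'I_n -> A)
    (hdelta : is_flag delta) (sdelta : forall j, delta j = star (delta j)) :
  let pn : A := flag_idem delta n in
  let DU : set A := unitary_group star `&` block_diagonal delta in
  let Du : set A := skew_adjoint star `&` block_diagonal delta in
  (* manifold structures on U(A), D^U(delta), V^U(delta, A), G^U(delta) and
     Fl(delta) *)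
  exists (EU ED EV EG EZ : completeNormedModType R)
         (MU : premanifold A EU) (MD : premanifold A ED)
         (V : premanifold A EV) (G : premanifold A EG)
         (Fl : premanifold ('I_n -> A) EZ),
  [/\ carrier MU = unitary_group star /\ unitary_lie_group MU (skew_adjoint star),
      carrier MD = DU /\ unitary_lie_group MD Du,
      quotient_manifold MU V (fun u => u * pn),
      quotient_manifold MD G (fun a => a * pn) &
      quotient_manifold MU Fl (flag_conj delta)] /\
  exists (sigma : A -> 'I_n -> A) (mu : A -> A -> A)
         (Phi : tvec A EV -> tvec A EV),
  [/\ forall u, unitary_group star u -> sigma (u * pn) = flag_conj delta u,
      forall u a, unitary_group star u -> DU a -> mu (u * pn) (a * pn) = u * a * pn,
      principal_bundle V Fl G *%R pn mu sigma,
      principal_connection V Fl G mu sigma Phi &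
      (* the tangent space of V at u pn is identified with u u(A) pn by the
         inclusion of V in A, and Phi is the asserted map *)
      [/\ smooth_map V (banach_manifold (realified A)) (id : A -> realified A),
          forall u, unitary_group star u ->
            {in tangent_space V (u * pn) &, injective (velocity V)} /\
            velocity V @` tangent_space V (u * pn) =
              [set u * a * pn | a in skew_adjoint star],
          forall a, skew_adjoint star a -> Du (truncation delta a) &
          forall u a v, unitary_group star u -> skew_adjoint star a ->
            tangent_space V (u * pn) v -> velocity V v = u * a * pn ->
            velocity V (Phi v) = u * truncation delta a * pn]].
Proof.
move=> pn DU Du.
pose E1 := expec_id star.
pose EB := expec_trunc hstar cstar hdelta sdelta.
pose EK := expec_corner hstar cstar hdelta sdelta.
have EB1 : EB 1 = 1 := truncation1 hdelta.
have EBK x : EB (EK x) = EK (EB x) := corner_truncation hstar cstar hdelta sdelta x.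
have EKB x : EB (EK x) = EK x := truncation_corner hstar cstar hdelta sdelta x.
pose pr := right_pn delta.
have prP := right_pn_eqP hstar cstar hdelta sdelta (F := E1).
have prG := right_pn_eqP hstar cstar hdelta sdelta (F := EB).
have prB := flag_conj_eqP hstar cstar hdelta sdelta.
have E11 : E1 1 = 1 by [].
have E1E : in_grp E1 = unitary_group star.
  by apply/seteqP; split=> u []; [move=> ? ? _|]; split.
have L1E : in_lie E1 = skew_adjoint star.
  by apply/seteqP; split=> a; [case|].
have EBE : in_grp EB = DU.
  apply/seteqP; split=> u; first by move=> [? ? /(truncation_fixE hdelta) ?]; split.
  by move=> [[? ?] /(truncation_fixE hdelta) ?]; split.
have LBE : in_lie EB = Du.
  apply/seteqP; split=> a; first by move=> [? /(truncation_fixE hdelta) ?]; split.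
  by move=> [? /(truncation_fixE hdelta) ?]; split.
pose MU := grp_manifold hstar cstar E1.
pose MD := grp_manifold hstar cstar EB.
pose V := total_space hstar cstar EK pr.
pose G := structure_group hstar cstar EBK pr.
pose Fl := base_space hstar cstar EB (flag_conj delta).
exists (range_of (slice_projector hstar cstar (grp_commute0 hstar cstar E1))).
exists (range_of (slice_projector hstar cstar (grp_commute0 hstar cstar EB))).
exists (range_of (slice_projector hstar cstar (EH := E1) (EK := EK) (fun=> erefl))).
exists (range_of (slice_projector hstar cstar EBK)).
exists (range_of (slice_projector hstar cstar (EH := E1) (EK := EB) (fun=> erefl))).
exists MU, MD, V, G, Fl; split.
  split.
  - rewrite -L1E -E1E; split; first exact: grp_carrier.
    exact: grp_unitary_lie_group.
  - rewrite -LBE -EBE; split; first exact: grp_carrier.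
    exact: grp_unitary_lie_group.
  - exact: (grp_quotient_manifold hstar cstar E11 _ prP).
  - exact: (grp_quotient_manifold hstar cstar EB1 EBK prG).
  - exact: (grp_quotient_manifold hstar cstar E11 _ prB).
have prM u v (Bu : in_grp EB u) (Bv : in_grp EB v) : pr (u * v) = pr u * pr v.
  by apply: esym; exact: right_pnM Bv.
have prV u (Bu : in_grp EB u) : star (pr u) = pr (star u) by exact: right_pnV Bu.
have muE u d (Hu : in_grp E1 u) (Bd : in_grp EB d) : pr u * pr d = pr (u * d).
  exact: right_pnM Bd.
have sigE := stiefel_projE hstar cstar hdelta sdelta.
exists (stiefel_proj star delta), *%R, (connection EB pr).
have H2 u : unitary_group star u -> in_grp E1 u by rewrite E1E.
have S2 a : skew_adjoint star a -> in_lie E1 a by rewrite L1E.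
have lpr : cont_linear (pr : realified A -> realified A) by exact: cont_linear_mulr.
have VH := hom_presented hstar cstar E11 (EK := EK) (fun=> erefl) prP.
have velE u a : in_grp E1 u -> in_lie E1 a ->
    velocity V (tpush V (in_grp E1) pr u (u * a)) = u * a * pn.
  move=> Hu la; apply: (velocity_tpush VH lpr Hu).
  exact: (lie_tangent_dir hstar cstar E11).
have velI u a b : in_grp E1 u -> in_lie E1 a -> in_lie E1 b ->
    u * a * pn = u * b * pn ->
    tpush V (in_grp E1) pr u (u * a) = tpush V (in_grp E1) pr u (u * b).
  move=> Hu la lb uab; apply/(total_tpush_eq hstar cstar prP) => //.
  have [sa _] := la; have [sb _] := lb.
  have abp : (a - b) * pn = 0.
    have : star u * (u * a * pn) = star u * (u * b * pn) by rewrite uab.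
    have [_ u2 _] := Hu.
    by rewrite !mulrA u2 !mul1r mulrBl => ->; rewrite subrr.
  (* Since a - b is skew, (a - b) p_n = 0 also gives p_n (a - b) = 0. *)
  apply: (corner_fixE (delta := delta)) => //.
  have := congr1 star abp; rewrite (starM hstar) (star_flag_idem hstar cstar sdelta).
  rewrite (starBW hstar cstar) sa sb (star0W hstar cstar) => pab.
  by apply: oppr_inj; rewrite oppr0 -mulrN opprB addrC -[RHS]pab opprK addrC.
have tanE u v : in_grp E1 u -> tangent_space V (u * pn) v ->
    exists2 a, in_lie E1 a & v = tpush V (in_grp E1) pr u (u * a).
  exact: total_tangentE.
split.
- by move=> u /H2; exact: sigE.
- move=> u a /H2 Hu; rewrite -EBE => Ba; exact: (muE u a Hu Ba).
- have -> : pn = pr 1 by rewrite /pr /right_pn mul1r.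
  exact: (hom_principal_bundle hstar cstar EB1 EBK EKB prP prG prB prM prV muE sigE).
- exact: (hom_principal_connection hstar cstar EB1 EBK EKB prP prB muE sigE).
- split.
  + exact: (smooth_inclusion VH lpr).
  + move=> u /H2 Hu; split.
      move=> v w /set_mem tv /set_mem tw.
      have [a la ->] := tanE _ _ Hu tv; have [b lb ->] := tanE _ _ Hu tw.
      by rewrite !velE//; exact: velI.
    apply/seteqP; split=> [_ [v /(tanE _ _ Hu)[a la ->] <-]|_ [a /S2 la <-]].
      by rewrite velE//; exists a => //; rewrite -L1E.
    exists (tpush V (in_grp E1) pr u (u * a)); last exact: velE.
    exact: (total_tangent hstar cstar prP).
  + move=> a /S2 la; rewrite -LBE; split; last exact: (expec_idem EB).
    by have [sa _] := in_lie_base EB la.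
  + move=> u a v /H2 Hu /S2 la /(tanE _ _ Hu)[b lb ->].
    rewrite velE// => /(velI _ _ _ Hu lb la) ->.
    rewrite (connectionE hstar cstar EB1 EBK EKB prP Hu la) velE//.
    exact: (in_lie_base EB la).
Qed.
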